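(* Consider the problem $\min_{x\in\mathcal X}F(x)$, $F(x)=\frac1n\sum_{i=1}^n f_i(g_i(x))+r(x)$, under the standing assumptions (A1)-(A4) listed in the context (with $\mu\ge0$; neither $f_i$ nor $g_i$ is assumed to be smooth). Let $x_*$ be a minimizer of $F$ over $\mathcal X$. Run ALEXR (described in the context) with $\psi_i=\frac12\|\cdot\|_2^2$, $\theta=0$, and suitable $\eta=O(\frac1\epsilon)$, $\tau=O(\frac1{B\epsilon})$. Then $\mathbb E[F(\bar x_T)-F(x_* )]\le\epsilon$ holds after $$T=O\left(\max\left\{1,\frac{\Omega_{\mathcal Y}^0}{BS}\right\}\epsilon^{-2}\right)$$ iterations, where $\bar x_T=\frac1T\sum_{t=0}^{T-1}x_{t+1}$, $\Omega_{\mathcal Y}^0=\mathbb E[U_\psi(\tilde y_T,y_0)]=\sum_{i=1}^n\mathbb E[U_{\psi_i}(\tilde y_T^{(i)},y_0^{(i)})]$, and $\tilde y_T^{(i)}\in\arg\max_{v\in\mathcal Y_i}\{v^\top g_i(\bar x_T)-f_i^*(v)\}$.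
   Context: **Problem.** $\mathcal X\subseteq\mathbb R^d$, $g_i:\mathcal X\to\mathbb R^m$ with $g_i(x)=\mathbb E_{\zeta_i\sim\mathbb P_i}[g_i(x;\zeta_i)]$, $f_i:\mathbb R^m\to\mathbb R$ deterministic, $i\in[n]=\{1,\dots,n\}$. The norm on $\mathcal X$ is $\|\cdot\|_2$; $\mathbb R^m$ carries a norm $\|\cdot\|$ (dual variables) with dual norm $\|\cdot\|_*$ (values of $g_i$). $f_i^*$ is the convex conjugate of $f_i$, and $\mathcal Y_i=\mathrm{dom} f_i^*\subset\mathbb R^m$, regarded as a convex compact set, so that $f_i(u)=\max_{v\in\mathcal Y_i}\{v^\top u-f_i^*(v)\}$; $\mathcal Y=\mathcal Y_1\times\dots\times\mathcal Y_n\subset\mathbb R^{nm}$, and $y^{(i)}\in\mathbb R^m$ is the $i$-th block of $y\in\mathbb R^{nm}$. **Standing assumptions.** (A1) $\mathcal X$ is closed and convex; $r$ is proper, lower semicontinuous and $\mu$-convex on $\mathcal X$ ($\mu\ge0$), i.e. $r-\frac\mu2\|\cdot\|_2^2$ is convex. (A2) Each $g_i$ is convex (coordinatewise) and $\|g_i(x)-g_i(x')\|_*\le C_g\|x-x'\|_2$ for all $x,x'\in\mathcal X$. (A3) Each $f_i$ is convex and $|f_i(u)-f_i(u')|\le C_f\|u-u'\|_*$ for all $u,u'$. If $g_i$ is not affine, $f_i$ is non-decreasing in each coordinate of its input. (Consequently $\|y^{(i)}\|\le C_f$ on $\mathcal Y_i$, and $\mathcal Y_i\subseteq\mathbb R^m_+$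 in the monotone case.) (A4) There are finite $\sigma_0^2,\sigma_1^2,\delta^2$ such that for all $x\in\mathcal X$, $g_i'(x)\in\partial g_i(x)$, $y\in\mathcal Y$: $\mathbb E_{\zeta_i}\|g_i(x)-g_i(x;\zeta_i)\|_*^2\le\sigma_0^2$; $\mathbb E_{\zeta_i}\|[g_i'(x)]^\top-[g_i'(x;\zeta_i)]^\top\|_{\rm op}^2\le\sigma_1^2$; $\frac1n\sum_{j=1}^n\|[g_j'(x)]^\top y^{(j)}-\frac1n\sum_{i=1}^n[g_i'(x)]^\top y^{(i)}\|_2^2\le\delta^2$. The stochastic (sub)gradients $g_i'(x;\zeta_i)$ are unbiased. **Bregman divergences.** $U_{\psi_i}(u,v)=\psi_i(u)-\psi_i(v)-\langle\nabla\psi_i(v),u-v\rangle$, and $U_\psi(y_1,y_2)=\sum_{i=1}^nU_{\psi_i}(y_1^{(i)},y_2^{(i)})$; for $\psi_i=\frac12\|\cdot\|_2^2$ one has $U_{\psi_i}(u,v)=\frac12\|u-v\|_2^2$. **Algorithm ALEXR.** Parameters $\eta,\tau>0$, $\theta\in[0,1]$, batch sizes $S,B$. Start from $x_{-1}=x_0\in\mathcal X$, $y_0\in\mathcal Y$. For $t=0,1,\dots,T-1$: sample uniformly $\mathcal S_t\subset[n]$ with $|\mathcal S_t|=S$; for each $i\in\mathcal S_t$ draw two independent i.i.d. mini-batches $\mathcal B_t^{(i)},\tilde{\mathcal B}_t^{(i)}$ of size $B$ from $\mathbb P_i$ (mini-batch estimators are averages over the batch), set $\tilde g_t^{(i)}=g_i(x_t;\mathcal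 B_t^{(i)})+\theta\,(g_i(x_t;\mathcal B_t^{(i)})-g_i(x_{t-1};\mathcal B_t^{(i)}))$, $y_{t+1}^{(i)}=\arg\max_{v\in\mathcal Y_i}\{v^\top\tilde g_t^{(i)}-f_i^*(v)-\tau U_{\psi_i}(v,y_t^{(i)})\}$; for $i\notin\mathcal S_t$ set $y_{t+1}^{(i)}=y_t^{(i)}$. Then set $G_t=\frac1S\sum_{i\in\mathcal S_t}[g_i'(x_t;\tilde{\mathcal B}_t^{(i)})]^\top y_{t+1}^{(i)}$ with $g_i'(x_t;\tilde{\mathcal B}_t^{(i)})\in\partial g_i(x_t;\tilde{\mathcal B}_t^{(i)})$, and $x_{t+1}=\arg\min_{x\in\mathcal X}\{\langle G_t,x\rangle+r(x)+\frac\eta2\|x-x_t\|_2^2\}$. Independence holds across iterations and indices. **Asymptotic convention.** The iteration bound means: there is a constant $C$ independent of $n,S,B,\epsilon$ (but possibly depending on $C_f,C_g,\sigma_0,\sigma_1,\delta$, norm-equivalence constants, and the distance of $x_0$ to $x_*$) such that, for all sufficiently small $\epsilon$, the accuracy is attained whenever $T\ge C\max\{1,\Omega_{\mathcal Y}^0/(BS)\}\epsilon^{-2}$, where $\Omega^0_{\mathcal Y}$ is the quantity associated with that run. In the choices $\eta=O(1/\epsilon)$, $\tau=O(1/(B\epsilon))$ the hidden constants may depend on the problem parameters. *)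

(* Defs.v *)
(* MathComp / MathComp-Analysis development. *)
From HB Require Import structures.
From mathcomp Require Import all_boot all_order all_algebra.
From mathcomp Require Import all_classical all_reals all_analysis.
From mathcomp Require Import ring lra.

Set Implicit Arguments.
Unset Strict Implicit.
Unset Printing Implicit Defensive.

Import Order.TTheory GRing.Theory Num.Theory.
Import numFieldNormedType.Exports.

Local Open Scope classical_set_scope.
Local Open Scope ring_scope.

(* The library norm of ['cV[R]_d] is the sup norm, so the Euclidean norm and the
   abstract norm pair on [R^m] are introduced separately; the library topology is
   the usual one. *)
Section norms.
Context {R : realType}.

Definition dotv d (u v : 'cV[R]_d) : R := \sum_(i < d) u i 0 * v i 0.

Definition norm2 d (u : 'cV[R]_d) : R := Num.sqrt (dotv u u).

Definition half_sqnorm d (u : 'cV[R]_d) : R := 2^-1 * norm2 u ^+ 2.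

Record is_norm m (nrm : 'cV[R]_m -> R) : Prop := {
  nrm_triangle : forall u v, nrm (u + v) <= nrm u + nrm v ;
  nrm_homog : forall a u, nrm (a *: u) = `|a| * nrm u ;
  nrm_definite : forall u, nrm u = 0 -> u = 0 }.

Definition dual_norm m (nrm : 'cV[R]_m -> R) (u : 'cV[R]_m) : R :=
  sup [set dotv v u | v in [set v | nrm v <= 1]].

(* Operator norm of [A] as a map from [(R^m, nrm)] to [(R^d, norm2)]. *)
Definition op_norm m d (nrm : 'cV[R]_m -> R) (A : 'M[R]_(d, m)) : R :=
  sup [set norm2 (A *m v) | v in [set v | nrm v <= 1]].

Lemma norm2_sqr d (u : 'cV[R]_d) : norm2 u ^+ 2 = dotv u u.
Proof. by rewrite sqr_sqrtr// sumr_ge0// => i _; rewrite -expr2 sqr_ge0. Qed.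

End norms.

Section convex_analysis.
Context {R : realType}.

Definition is_argmin T (A : set T) (h : T -> \bar R) (a : T) : Prop :=
  A a /\ forall b, A b -> (h a <= h b)%E.

Definition is_argmax T (A : set T) (h : T -> \bar R) (a : T) : Prop :=
  A a /\ forall b, A b -> (h b <= h a)%E.

(* Extended-valued counterpart of [convex_function].  It is used below for
   functions avoiding [-oo] on [A], where all the sums are meaningful. *)
Definition econvex_function d (A : set 'cV[R]_d) (h : 'cV[R]_d -> \bar R) : Prop :=
  forall (t : R) (x y : 'cV[R]_d), 0 <= t <= 1 -> A x -> A y ->
    (h (t *: x + (1 - t) *: y)%R <= t%:E * h x + (1 - t)%:E * h y)%E.

Definition conjugate m (f : 'cV[R]_m -> R) (v : 'cV[R]_m) : \bar R :=
  ereal_sup [set (dotv v u - f u)%:E | u in [set: 'cV[R]_m]].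

Definition conj_dom m (f : 'cV[R]_m -> R) : set 'cV[R]_m :=
  [set v | (conjugate f v < +oo)%E].

(* Subdifferential at [x] of a vector-valued function with domain [D]: row [j] of
   the [m x d] matrix is a subgradient of the [j]-th coordinate. *)
Definition subdiff d m (D : set 'cV[R]_d) (g : 'cV[R]_d -> 'cV[R]_m)
    (x : 'cV[R]_d) : set 'M[R]_(m, d) :=
  [set J | forall x', D x' -> forall j, g x j 0 + (J *m (x' - x)) j 0 <= g x' j 0].

Definition affine_on d m (D : set 'cV[R]_d) (g : 'cV[R]_d -> 'cV[R]_m) : Prop :=
  exists (A : 'M[R]_(m, d)) (b : 'cV[R]_m), forall x, D x -> g x = A *m x + b.

Definition nondecreasing_coord m (f : 'cV[R]_m -> R) : Prop :=
  forall u u' : 'cV[R]_m, (forall j, u j 0 <= u' j 0) -> f u <= f u'.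

Definition bregman m (psi : 'cV[R]_m -> R) (u v : 'cV[R]_m) : R :=
  psi u - psi v - 'D_(u - v) psi v.

Lemma bregman_half_sqnorm m (u v : 'cV[R]_m) :
  bregman (@half_sqnorm R m) u v = half_sqnorm (u - v).
Proof.
pose w := u - v.
have E h : half_sqnorm (h *: w + v) =
    half_sqnorm v + h * dotv w v + 2^-1 * h ^+ 2 * dotv w w.
  rewrite /half_sqnorm !norm2_sqr /dotv !mulr_sumr -!big_split/=.
  by apply: eq_bigr => i _; rewrite !mxE; field.
have Eu : half_sqnorm u = half_sqnorm v + dotv w v + half_sqnorm w.
  have := E 1; rewrite scale1r subrK => ->.
  by rewrite /half_sqnorm !norm2_sqr mul1r expr1n mulr1.
rewrite /bregman Eu -/w.
suff -> : 'D_w (@half_sqnorm R m) v = dotv w v by lra.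
rewrite /derive; apply: cvg_lim => //.
have : (fun h : R => dotv w v + 2^-1 * h * dotv w w) @ 0^'
    --> dotv w v + 2^-1 * 0 * dotv w w.
  apply: cvgD; first exact: cvg_cst.
  apply: cvgM; last exact: cvg_cst.
  by apply: cvgM; [exact: cvg_cst | exact: cvg_within].
rewrite mulr0 mul0r addr0; apply: cvg_trans; apply: near_eq_cvg.
near=> h.
have h0 : h != 0 by near: h; exact: nbhs_dnbhs_neq.
rewrite /= E /GRing.scale/=; field => //.
Unshelve. all: by end_near. Qed.

End convex_analysis.

Section independence.
Local Open Scope ereal_scope.
Context {R : realType} {dO : measure_display} {O : measurableType dO}.

Definition mutual_indep (P : probability O R) (I : eqType)
    (F : I -> set (set O)) : Prop :=
  forall (s : seq I) (E : I -> set O), uniq s ->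
    (forall i, i \in s -> F i (E i)) ->
    P (\big[setI/setT]_(i <- s) E i) = \prod_(i <- s) P (E i).

End independence.

Section problem.
Context {R : realType} {d m n : nat} {dZ : measure_display} {Z : measurableType dZ}.

(* One measurable space [Z] carries all the samples; the laws [law i] differ.
   [gdom] is the domain on which the inner functions are finite and convex and with
   respect to which their subgradients are taken.  It may be [Xset] itself or any
   larger convex set, e.g. an open neighbourhood of [Xset] or the whole space:
   subgradients relative to [Xset] alone are never bounded at a boundary point of [Xset].
   [reg] is the regularizer. *)
Record problem := Problem {
  Xset : set 'cV[R]_d ;
  gdom : set 'cV[R]_d ;
  reg : 'cV[R]_d -> \bar R ;
  fout : 'I_n -> 'cV[R]_m -> R ;
  gin : 'I_n -> 'cV[R]_d -> 'cV[R]_m ;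
  law : 'I_n -> probability Z R ;
  gsamp : 'I_n -> 'cV[R]_d -> Z -> 'cV[R]_m ;
  dgsamp : 'I_n -> 'cV[R]_d -> Z -> 'M[R]_(m, d) }.

Definition Yset (pb : problem) (i : 'I_n) : set 'cV[R]_m := conj_dom (fout pb i).

Definition Fobj (pb : problem) (x : 'cV[R]_d) : \bar R :=
  ((n%:R^-1 * \sum_(i < n) fout pb i (gin pb i x))%:E + reg pb x)%E.

Definition borel_cV := g_sigma_algebraType (@open 'cV[R]_d).

Record oracle_model (pb : problem) : Prop := {
  gsamp_integrable : forall i x j, gdom pb x ->
    (law pb i).-integrable setT (fun z => (gsamp pb i x z j 0%R)%:E) ;
  gsamp_mean : forall i x j, gdom pb x ->
    ('E_(law pb i)[fun z => gsamp pb i x z j 0%R] = (gin pb i x j 0%R)%:E)%E ;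
  dgsamp_sub : forall i x z, Xset pb x ->
    subdiff (gdom pb) (gsamp pb i ^~ z) x (dgsamp pb i x z) ;
  dgsamp_integrable : forall i x j k, Xset pb x ->
    (law pb i).-integrable setT (fun z => (dgsamp pb i x z j k)%:E) ;
  dgsamp_mean : forall i x, Xset pb x -> exists2 J, subdiff (gdom pb) (gin pb i) x J &
    forall j k, ('E_(law pb i)[fun z => dgsamp pb i x z j k] = (J j k)%:E)%E ;
  gsamp_measurable : forall i j,
    measurable_fun (Xset pb `*` [set: Z] : set (borel_cV * Z)%type)
      (fun p => gsamp pb i p.1 p.2 j 0) ;
  dgsamp_measurable : forall i j k,
    measurable_fun (Xset pb `*` [set: Z] : set (borel_cV * Z)%type)
      (fun p => dgsamp pb i p.1 p.2 j k) }.

Record A1 (pb : problem) (mu : R) : Prop := {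
  Xset_closed : closed (Xset pb) ;
  Xset_convex : convex_set (Xset pb) ;
  mu_ge0 : 0 <= mu ;
  reg_proper : (forall x, Xset pb x -> reg pb x != -oo%E) /\
    (exists2 x, Xset pb x & (reg pb x < +oo)%E) ;
  reg_lsc : lower_semicontinuous (reg pb : subspace (Xset pb) -> \bar R) ;
  reg_mu_convex :
    econvex_function (Xset pb) (fun x => reg pb x - (mu / 2 * norm2 x ^+ 2)%:E)%E }.

Record A2 (pb : problem) (nrm : 'cV[R]_m -> R) (Cg : R) : Prop := {
  Xset_gdom : Xset pb `<=` gdom pb ;
  gdom_convex : convex_set (gdom pb) ;
  g_convex : forall i j, convex_function (gdom pb) (fun x => gin pb i x j 0) ;
  g_lipschitz : forall i x x', Xset pb x -> Xset pb x' ->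
    dual_norm nrm (gin pb i x - gin pb i x') <= Cg * norm2 (x - x') }.

(* Convexity of [Yset pb i] is automatic; its compactness is not. *)
Record A3 (pb : problem) (nrm : 'cV[R]_m -> R) (Cf : R) : Prop := {
  f_convex : forall i, convex_function [set: 'cV[R]_m] (fout pb i) ;
  f_lipschitz : forall i u u', `|fout pb i u - fout pb i u'| <= Cf * dual_norm nrm (u - u') ;
  f_monotone : forall i, ~ affine_on (gdom pb) (gin pb i) -> nondecreasing_coord (fout pb i) ;
  Yset_compact : forall i, compact (Yset pb i) }.

Record A4 (pb : problem) (nrm : 'cV[R]_m -> R) (sigma0 sigma1 delta : R) : Prop := {
  value_variance : forall i x, Xset pb x ->
    ('E_(law pb i)[fun z => (dual_norm nrm (gin pb i x - gsamp pb i x z) ^+ 2)%R]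
      <= (sigma0 ^+ 2)%:E)%E ;
  grad_variance : forall i x J, Xset pb x -> subdiff (gdom pb) (gin pb i) x J ->
    ('E_(law pb i)[fun z => (op_norm nrm (J^T - (dgsamp pb i x z)^T) ^+ 2)%R]
      <= (sigma1 ^+ 2)%:E)%E ;
  grad_dissimilarity : forall x (J : 'I_n -> 'M[R]_(m, d)) (y : 'I_n -> 'cV[R]_m),
    Xset pb x -> (forall i, subdiff (gdom pb) (gin pb i) x (J i)) ->
    (forall i, Yset pb i (y i)) ->
    n%:R^-1 * (\sum_(j < n)
      norm2 ((J j)^T *m y j - n%:R^-1 *: (\sum_(i < n) (J i)^T *m y i)) ^+ 2)
      <= delta ^+ 2 }.

End problem.

Arguments problem R d m n {dZ} Z.

Section alexr.
Context {R : realType} {d m n : nat} {dZ : measure_display} {Z : measurableType dZ}.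
Context {dO : measure_display} {O : measurableType dO}.
Variables (pb : problem R d m n Z) (P : probability O R) (S B : nat).

Definition batch_g (i : 'I_n) (x : 'cV[R]_d) (zs : 'I_B -> Z) : 'cV[R]_m :=
  B%:R^-1 *: \sum_(b < B) gsamp pb i x (zs b).

Definition batch_dg (i : 'I_n) (x : 'cV[R]_d) (zs : 'I_B -> Z) : 'M[R]_(m, d) :=
  B%:R^-1 *: \sum_(b < B) dgsamp pb i x (zs b).

(* Index of the independent random inputs: the index set drawn at step [t], the
   [b]-th sample of the first batch of block [i] at step [t], and likewise for the
   second batch. *)
Definition input_index : eqType := (nat + (nat * 'I_n * 'I_B + nat * 'I_n * 'I_B))%type.

Definition input_events (St : nat -> O -> {set 'I_n})
    (zeta zeta' : nat -> 'I_n -> 'I_B -> {RV P >-> Z}) (k : input_index) : set (set O) :=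
  match k with
  | inl t => [set St t @^-1` A | A in setT]
  | inr (inl (t, i, b)) => [set zeta t i b @^-1` A | A in measurable]
  | inr (inr (t, i, b)) => [set zeta' t i b @^-1` A | A in measurable]
  end.

(* Batches are attached to every [i]; only those with [i \in St t] are used. *)
Record alexr_inputs (St : nat -> O -> {set 'I_n})
    (zeta zeta' : nat -> 'I_n -> 'I_B -> {RV P >-> Z}) : Prop := {
  St_measurable : forall t (A : {set 'I_n}), measurable (St t @^-1` [set A]) ;
  St_card : forall t w, #|St t w| = S ;
  St_uniform : forall t (A : {set 'I_n}), #|A| = S ->
    P (St t @^-1` [set A]) = ('C(n, S)%:R^-1)%:E ;
  zeta_law : forall t i b A, measurable A -> distribution P (zeta t i b) A = law pb i A ;
  zeta'_law : forall t i b A, measurable A ->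
    distribution P (zeta' t i b) A = law pb i A ;
  inputs_indep : mutual_indep P (input_events St zeta zeta') }.

Variables (psi : 'I_n -> 'cV[R]_m -> R) (theta eta tau : R).
Variables (x0 : 'cV[R]_d) (y0 : 'I_n -> 'cV[R]_m).

(* [x t.-1] is [x (t - 1)] for [0 < t] and [x 0] for [t = 0], i.e. the initial
   convention [x_{-1} = x_0]. *)
Record alexr_iterates (St : nat -> O -> {set 'I_n})
    (zeta zeta' : nat -> 'I_n -> 'I_B -> O -> Z)
    (x : nat -> O -> 'cV[R]_d) (y : nat -> O -> 'I_n -> 'cV[R]_m) : Prop := {
  x0_in : Xset pb x0 ;
  y0_in : forall i, Yset pb i (y0 i) ;
  x_init : forall w, x 0%N w = x0 ;
  y_init : forall w i, y 0%N w i = y0 i ;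
  y_step : forall t w i, i \in St t w ->
    let zs := fun b => zeta t i b w in
    let gt := batch_g i (x t w) zs +
              theta *: (batch_g i (x t w) zs - batch_g i (x t.-1 w) zs) in
    is_argmax (Yset pb i)
      (fun v => (dotv v gt)%:E - conjugate (fout pb i) v
                - (tau * bregman (psi i) v (y t w i))%:E)%E
      (y t.+1 w i) ;
  y_stay : forall t w i, i \notin St t w -> y t.+1 w i = y t w i ;
  x_step : forall t w,
    let G := S%:R^-1 *: \sum_(i in St t w)
      ((batch_dg i (x t w) (fun b => zeta' t i b w))^T *m y t.+1 w i) in
    is_argmin (Xset pb)
      (fun u => (dotv G u)%:E + reg pb u
                + (eta / 2 * norm2 (u - x t w) ^+ 2)%:E)%E
      (x t.+1 w) }.

Definition xbar (x : nat -> O -> 'cV[R]_d) (T : nat) (w : O) : 'cV[R]_d :=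
  T%:R^-1 *: \sum_(0 <= t < T) x t.+1 w.

(* A measurable selection of dual maximizers at the random point [xb]. *)
Record dual_selection (xb : O -> 'cV[R]_d) (yt : O -> 'I_n -> 'cV[R]_m) : Prop := {
  yt_measurable : forall i j, measurable_fun [set: O] (fun w => yt w i j 0) ;
  yt_argmax : forall w i, is_argmax (Yset pb i)
    (fun v => (dotv v (gin pb i (xb w)))%:E - conjugate (fout pb i) v)%E (yt w i) }.

Definition OmegaY (yt : O -> 'I_n -> 'cV[R]_m) : \bar R :=
  ('E_P[fun w => (\sum_(i < n) bregman (psi i) (yt w i) (y0 i))%R])%E.

End alexr.

(* Main.v *)
(* All norms are compared with the Euclidean one. Writing f_i(u) as the maximum of
   <v, u> - f_i^*(v) turns F(xbar) - F(xs) into the average over t of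
   L(x_{t+1}, ytilde) - L(xs, ybar_t), where ybar_t is the dual update that all blocks
   would make at step t.

   Dual part. The three-point inequality of the proximal step bounds the dual terms by
   tau (n/S) (|ytilde - y_t|^2 - |ytilde - y_{t+1}|^2) / 2, which telescopes, plus
   <ytilde, a_t>, where a_t collects the sampling error of S_t and the error of the
   batch. Since ytilde depends on the whole run, <ytilde, a_t> does not average out;
   Young's inequality bounds the sum over t of <ytilde - y_0, a_t> by
   tau (n/S) |ytilde - y_0|^2 + |sum_t a_t|^2 / (4 tau n/S), and the a_t are orthogonal
   martingale differences. Half of the term tau |ybar_t - y_t|^2 / 2 of the proximal step
   absorbs the sampling error, the rest leaves sigma_0^2 / (tau B) per step.

   Primal part. Subgradient and three-point inequalities, in which <G_t, x_t - x_{t+1}>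
   must be bounded. The Lipschitz constant of g_i on X does not bound its subgradients
   at boundary points of X, but the variance assumption, which holds for every
   subgradient, bounds the diameter of the subdifferential by 2 sigma_1; hence, by a
   limit of subgradients along the segment from x_t to x_{t+1}, every subgradient J of
   g_i at x_t satisfies <y, J (x_t - x_{t+1})> = O(|x_t - x_{t+1}|) for dual points y.

   In total, E[F(xbar) - F(xs)] is at most
   (eta |x_0 - xs|^2 / 2 + 3 tau Omega / S) / T + O(1 / (tau B)) + O(1 / eta). *)
Require Import Defs.
From HB Require Import structures.
From mathcomp Require Import all_boot all_order all_algebra.
From mathcomp Require Import all_classical all_reals all_analysis.
From mathcomp Require Import measurable_realfun ring lra.

Import Order.TTheory GRing.Theory Num.Theory.
Import numFieldNormedType.Exports.

Local Open Scope classical_set_scope.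
Local Open Scope ring_scope.

Set Implicit Arguments.
Unset Strict Implicit.
Unset Printing Implicit Defensive.

(** * Euclidean geometry and proximal steps *)

Section euclid.
Context {R : realType}.
Implicit Types (d m : nat).

(** The iterates are known only as minimizers, so their measurability must be proved. A proximal
    point is a nonexpansive function of the point reached by the preceding explicit step, and such a
    function of a measurable vector is measurable. This also handles [yfull], which is a mere choice
    on blocks that are not drawn: it turns out to be determined before the draw, which is what
    centres the sampling error.

    Conditional expectations are avoided. For each set of revealed inputs the sample space is given
    the sigma-algebra they generate, and the expectation over a fresh input becomes an integral
    against a product measure.

    Centring and orthogonality require square integrability. For dual points it follows from
    boundedness, the conjugate of a Lipschitz function having a bounded domain; for [x t] it is
    obtained by induction on [t], as [Xset] may be unbounded.

    The primal error carries no factor [n / S]: the direction is an average over the drawn blocks,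
    so a bound valid for every block passes to it. Finally, [F(xbar) - F(xs)] is not shown to be
    measurable; it is nonnegative, and its integral is compared as a supremum over simple
    functions. *)

Lemma dotvC d (u v : 'cV[R]_d) : dotv u v = dotv v u.
Proof. by apply: eq_bigr => i _; rewrite mulrC. Qed.

Lemma dotvDl d (u v w : 'cV[R]_d) : dotv (u + v) w = dotv u w + dotv v w.
Proof. by rewrite -big_split; apply: eq_bigr => i _; rewrite mxE mulrDl. Qed.

Lemma dotvZl d a (u v : 'cV[R]_d) : dotv (a *: u) v = a * dotv u v.
Proof. by rewrite mulr_sumr; apply: eq_bigr => i _; rewrite mxE mulrA. Qed.

Lemma dotvDr d (u v w : 'cV[R]_d) : dotv w (u + v) = dotv w u + dotv w v.
Proof. by rewrite dotvC dotvDl !(dotvC w). Qed.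

Lemma dotvZr d a (u v : 'cV[R]_d) : dotv u (a *: v) = a * dotv u v.
Proof. by rewrite dotvC dotvZl dotvC. Qed.

Lemma dotvNl d (u v : 'cV[R]_d) : dotv (- u) v = - dotv u v.
Proof. by rewrite -scaleN1r dotvZl mulN1r. Qed.

Lemma dotvNr d (u v : 'cV[R]_d) : dotv u (- v) = - dotv u v.
Proof. by rewrite dotvC dotvNl dotvC. Qed.

Lemma dotvBl d (u v w : 'cV[R]_d) : dotv (u - v) w = dotv u w - dotv v w.
Proof. by rewrite dotvDl dotvNl. Qed.

Lemma dotvBr d (u v w : 'cV[R]_d) : dotv w (u - v) = dotv w u - dotv w v.
Proof. by rewrite dotvDr dotvNr. Qed.

Lemma dotv0l d (u : 'cV[R]_d) : dotv 0 u = 0.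
Proof. by rewrite -(scale0r 0) dotvZl mul0r. Qed.

Lemma dotv0r d (u : 'cV[R]_d) : dotv u 0 = 0.
Proof. by rewrite dotvC dotv0l. Qed.

Definition dotvE := (dotvDl, dotvDr, dotvNl, dotvNr, dotvZl, dotvZr).

Lemma dotv_suml d I (s : seq I) (P : pred I) (F : I -> 'cV[R]_d) v :
  dotv (\sum_(i <- s | P i) F i) v = \sum_(i <- s | P i) dotv (F i) v.
Proof.
by elim/big_rec2: _ => [|i x y _ <-]; rewrite ?dotv0l ?dotvDl.
Qed.

Lemma dotv_sumr d I (s : seq I) (P : pred I) (F : I -> 'cV[R]_d) v :
  dotv v (\sum_(i <- s | P i) F i) = \sum_(i <- s | P i) dotv v (F i).
Proof. by rewrite dotvC dotv_suml; apply: eq_bigr => i _; rewrite dotvC. Qed.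

Lemma dotv_ge0 d (u : 'cV[R]_d) : 0 <= dotv u u.
Proof. by apply: sumr_ge0 => i _; rewrite -expr2 sqr_ge0. Qed.

Lemma dotv_mulmx d m (A : 'M[R]_(m, d)) (y : 'cV[R]_m) (v : 'cV[R]_d) :
  dotv (A^T *m y) v = dotv y (A *m v).
Proof.
have E k (a b : 'cV[R]_k) : dotv a b = (a^T *m b) 0 0.
  by rewrite mxE; apply: eq_bigr => i _; rewrite mxE.
by rewrite !E trmx_mul trmxK mulmxA.
Qed.

Lemma norm2_ge0 d (u : 'cV[R]_d) : 0 <= norm2 u.
Proof. exact: sqrtr_ge0. Qed.

Lemma norm2Z d a (u : 'cV[R]_d) : norm2 (a *: u) = `|a| * norm2 u.
Proof.
rewrite /norm2 dotvZl dotvZr mulrA -expr2 sqrtrM ?sqr_ge0//.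
by rewrite sqrtr_sqr.
Qed.

Lemma norm2N d (u : 'cV[R]_d) : norm2 (- u) = norm2 u.
Proof. by rewrite -scaleN1r norm2Z normrN1 mul1r. Qed.

Lemma norm2_distC d (u v : 'cV[R]_d) : norm2 (u - v) = norm2 (v - u).
Proof. by rewrite -norm2N opprB. Qed.

Lemma norm2_0 d : norm2 (0 : 'cV[R]_d) = 0.
Proof. by rewrite -(scale0r 0) norm2Z normr0 mul0r. Qed.

Lemma norm2_eq0 d (u : 'cV[R]_d) : norm2 u = 0 -> u = 0.
Proof.
move=> u0; have : dotv u u = 0 by rewrite -norm2_sqr u0 expr0n.
move/eqP; rewrite psumr_eq0 => [|i _]; last by rewrite -expr2 sqr_ge0.
move=> /allP uu; apply/matrixP => i j; rewrite ord1 mxE.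
by have := uu i (mem_index_enum _); rewrite mulf_eq0 orbb => /eqP.
Qed.

Lemma dotv_young d a (u v : 'cV[R]_d) : 0 < a ->
  dotv u v <= a / 2 * dotv u u + dotv v v / (2 * a).
Proof.
move=> a0; have := dotv_ge0 (a *: u - v).
rewrite !dotvE (dotvC v u) => H.
have -> : a / 2 * dotv u u + dotv v v / (2 * a) =
  (a * (a * dotv u u) + dotv v v) / (2 * a) by field; rewrite gt_eqF.
rewrite ler_pdivlMr; last by rewrite mulr_gt0.
by lra.
Qed.

Lemma cauchy_schwarz d (u v : 'cV[R]_d) : dotv u v <= norm2 u * norm2 v.
Proof.
have [u0|u0] := eqVneq (norm2 u) 0.
  by rewrite (norm2_eq0 u0) dotv0l norm2_0 mul0r.
have [v0|v0] := eqVneq (norm2 v) 0.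
  by rewrite (norm2_eq0 v0) dotv0r norm2_0 mulr0.
have up : 0 < norm2 u by rewrite lt_neqAle eq_sym u0 norm2_ge0.
have vp : 0 < norm2 v by rewrite lt_neqAle eq_sym v0 norm2_ge0.
(* With the weight [norm2 v / norm2 u] both terms of Young's inequality equal half of
   [norm2 u * norm2 v]. *)
have := dotv_young u v (divr_gt0 vp up); rewrite -!norm2_sqr => /le_trans; apply.
rewrite le_eqVlt; apply/orP; left; apply/eqP; field.
by rewrite u0 v0.
Qed.

Lemma norm2D d (u v : 'cV[R]_d) : norm2 (u + v) <= norm2 u + norm2 v.
Proof.
rewrite -(@ler_pXn2r _ 2%N)// ?nnegrE ?addr_ge0 ?norm2_ge0//.
rewrite norm2_sqr !dotvE (dotvC v u) sqrrD !norm2_sqr.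
by have := cauchy_schwarz u v; lra.
Qed.

Lemma ler_dotvN d (u v : 'cV[R]_d) : - dotv u v <= norm2 u * norm2 v.
Proof. by rewrite -dotvNl -(norm2N u) cauchy_schwarz. Qed.

Lemma coord_le_norm2 d (u : 'cV[R]_d) i : `|u i 0| <= norm2 u.
Proof.
rewrite -sqrtr_sqr ler_sqrt ?dotv_ge0// /dotv (bigD1 i)//= expr2 lerDl.
by apply: sumr_ge0 => j _; rewrite -expr2 sqr_ge0.
Qed.

Lemma norm2_le_sum d (u : 'cV[R]_d) : norm2 u <= \sum_(i < d) `|u i 0|.
Proof.
have s0 : 0 <= \sum_(i < d) `|u i 0| by apply: sumr_ge0.
rewrite -(@ler_pXn2r _ 2%N)// ?nnegrE ?norm2_ge0// norm2_sqr expr2 mulr_suml.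
apply: ler_sum => i _; apply: le_trans (ler_norm _) _; rewrite normrM ler_wpM2l//.
by rewrite (bigD1 i)//= lerDl sumr_ge0.
Qed.

Lemma norm2_mulmx d m (A : 'M[R]_(d, m)) :
  exists2 C, 0 <= C & forall v : 'cV[R]_m, norm2 (A *m v) <= C * norm2 v.
Proof.
exists (\sum_(i < d) \sum_(j < m) `|A i j|) => [|v].
  by apply: sumr_ge0 => i _; apply: sumr_ge0.
apply: le_trans (norm2_le_sum _) _; rewrite mulr_suml; apply: ler_sum => i _.
rewrite mxE mulr_suml; apply: le_trans (ler_norm_sum _ _ _) _.
by apply: ler_sum => j _; rewrite normrM ler_wpM2l// coord_le_norm2.
Qed.

Lemma sqrD_le d (u v : 'cV[R]_d) :
  dotv (u + v) (u + v) <= 2 * dotv u u + 2 * dotv v v.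
Proof. by have := dotv_ge0 (u - v); rewrite !dotvE (dotvC v u); lra. Qed.

Lemma sqnDZ d s (u v : 'cV[R]_d) :
  dotv (u + s *: v) (u + s *: v) = dotv u u + 2 * s * dotv u v + s ^+ 2 * dotv v v.
Proof. by rewrite !dotvE (dotvC v u); ring. Qed.

(** The difference of the two sides is the weighted sum of squared distances of the [u i] to their
    mean [s]. *)
Lemma jensen_sqnorm d (I : finType) (c : I -> R) (u : I -> 'cV[R]_d) :
  (forall i, 0 <= c i) -> \sum_i c i = 1 ->
  dotv (\sum_i c i *: u i) (\sum_i c i *: u i) <= \sum_i c i * dotv (u i) (u i).
Proof.
move=> c0 c1.
have E (s : 'cV[R]_d) : \sum_i c i * dotv (u i - s) (u i - s) =
    \sum_i c i * dotv (u i) (u i) - 2 * dotv (\sum_i c i *: u i) s + (\sum_i c i) * dotv s s.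
  rewrite dotv_suml mulr_sumr mulr_suml -sumrB -big_split/=; apply: eq_bigr => i _.
  by rewrite dotvZl !dotvBl !dotvBr (dotvC s (u i)); ring.
set s := \sum_i c i *: u i.
have : 0 <= \sum_i c i * dotv (u i - s) (u i - s).
  by apply: sumr_ge0 => i _; rewrite mulr_ge0// dotv_ge0.
by rewrite E c1 -/s; lra.
Qed.

End euclid.

(** * Comparison of the dual and operator norms with the Euclidean norm *)

Section norm_comparison.
Context {R : realType} {m : nat} {nrm : 'cV[R]_m -> R} {k1 k2 : R}.
Hypothesis nrmP : is_norm nrm.
Hypothesis k1_gt0 : 0 < k1.
Hypothesis nrm_bounds : forall u : 'cV[R]_m, k1 * norm2 u <= nrm u <= k2 * norm2 u.
(** For [m = 0] the bounds do not force [k2] to be positive; the maximum with [1] gives a constant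
    by which one can divide. *)
Let k := Num.max k2 1.

Let k_gt0 : 0 < k.
Proof. by rewrite lt_max ltr01 orbT. Qed.

Let nrm_le_norm2 u : nrm u <= k * norm2 u.
Proof.
have /andP[_ /le_trans] := nrm_bounds u; apply.
by rewrite ler_wpM2r ?norm2_ge0// le_max lexx.
Qed.

Let unit_ball_norm2 u : nrm u <= 1 -> norm2 u <= k1^-1.
Proof.
move=> u1; rewrite -[leRHS]mul1r ler_pdivlMr// mulrC.
by have /andP[/le_trans h _] := nrm_bounds u; exact: h.
Qed.

Let nrm0 : nrm 0 = 0.
Proof. by rewrite -(scale0r 0) nrm_homog// normr0 mul0r. Qed.

Lemma dual_norm_le (u : 'cV[R]_m) : dual_norm nrm u <= k1^-1 * norm2 u.
Proof.
apply: ge_sup => [|_ [v /= v1 <-]]; first by exists (dotv 0 u), 0 => //=; rewrite nrm0.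
apply: le_trans (cauchy_schwarz _ _) _.
by rewrite ler_wpM2r ?norm2_ge0// unit_ball_norm2.
Qed.

(** The supremum is tested at [u / (k * norm2 u)], which lies in the unit ball. A real [sup]
    dominates the elements of its set only if the set is bounded, hence [ub]. *)
Lemma norm2_le_dual (u : 'cV[R]_m) : norm2 u <= k * dual_norm nrm u.
Proof.
have ub : has_sup [set dotv v u | v in [set v | nrm v <= 1]].
  split; first by exists (dotv 0 u), 0 => //=; rewrite nrm0.
  exists (k1^-1 * norm2 u) => _ [v /= v1 <-]; apply: le_trans (cauchy_schwarz _ _) _.
  by rewrite ler_wpM2r ?norm2_ge0// unit_ball_norm2.
have [u0|u0] := eqVneq (norm2 u) 0.
  rewrite u0 mulr_ge0 ?(ltW k_gt0)//; apply: sup_upper_bound => //.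
  by exists 0; rewrite /= ?nrm0 ?dotv0l.
have u_gt0 : 0 < norm2 u by rewrite lt_neqAle eq_sym u0 norm2_ge0.
rewrite -ler_pdivrMl//; apply: sup_upper_bound => //.
exists ((k * norm2 u)^-1 *: u) => /=.
  apply: le_trans (nrm_le_norm2 _) _.
  rewrite norm2Z gtr0_norm ?invr_gt0 ?mulr_gt0// le_eqVlt; apply/orP; left.
  by apply/eqP; field; rewrite u0 gt_eqF.
by rewrite dotvZl -norm2_sqr; field; rewrite u0 gt_eqF.
Qed.

Lemma norm2_mulmx_op d (A : 'M[R]_(d, m)) (v : 'cV[R]_m) :
  norm2 (A *m v) <= k * norm2 v * op_norm nrm A.
Proof.
have [C C0 AC] := norm2_mulmx A.
have ub : has_sup [set norm2 (A *m v) | v in [set v | nrm v <= 1]].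
  split; first by exists (norm2 (A *m 0)), 0 => //=; rewrite nrm0.
  exists (C * k1^-1) => _ [w /= w1 <-]; apply: le_trans (AC _) _.
  by rewrite ler_wpM2l// unit_ball_norm2.
have [v0|v0] := eqVneq (norm2 v) 0.
  by rewrite v0 (norm2_eq0 v0) mulmx0 norm2_0 mulr0 mul0r.
have v_gt0 : 0 < norm2 v by rewrite lt_neqAle eq_sym v0 norm2_ge0.
have kv : 0 < k * norm2 v by rewrite mulr_gt0.
rewrite -ler_pdivrMl//; apply: sup_upper_bound => //.
exists ((k * norm2 v)^-1 *: v) => /=.
  apply: le_trans (nrm_le_norm2 _) _.
  rewrite norm2Z gtr0_norm ?invr_gt0 ?mulr_gt0// le_eqVlt; apply/orP; left.
  by apply/eqP; field; rewrite v0 gt_eqF.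
by rewrite -scalemxAr norm2Z gtr0_norm// invr_gt0.
Qed.

End norm_comparison.

(** * Convex functions and optimality of proximal points *)

Section convexity.
Context {R : realType} {d : nat}.
Implicit Types (A : set 'cV[R]_d) (phi : 'cV[R]_d -> R).

(** Convexity of the set is part of the notion because it is used with effective domains,
    [conj_dom f] and [reg_dom pb], whose convexity results from the same inequality as that of the
    function. *)
Definition convex_on A phi := forall (t : R) x y, 0 <= t <= 1 -> A x -> A y ->
  A (t *: x + (1 - t) *: y) /\
  phi (t *: x + (1 - t) *: y) <= t * phi x + (1 - t) * phi y.

Lemma convex_set_comb A (t : R) x y : convex_set A -> 0 <= t <= 1 -> A x -> A y ->
  A (t *: x + (1 - t) *: y).
Proof.
move=> cA /andP[t0 t1] /mem_set Ax /mem_set Ay.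
exact: set_mem (cA x y (Itv01 t0 t1) Ax Ay).
Qed.

Lemma convex_function_comb A phi (t : R) x y : convex_function A phi ->
  0 <= t <= 1 -> A x -> A y ->
  phi (t *: x + (1 - t) *: y) <= t * phi x + (1 - t) * phi y.
Proof.
move=> cphi /andP[t0 t1] /mem_set Ax /mem_set Ay.
exact: (cphi (Itv01 t0 t1) x y Ax Ay).
Qed.

Lemma convex_on_mean A phi (x : nat -> 'cV[R]_d) T : convex_on A phi -> (0 < T)%N ->
  (forall t, (t < T)%N -> A (x t)) ->
  A (T%:R^-1 *: \sum_(0 <= t < T) x t) /\
  phi (T%:R^-1 *: \sum_(0 <= t < T) x t) <= T%:R^-1 * \sum_(0 <= t < T) phi (x t).
Proof.
move=> cphi; elim: T => // -[|T] IH _ xA.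
  by rewrite !big_nat1 invr1 scale1r mul1r; split => //; exact: xA.
have [|AT phiT] := IH isT; first by move=> t tT; apply: xA; exact: ltnW.
rewrite !(big_nat_recr T.+1)//=.
set s := \sum_(0 <= t < T.+1) x t; set p := \sum_(0 <= t < T.+1) phi (x t).
(* The mean of [T.+2] points is the combination, with weight [a], of the mean of the first [T.+1]
   points and the last point. *)
pose a : R := T.+1%:R / T.+2%:R.
have TN : T.+2%:R = T.+1%:R + 1 :> R by rewrite -natr1.
have T1 : 0 < T.+1%:R :> R by [].
have a01 : 0 <= a <= 1.
  by rewrite divr_ge0//= ler_pdivrMr ?mul1r ?ler_nat.
have := cphi a _ (x T.+1) a01 AT (xA _ (ltnSn _)).
have -> : a *: (T.+1%:R^-1 *: s) + (1 - a) *: x T.+1 = T.+2%:R^-1 *: (s + x T.+1).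
  rewrite scalerA scalerDr; congr (_ *: _ + _ *: _); rewrite /a TN; field.
    by rewrite !gt_eqF// addr_gt0.
  by rewrite gt_eqF// addr_gt0.
move=> [? phi_le]; split=> //; apply: (le_trans phi_le).
have -> : T.+2%:R^-1 * (p + phi (x T.+1)) = a * (T.+1%:R^-1 * p) + (1 - a) * phi (x T.+1).
  by rewrite /a TN; field; rewrite !gt_eqF// addr_gt0.
by rewrite lerD2r ler_wpM2l//; case/andP: a01.
Qed.

Lemma prox_ineq A phi (a : R) (c G z : 'cV[R]_d) : convex_on A phi -> A z ->
  (forall u, A u -> phi z + dotv G z + a / 2 * dotv (z - c) (z - c) <=
    phi u + dotv G u + a / 2 * dotv (u - c) (u - c)) ->
  forall u, A u -> phi z + dotv G (z - u) - phi u <= a * dotv (z - c) (u - z).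
Proof.
move=> cphi Az zmin u Au; rewrite leNgt; apply/negP => lt.
pose D := dotv (u - z) (u - z).
pose e := phi z + dotv G (z - u) - phi u - a * dotv (z - c) (u - z).
have e_gt0 : 0 < e by rewrite subr_gt0.
pose b := `|a| / 2 * D + 1.
have b_gt0 : 0 < b.
  by rewrite ltr_wpDl// mulr_ge0 ?dotv_ge0// divr_ge0.
(* Small enough for the quadratic remainder, at most [s * b] after division by [s], to stay below
   [e / 2]. *)
pose s := Num.min 1 (e / (2 * b)).
have s_gt0 : 0 < s by rewrite lt_min ltr01 divr_gt0// mulr_gt0.
have s_le1 : s <= 1 by rewrite ge_min lexx.
have sb : s * b <= e / 2.
  have : s <= e / (2 * b) by rewrite ge_min lexx orbT.
  by rewrite ler_pdivlMr ?mulr_gt0//; lra.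
have s01 : 0 <= s <= 1 by rewrite ltW.
have [Aw phiw] := cphi s u z s01 Au Az.
have := zmin _ Aw; move: phiw.
have -> : s *: u + (1 - s) *: z = z + s *: (u - z).
  by rewrite scalerBr scalerBl scale1r addrCA.
have -> : z + s *: (u - z) - c = (z - c) + s *: (u - z) by rewrite addrAC.
rewrite sqnDZ -/D (dotvDr _ _ G) (dotvZr _ G) => phi_le H.
have Gzu : dotv G (z - u) = - dotv G (u - z) by rewrite -dotvNr opprB.
have aD : a / 2 * D <= b.
  by rewrite /b ler_wpDr// ler_wpM2r ?dotv_ge0// ler_wpM2r// ler_norm.
have : s * e <= s * (s * (a / 2 * D)) by rewrite /e Gzu; lra.
rewrite ler_pM2l// => e_le.
have : s * (a / 2 * D) <= s * b by rewrite ler_pM2l.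
by lra.
Qed.

(** Adding the optimality inequalities of [z] and [z'], each tested at the other point, eliminates
    [phi] and leaves [dotv w w <= dotv q w]. This gives uniqueness of proximal points and, later,
    their measurability. *)
Lemma prox_nonexpansive A phi (a : R) (c c' G G' z z' : 'cV[R]_d) : 0 < a ->
  convex_on A phi -> A z -> A z' ->
  (forall u, A u -> phi z + dotv G z + a / 2 * dotv (z - c) (z - c) <=
    phi u + dotv G u + a / 2 * dotv (u - c) (u - c)) ->
  (forall u, A u -> phi z' + dotv G' z' + a / 2 * dotv (z' - c') (z' - c') <=
    phi u + dotv G' u + a / 2 * dotv (u - c') (u - c')) ->
  norm2 (z - z') <= norm2 ((c - a^-1 *: G) - (c' - a^-1 *: G')).
Proof.
move=> a0 cphi Az Az' zmin zmin'.
have := prox_ineq cphi Az zmin Az'; have := prox_ineq cphi Az' zmin' Az.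
set q := (_ - _ *: G) - _; set w := z - z'.
rewrite -(opprB z z') -/w !dotvNr => H2 H1.
have wE : dotv w w = dotv (z - c) w - dotv (z' - c') w + dotv c w - dotv c' w.
  by rewrite {1}/w !dotvBl; ring.
have qE : a * dotv q w = a * dotv c w - a * dotv c' w - dotv G w + dotv G' w.
  by rewrite /q !dotvBl !dotvZl; field; rewrite gt_eqF.
have : a * dotv w w <= a * dotv q w by rewrite qE wE; lra.
rewrite ler_pM2l// => H; have [->|w0] := eqVneq (norm2 w) 0; first exact: norm2_ge0.
have wp : 0 < norm2 w by rewrite lt_neqAle eq_sym w0 norm2_ge0.
rewrite -(ler_pM2r wp) -expr2 norm2_sqr; apply: (le_trans H).
exact: cauchy_schwarz.
Qed.

End convexity.

(** * Conjugate functions *)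

Section topology_aux.
Context {R : realType}.

Lemma continuous_sumr (T : topologicalType) I (s : seq I) (F : I -> T -> R) :
  (forall i, continuous (F i)) -> continuous (fun x => \sum_(i <- s) F i x).
Proof.
move=> F_cont; elim: s => [|i s IH] x.
  by under eq_fun do rewrite big_nil; exact: cvg_cst.
under eq_fun do rewrite big_cons.
by apply: cvgD; [exact: F_cont|exact: IH].
Qed.

Lemma row_coord_le n (v : 'rV[R]_n) j : `|v 0 j| <= `|v|.
Proof.
rewrite [leRHS]/Num.Def.normr/= mx_normrE.
by apply: (le_bigmax _ (fun p : 'I_1 * 'I_n => `|v p.1 p.2|) (0, j)).
Qed.

End topology_aux.

Section conjugate_function.
Context {R : realType} {m : nat} (f : 'cV[R]_m -> R) (L : R).
Hypothesis f_convex : convex_function [set: 'cV[R]_m] f.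
Hypothesis L_ge0 : 0 <= L.
Hypothesis f_lip : forall u u', `|f u - f u'| <= L * norm2 (u - u').

Definition conjr (v : 'cV[R]_m) : R := fine (conjugate f v).

Lemma conjugateE v : conj_dom f v -> conjugate f v = (conjr v)%:E.
Proof.
move=> vY; rewrite fineK// fin_numE (lt_eqF vY) andbT gt_eqF//.
apply: (@lt_le_trans _ _ (dotv v 0 - f 0)%:E); first exact: ltNyr.
by apply: ereal_sup_ubound; exists 0.
Qed.

Lemma fenchel_young v u : conj_dom f v -> dotv v u - f u <= conjr v.
Proof.
move=> vY; rewrite -lee_fin -conjugateE//.
by apply: ereal_sup_ubound; exists u.
Qed.

Lemma conjr_le v c : (forall u, dotv v u - f u <= c) -> conj_dom f v /\ conjr v <= c.
Proof.
move=> vc; have vc' : (conjugate f v <= c%:E)%E.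
  by apply: ge_ereal_sup => _ [u _ <-]; rewrite lee_fin.
have vY : conj_dom f v by apply: le_lt_trans vc' (ltry _).
by split => //; rewrite -lee_fin -conjugateE.
Qed.

(** Fenchel-Young at [s *: v] gives [s * norm2 v * (norm2 v - L) <= conjr v + f 0], which fails for
    large [s] if [norm2 v] exceeds [L]. *)
Lemma conj_dom_norm2 v : conj_dom f v -> norm2 v <= L.
Proof.
move=> vY; rewrite leNgt; apply/negP => Lv.
pose b := norm2 v * (norm2 v - L).
have b0 : 0 < b by rewrite mulr_gt0 ?subr_gt0//; exact: le_lt_trans Lv.
pose s := (`|conjr v + f 0| + 1) / b.
have s0 : 0 < s by rewrite divr_gt0// ltr_wpDl.
have := le_trans (ler_norm _) (f_lip (s *: v) 0).
have := fenchel_young (s *: v) vY.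
rewrite subr0 norm2Z gtr0_norm// dotvZr -norm2_sqr => H1 H2.
have sb : s * b = `|conjr v + f 0| + 1 by rewrite /s divfK// gt_eqF.
have := ler_norm (conjr v + f 0); move: sb; rewrite /b; lra.
Qed.

(** If [v j 0] were negative, moving [u] to minus infinity along the [j]-th axis would make
    [dotv v u] unbounded while [f u] stays below [f 0]. *)
Lemma conj_dom_ge0 v j : nondecreasing_coord f -> conj_dom f v -> 0 <= v j 0.
Proof.
move=> f_mono vY; rewrite leNgt; apply/negP => vj.
pose s := (`|conjr v + f 0| + 1) / (- v j 0).
have s0 : 0 < s by rewrite divr_gt0 ?oppr_gt0// ltr_wpDl.
pose u : 'cV[R]_m := - s *: delta_mx j 0.
have fu : f u <= f 0.
  apply: f_mono => l; rewrite !mxE eqxx andbT; case: eqP => _.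
    by rewrite mulr1 oppr_le0 ltW.
  by rewrite mulr0.
have vu : dotv v u = - s * v j 0.
  rewrite dotvZr; congr (_ * _); rewrite /dotv (bigD1 j)//= mxE !eqxx mulr1.
  rewrite big1 ?addr0// => i ij; rewrite mxE (negbTE ij)/= mulr0//.
have := fenchel_young u vY; rewrite vu mulNr -mulrN /s divfK; last first.
  by rewrite oppr_eq0 lt_eqF.
by have := ler_norm (conjr v + f 0); lra.
Qed.

Lemma conjr_convex : convex_on (conj_dom f) conjr.
Proof.
move=> t x y /andP[t0 t1] xY yY; apply: conjr_le => u.
have := ler_wpM2l t0 (fenchel_young u xY).
have t1' : 0 <= 1 - t by rewrite subr_ge0.
have := ler_wpM2l t1' (fenchel_young u yY).
by rewrite dotvDl !dotvZl; lra.
Qed.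

Lemma norm2_tr_le (v : 'rV[R]_m) : norm2 v^T <= m%:R * `|v|.
Proof.
apply: le_trans (norm2_le_sum _) _.
have -> : m%:R * `|v| = \sum_(i < m) `|v| by rewrite sumr_const card_ord mulr_natl.
by apply: ler_sum => i _; rewrite mxE row_coord_le.
Qed.

(** Minimization of a continuous function over a compact sublevel set, carried out on row vectors,
    to which [bounded_closed_compact] applies. *)
Lemma exists_prox a c : 0 < a -> exists w, forall u,
  f w + a / 2 * dotv (w - c) (w - c) <= f u + a / 2 * dotv (u - c) (u - c).
Proof.
move=> a0.
pose h (v : 'rV[R]_m) := f v^T + a / 2 * dotv (v^T - c) (v^T - c).
have f_cont : continuous (fun v : 'rV[R]_m => f v^T).
  move=> v; apply/(@cvgrPdist_le _ _ _ (nbhs v)) => e e0.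
  have b0 : 0 < L * m%:R + 1 by rewrite ltr_wpDl// mulr_ge0.
  have eb0 : 0 < (L * m%:R + 1)^-1 * e by rewrite mulr_gt0// invr_gt0.
  have near_v : \forall w \near v, `|v - w| <= (L * m%:R + 1)^-1 * e.
    by apply/nbhs_ballP; exists ((L * m%:R + 1)^-1 * e) => //= w; rewrite -ball_normE => /ltW.
  near=> w.
  apply: le_trans (f_lip _ _) _; rewrite -linearB/=.
  apply: (@le_trans _ _ (L * (m%:R * `|v - w|))); first by rewrite ler_wpM2l// norm2_tr_le.
  apply: (@le_trans _ _ ((L * m%:R + 1) * `|v - w|)).
    by rewrite mulrA ler_wpM2r// lerDl.
  by rewrite -ler_pdivlMl//; near: w.
have h_cont : continuous h.
  move=> v; apply: (@cvgD _ _ _ (nbhs v)); first exact: (f_cont v).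
  apply: (@cvgM _ _ (nbhs v)); first exact: (@cvg_cst _ _ _ (nbhs v)).
  apply: continuous_sumr => i w.
  have Ci : {for w, continuous (fun w : 'rV[R]_m => (w^T - c) i 0)}.
    rewrite [X in {for _, continuous X}](_ : _ = fun w : 'rV[R]_m => w 0 i - c i 0).
      by apply: (@cvgB _ _ _ (nbhs w));
        [exact: (@coord_continuous R 1 m 0 i w)|exact: (@cvg_cst _ _ _ (nbhs w))].
    by apply/funext => z; rewrite !mxE.
  by apply: (@cvgM _ _ (nbhs w)).
pose A := [set v | h v <= h c^T].
have A_closed : closed A.
  apply: (@closed_comp _ _ h [set r | r <= h c^T]) => [v _|]; first exact: h_cont.
  exact: closed_le.
have A_bounded : bounded_set A.
  (* On the sublevel set [a / 2 * norm2 (v - c) ^+ 2 <= f c - f v <= L * norm2 (v - c)], hence the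
     radius [2 * L / a] around [c]. *)
  exists (`|c^T| + 2 * L / a); split; first by rewrite num_real.
  move=> r rlt v; rewrite /A/= /h trmxK subrr dotv0l mulr0 addr0 => hv.
  apply: le_trans (ltW rlt); rewrite -[v](subrK c^T) addrC.
  apply: le_trans (ler_normD _ _) _; rewrite lerD2l.
  have vc : norm2 (v^T - c) <= 2 * L / a.
    have [->|z0] := eqVneq (norm2 (v^T - c)) 0.
      by rewrite divr_ge0 ?mulr_ge0// ltW.
    have zp : 0 < norm2 (v^T - c) by rewrite lt_neqAle eq_sym z0 norm2_ge0.
    rewrite ler_pdivlMr// -(ler_pM2l zp).
    have := le_trans (ler_norm _) (f_lip c v^T); rewrite norm2_distC => H.
    move: hv; rewrite -norm2_sqr expr2; lra.
  apply: le_trans vc; rewrite [leLHS]/Num.Def.normr/= mx_normrE; apply: bigmax_le.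
    exact: norm2_ge0.
  move=> [i j] _ /=; rewrite ord1 (_ : (v - c^T) 0 j = (v^T - c) j 0) ?coord_le_norm2//.
  by rewrite !mxE.
have [|||w wA wmin] := @compact_EVT_min _ _ h A.
- by exists c^T; rewrite /A/=.
- exact: bounded_closed_compact.
- exact: continuous_subspaceT.
exists w^T => u; have [hu|/ltW hu] := leP (h u^T) (h c^T).
  by have := wmin u^T (mem_set hu); rewrite /h trmxK.
have := wmin c^T (mem_set (lexx _)) => /le_trans/(_ hu).
by rewrite /h trmxK.
Unshelve. all: by end_near. Qed.

(* Moreau: the residual of a proximal step of [f] is a subgradient of [f]. *)
Lemma conj_dom_prox a c w : 0 < a ->
  (forall u, f w + a / 2 * dotv (w - c) (w - c) <= f u + a / 2 * dotv (u - c) (u - c)) ->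
  let v := a *: (c - w) in
  conj_dom f v /\ conjr v = dotv v w - f w.
Proof.
move=> a0 wmin v.
have cf : convex_on [set: 'cV[R]_m] f.
  by move=> t x y t01 _ _; split => //; exact: convex_function_comb.
have vu u : dotv v u - f u <= dotv v w - f w.
  have : f w + dotv 0 (w - u) - f u <= a * dotv (w - c) (u - w).
    by apply: (@prox_ineq _ _ setT f a c 0 w cf I) => // u' _; rewrite !dotv0l !addr0.
  by rewrite -(opprB c w) dotv0l dotvNl /v !dotvZl dotvBr; lra.
have [vY vle] := conjr_le vu; split=> //; apply/eqP.
by rewrite eq_le vle fenchel_young.
Qed.

(** Moreau's decomposition: existence is transferred from [f], which is finite and continuous. If
    [w] is the proximal point of [f] at [c = g + tau y] with parameter [tau^-1], the residual
    [(c - w) / tau] solves the problem for the conjugate. *)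
Lemma exists_conj_prox tau (g y : 'cV[R]_m) : 0 < tau ->
  exists2 v, conj_dom f v & forall v', conj_dom f v' ->
    conjr v + dotv (- g) v + tau / 2 * dotv (v - y) (v - y) <=
    conjr v' + dotv (- g) v' + tau / 2 * dotv (v' - y) (v' - y).
Proof.
move=> tau0; pose c := g + tau *: y.
have a0 : 0 < tau^-1 by rewrite invr_gt0.
have [w wmin] := exists_prox c a0.
have [vY vE] := conj_dom_prox a0 wmin.
set v := tau^-1 *: (c - w) in vY vE; exists v => // v' v'Y.
have := fenchel_young w v'Y; rewrite vE.
have gE : g = tau *: (v - y) + w.
  by apply/matrixP => i j; rewrite !mxE; field; rewrite gt_eqF.
have -> : v' - y = (v - y) + 1 *: (v' - v).
  by apply/matrixP => i j; rewrite !mxE; ring.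
rewrite sqnDZ !dotvNl (_ : dotv g v' = dotv g v + dotv g (v' - v)); last first.
  by rewrite -dotvDr addrC subrK.
rewrite [dotv g (v' - v)](_ : _ = tau * dotv (v - y) (v' - v) + dotv v' w - dotv v w).
  by have := dotv_ge0 (v' - v); nra.
by rewrite {1}gE dotvDl dotvZl [dotv w _]dotvBr !(dotvC w) addrA.
Qed.

(** One half of biconjugation. The residual [v'] of a proximal step of [f] from [u] attains the
    conjugate at the new point [w]. As [norm2 v' <= L], the point [w] is within [L / a] of [u], so
    for large [a] the vector [v'] is optimal at [u] up to [e], and [v] does at least as well. *)
Lemma conjr_argmax u v : conj_dom f v ->
  (forall v', conj_dom f v' -> dotv v' u - conjr v' <= dotv v u - conjr v) ->
  f u <= dotv v u - conjr v.
Proof.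
move=> vY vmax; apply/ler_addgt0Pr => e e0.
pose a := (2 * L * L + 1) / e.
have b0 : 0 < 2 * L * L + 1 by rewrite ltr_wpDl// !mulr_ge0.
have a0 : 0 < a by rewrite divr_gt0.
have [w wmin] := exists_prox u a0.
have [v'Y v'E] := conj_dom_prox a0 wmin.
set v' := a *: (u - w) in v'Y v'E.
have := vmax _ v'Y; rewrite v'E.
have : f u - f w <= L * norm2 (u - w) := le_trans (ler_norm _) (f_lip u w).
have : 0 <= dotv v' u - dotv v' w.
  by rewrite -dotvBr /v' dotvZl mulr_ge0 ?dotv_ge0// ltW.
have : L * norm2 (u - w) <= e.
  have : norm2 v' <= L by exact: conj_dom_norm2.
  rewrite norm2Z gtr0_norm// => H.
  have : a * (L * norm2 (u - w)) <= a * e.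
    rewrite {2}/a divfK ?gt_eqF//; have := ler_wpM2l L_ge0 H; have := mulr_ge0 L_ge0 L_ge0.
    by lra.
  by rewrite ler_pM2l.
lra.
Qed.

End conjugate_function.

(** * Subdifferentials of bounded diameter *)

Section subdifferential.
Context {R : realType} {d m : nat}.
Variables (X D : set 'cV[R]_d) (g : 'cV[R]_d -> 'cV[R]_m) (K L : R).
Hypothesis X_convex : convex_set X.
Hypothesis XD : X `<=` D.
Hypothesis K_ge0 : 0 <= K.
Hypothesis subdiff_diam : forall x J J', X x -> subdiff D g x J -> subdiff D g x J' ->
  forall y : 'cV[R]_m, norm2 ((J - J')^T *m y) <= K * norm2 y.
Hypothesis subdiff_nonempty : forall x, X x -> exists J, subdiff D g x J.
Hypothesis g_lip : forall x x', X x -> X x' -> norm2 (g x - g x') <= L * norm2 (x - x').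

Let L_ge0 x x' : X x -> X x' -> 0 <= L * norm2 (x - x').
Proof. by move=> Xx Xx'; apply: le_trans (norm2_ge0 _) (g_lip Xx Xx'). Qed.

Let comb x x' (s : R) : X x -> X x' -> 0 <= s <= 1 -> X (x + s *: (x' - x)).
Proof.
move=> Xx Xx' s01; have -> : x + s *: (x' - x) = s *: x' + (1 - s) *: x.
  by apply/matrixP => i j; rewrite !mxE; ring.
exact: convex_set_comb.
Qed.

(* Subgradients at [x + s (x' - x)], rescaled to norm at most [1], accumulate as
   [s] tends to [0]; [a = 0] would make [Q] normal to [D] at [x]. *)
Let limit_direction x x' : X x -> X x' ->
  exists (Q : 'M[R]_(m, d)) (a : R),
    [/\ `|mxvec Q| + a = 1, 0 <= a,
        (forall w, D w -> forall j, (Q *m (w - x)) j 0 <= a * (g w j 0 - g x j 0)) &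
        (forall y : 'cV[R]_m, (forall j, 0 <= y j 0) ->
          - (a * (L * norm2 y * norm2 (x' - x))) <= dotv y (Q *m (x' - x)))].
Proof.
move=> Xx Xx'; set v := x' - x.
pose s k : R := k.+1%:R^-1.
have s_gt0 k : 0 < s k by rewrite invr_gt0.
have s01 k : 0 <= s k <= 1 by rewrite ltW//= invf_le1// ler1n.
pose z k := x + s k *: v.
have Xz k : X (z k) by exact: comb.
have [J JP] : exists J : nat -> 'M[R]_(m, d), forall k, subdiff D g (z k) (J k).
  exists (fun k => xget 0 [set J | subdiff D g (z k) J]) => k.
  exact: (xgetPex 0 (subdiff_nonempty (Xz k))).
(* The scaling gives [|q k| + c k = 1]: the pairs stay in a compact set and their limit cannot
   vanish, however large the subgradients are. *)
pose c k : R := (1 + `|mxvec (J k)|)^-1.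
have c_gt0 k : 0 < c k by rewrite invr_gt0 ltr_pwDl.
have c_le1 k : c k <= 1 by rewrite invf_le1 ?lerDl// ltr_pwDl.
pose q k : 'rV[R]_(m * d) := c k *: mxvec (J k).
have qc k : `|q k| + c k = 1.
  by rewrite normrZ gtr0_norm// -[X in _ + X]mulr1 -mulrDr addrC mulVf// gt_eqF// ltr_pwDl.
pose F : set_system ('rV[R]_(m * d) * R) := (fun k => (q k, c k)) @ \oo.
pose BQ := [set u : 'rV[R]_(m * d) | `|u| <= 1].
have BQ_compact : compact BQ.
  apply: bounded_closed_compact; first exists 1.
    by split => [|r r1 u /le_trans]; [exact: num_real|apply; exact: ltW].
  apply: (@closed_comp _ _ (fun u : 'rV[R]_(m * d) => `|u|) [set r | r <= 1]); last exact: closed_le.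
  by move=> u _; exact: norm_continuous.
have FB : F (BQ `*` `[0, 1]%classic).
  exists 0%N => // k _ /=; split; last by rewrite /= in_itv/= (ltW (c_gt0 k)) c_le1.
  by rewrite /BQ/= -(qc k) lerDl ltW.
have [[u a] [[/= _ a01] clu]] :=
  compact_setX BQ_compact (@segment_compact R 0 1) _ FB.
(* No subsequence is extracted: a closed condition that holds eventually also holds at a cluster
   point. *)
have in_closed (C : set ('rV[R]_(m * d) * R)) : closed C ->
    (\forall k \near \oo, C (q k, c k)) -> C (u, a).
  by move=> C_closed FC; apply: C_closed => B; exact: clu.
have in_sublevel (h : 'rV[R]_(m * d) * R -> R) r : continuous h ->
    (\forall k \near \oo, h (q k, c k) <= r) -> h (u, a) <= r.
  move=> h_cont; apply: (in_closed [set p | h p <= r]).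
  by apply: (@closed_comp _ _ h [set x | x <= r]) => [p _|]; [exact: h_cont|exact: closed_le].
have snd_cont : continuous (snd : 'rV[R]_(m * d) * R -> R) by move=> p; exact: cvg_snd.
have coord_cont i : continuous (fun p : 'rV[R]_(m * d) * R => p.1 0 i).
  by move=> p; apply: (@cvg_comp _ _ _ fst (fun u : 'rV[R]_(m * d) => u 0 i) _ (nbhs p.1));
    [exact: cvg_fst|exact: (@coord_continuous R 1 (m * d) 0 i p.1)].
have mulmx_cont (w : 'cV[R]_d) j :
    continuous (fun p : 'rV[R]_(m * d) * R => (vec_mx p.1 *m w) j 0).
  have -> : (fun p : 'rV[R]_(m * d) * R => (vec_mx p.1 *m w) j 0) =
      fun p => \sum_(k < d) p.1 0 (mxvec_index j k) * w k 0.
    by apply/funext => p; rewrite mxE; apply: eq_bigr => k _; rewrite mxE.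
  apply: continuous_sumr => k p; apply: (@cvgM _ _ (nbhs p)); first exact: coord_cont.
  exact: (@cvg_cst _ _ _ (nbhs p)).
have cont_sub (h h' : 'rV[R]_(m * d) * R -> R) :
    continuous h -> continuous h' -> continuous (fun p => h p - h' p).
  by move=> hc hc' p; apply: (@cvgB _ _ _ (nbhs p)); [exact: hc|exact: hc'].
have cont_scale r (h : 'rV[R]_(m * d) * R -> R) :
    continuous h -> continuous (fun p => r * h p).
  by move=> hc p; apply: (@cvgM _ _ (nbhs p)); [exact: (@cvg_cst _ _ _ (nbhs p))|exact: hc].
have JzE k w : D w -> forall j,
    c k * (J k *m (w - z k)) j 0 <= c k * (g w j 0 - g (z k) j 0).
  by move=> Dw j; rewrite ler_pM2l// lerBrDl; exact: JP.
have qE k (w : 'cV[R]_d) j : (vec_mx (q k) *m w) j 0 = c k * (J k *m w) j 0.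
  by rewrite /q linearZ/= mxvecK -scalemxAl mxE.
exists (vec_mx u), a; split.
- rewrite vec_mxK; apply: (in_closed [set p | `|p.1| + p.2 = 1]).
    apply: (@closed_comp _ _ (fun p : 'rV[R]_(m * d) * R => `|p.1| + p.2) [set r | r = 1]).
      move=> p _; apply: (@cvgD _ _ _ (nbhs p)); last exact: snd_cont.
      by apply: (@cvg_norm _ _ _ (nbhs p)); exact: cvg_fst.
    exact: closed_eq.
  by exists 0%N => // k _; exact: qc.
- by move: a01; rewrite in_itv/= => /andP[].
- move=> w Dw j; rewrite -subr_le0 [a * _]mulrC; apply/ler_addgt0Pr => e e0; rewrite add0r.
  apply: (in_sublevel (fun p => (vec_mx p.1 *m (w - x)) j 0 - (g w j 0 - g x j 0) * p.2)).
    by apply: cont_sub; [exact: mulmx_cont|exact: cont_scale].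
  pose C : R := \sum_l `|v l 0| + L * norm2 v.
  have C0 : 0 <= C by rewrite addr_ge0 ?sumr_ge0//; exact: L_ge0.
  exists (Num.trunc (C / e)) => // k /= kN.
  have sC : s k * C <= e.
    rewrite /s ler_pdivrMl// mulrC -ler_pdivrMl// mulrC ltW//.
    apply: lt_le_trans (truncnS_gt _) _.
    by rewrite ler_nat ltnS.
  apply: le_trans sC.
  have -> : (vec_mx (q k) *m (w - x)) j 0 =
      (vec_mx (q k) *m (w - z k)) j 0 + s k * (vec_mx (q k) *m v) j 0.
    have -> : w - x = (w - z k) + s k *: v.
      by apply/matrixP => i l; rewrite !mxE; ring.
    by rewrite mulmxDr -scalemxAr [LHS]mxE [X in _ + X]mxE.
  rewrite qE.
  have := JzE k w Dw j.
  have : (vec_mx (q k) *m v) j 0 <= \sum_l `|v l 0|.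
    rewrite mxE; apply: ler_sum => l _; apply: le_trans (ler_norm _) _.
    rewrite normrM ler_piMl// mxE; apply: le_trans (row_coord_le _ _) _.
    by rewrite -(qc k) lerDl ltW.
  rewrite -(ler_pM2l (s_gt0 k)).
  have : c k * (g x j 0 - g (z k) j 0) <= s k * (L * norm2 v).
    apply: (@le_trans _ _ `|(g x - g (z k)) j 0|).
      apply: le_trans (ler_norm _) _; rewrite !mxE normrM gtr0_norm//.
      by rewrite ler_piMl.
    apply: le_trans (coord_le_norm2 _ _) _; apply: le_trans (g_lip Xx (Xz k)) _.
    rewrite opprD addrA subrr sub0r norm2N norm2Z gtr0_norm//.
    by rewrite mulrCA.
  by rewrite /C; lra.
- move=> y y0; rewrite -subr_le0 [a * _]mulrC -mulNr.
  apply: (in_sublevel (fun p =>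
    - (L * norm2 y * norm2 v) * p.2 - dotv y (vec_mx p.1 *m v))).
    apply: cont_sub; first exact: cont_scale.
    by apply: continuous_sumr => j; apply: cont_scale; exact: mulmx_cont.
  exists 0%N => // k _ /=.
  have -> : dotv y (vec_mx (q k) *m v) = c k * dotv y (J k *m v).
    by rewrite mulr_sumr; apply: eq_bigr => j _; rewrite qE mulrCA.
  rewrite subr_le0 mulrC ler_pM2l// -(ler_pM2l (s_gt0 k)) -dotvZr scalemxAr.
  (* The subgradient inequality at [z k], tested back at [x], bounds the slope in direction [v] from
     below by a difference quotient along the segment, where the Lipschitz constant on [X]
     applies. *)
  apply: (@le_trans _ _ (dotv y (g (z k) - g x))).
    rewrite mulrN lerNl; apply: le_trans (ler_dotvN _ _) _.
    apply: le_trans (ler_wpM2l (norm2_ge0 y) (g_lip (Xz k) Xx)) _.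
    rewrite [z k]addrC addrK norm2Z gtr0_norm//.
    by rewrite le_eqVlt; apply/orP; left; apply/eqP; ring.
  apply: ler_sum => j _; rewrite ler_wpM2l//.
  have := JP k x (XD Xx) j.
  have -> : x - z k = - (s k *: v) by rewrite opprD addrA subrr sub0r.
  by rewrite mulmxN !mxE; lra.
Qed.

(** This is the delicate direction: adding to [J] a matrix normal to [D] at [x] can only increase
    the left-hand side. The limit [Q] satisfies the bound with [a * L] in place of [L + K], and
    bounded diameter places [Q] within [a * K] of [a *: J]; dividing by [a] gives the claim. *)
Lemma subdiff_lower x x' J (y : 'cV[R]_m) : X x -> X x' -> subdiff D g x J ->
  (forall j, 0 <= y j 0) ->
  dotv y (J *m (x - x')) <= (L + K) * norm2 y * norm2 (x - x').
Proof.
move=> Xx Xx' JP y0; have [Q [a [Qa1 a0 QD Qy]]] := limit_direction Xx Xx'.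
have QJ (w : 'cV[R]_m) : norm2 ((Q - a *: J)^T *m w) <= a * (K * norm2 w).
  apply/ler_addgt0Pr => e e0.
  pose k := (Num.trunc (K * norm2 w / e)).+1.
  have k_gt0 : 0 < k%:R :> R by [].
  have ke : K * norm2 w <= k%:R * e.
    by rewrite -ler_pdivrMr// ltW// truncnS_gt.
  have b0 : 0 < 1 + k%:R * a by rewrite ltr_pwDl// mulr_ge0.
  (* [J + k Q] obeys the subgradient inequality scaled by [1 + k a], so [J'] is a subgradient; its
     distance to [J] tends to that between [Q / a] and [J] when [a > 0], and grows like [k] when
     [a = 0]. *)
  pose J' := (1 + k%:R * a)^-1 *: (J + k%:R *: Q).
  have J'P : subdiff D g x J'.
    move=> z Dz j; have := JP _ Dz j; have := QD _ Dz j.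
    have -> : (J' *m (z - x)) j 0 =
        (1 + k%:R * a)^-1 * ((J *m (z - x)) j 0 + k%:R * (Q *m (z - x)) j 0).
      by rewrite -scalemxAl mulmxDl -scalemxAl [LHS]mxE [X in _ * X]mxE [X in _ * (_ + X)]mxE.
    move=> /(ler_wpM2l (ltW k_gt0)) H1 H2.
    by rewrite -lerBrDl ler_pdivrMl//; lra.
  have := subdiff_diam Xx J'P JP w.
  have -> : J' - J = (k%:R / (1 + k%:R * a)) *: (Q - a *: J).
    by apply/matrixP => i j; rewrite !mxE; field; rewrite gt_eqF.
  rewrite linearZ/= -scalemxAl norm2Z gtr0_norm ?divr_gt0// mulrAC ler_pdivrMr// => H.
  rewrite -(ler_pM2l k_gt0); apply: (le_trans H); lra.
(* For [a = 0] the bound [QJ] would force [Q = 0], against the normalization. *)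
have a_gt0 : 0 < a.
  rewrite lt_neqAle a0 andbT eq_sym; apply/eqP => a_eq0.
  suff Q0 : Q = 0 by move: Qa1; rewrite Q0 a_eq0 linear0 normr0 addr0; lra.
  apply/matrixP => i j; rewrite mxE.
  have := QJ (delta_mx i 0); rewrite a_eq0 scale0r subr0 mul0r => H.
  have /norm2_eq0 : norm2 (Q^T *m (delta_mx i 0 : 'cV[R]_m)) = 0.
    by apply/eqP; rewrite eq_le H norm2_ge0.
  by rewrite -colE => /matrixP/(_ j 0); rewrite !mxE.
have := Qy y y0; rewrite -(opprB x x') mulmxN dotvNr norm2N lerNr opprK => H1.
have := ler_dotvN ((Q - a *: J)^T *m y) (x - x').
rewrite dotv_mulmx mulmxBl -scalemxAl dotvBr dotvZr => H2.
have H3 := ler_wpM2r (norm2_ge0 (x - x')) (QJ y).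
rewrite -(ler_pM2l a_gt0); lra.
Qed.

(* [J - A] is normal to [D] at [x], so adding multiples of it stays in the subdifferential. *)
Lemma subdiff_affine A b x J : (forall w, D w -> g w = A *m w + b) -> X x ->
  subdiff D g x J -> J = A.
Proof.
move=> gE Xx JP; pose E := J - A.
have ED w : D w -> forall j, (E *m (w - x)) j 0 <= 0.
  move=> Dw j; have := JP _ Dw j; rewrite (gE _ Dw) (gE _ (XD Xx)).
  have -> : E *m (w - x) = J *m (w - x) - (A *m w - A *m x).
    by rewrite /E mulmxBl mulmxBr; congr (_ - _); rewrite mulmxBr.
  by rewrite [in X in X -> _]mxE [in X in _ <= X -> _]mxE [X in _ -> X <= _]mxE
    [X in _ -> _ + X <= _]mxE [X in _ -> _ - X <= _]mxE [X in _ -> _ - (_ + X) <= _]mxE; lra.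
have Ek k : subdiff D g x (J + k%:R *: E).
  move=> w Dw j; apply: le_trans (JP _ Dw j); rewrite lerD2l mulmxDl -scalemxAl.
  by rewrite [leLHS]mxE [X in _ + X]mxE gerDl mulr_ge0_le0// ED.
suff E0 : E = 0 by apply/eqP; rewrite -subr_eq0 -/E E0.
have E_bound y k : k%:R * norm2 (E^T *m y) <= K * norm2 y.
  have := subdiff_diam Xx (Ek k) JP y.
  by rewrite [J + _]addrC addrK linearZ/= -scalemxAl norm2Z ger0_norm.
apply/matrixP => i j; rewrite mxE.
have /norm2_eq0 : norm2 (E^T *m (delta_mx i 0 : 'cV[R]_m)) = 0.
  apply/eqP; rewrite eq_le norm2_ge0 andbT leNgt; apply/negP => n0.
  have := E_bound (delta_mx i 0)
    (Num.trunc (K * norm2 (delta_mx i 0 : 'cV[R]_m) / norm2 (E^T *m (delta_mx i 0 : 'cV[R]_m)))).+1.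
  by rewrite -ler_pdivlMr// leNgt truncnS_gt.
by rewrite -colE => /matrixP/(_ j 0); rewrite !mxE.
Qed.

Hypothesis g_convex : forall j, convex_function D (fun x => g x j 0).
Variable f : 'cV[R]_m -> R.
Hypothesis f_monotone : ~ affine_on D g -> nondecreasing_coord f.

(** Dual points may have negative coordinates when [g] is affine; then [J] is the linear part and
    equality holds. Otherwise [f] is monotone, the coordinates of [y] are nonnegative and weight the
    coordinatewise inequalities. The next two lemmas split in the same way. *)
Lemma dual_subgradient_ineq y x x' J : conj_dom f y -> X x -> D x' ->
  subdiff D g x J -> dotv y (g x - g x') <= dotv y (J *m (x - x')).
Proof.
move=> yY Xx Dx' JP; have [[A [b gE]]|naff] := pselect (affine_on D g).
  rewrite (subdiff_affine gE Xx JP) (gE _ (XD Xx)) (gE _ Dx').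
  by rewrite opprD addrACA subrr addr0 mulmxBr.
apply: ler_sum => j _; rewrite ler_wpM2l//; first exact: conj_dom_ge0 (f_monotone naff) yY.
by have := JP _ Dx' j; rewrite -(opprB x x') mulmxN !mxE; lra.
Qed.

Lemma dual_subgradient_upper y x x' J : conj_dom f y -> X x -> X x' ->
  subdiff D g x J -> dotv y (J *m (x - x')) <= (L + K) * norm2 y * norm2 (x - x').
Proof.
move=> yY Xx Xx' JP; have [[A [b gE]]|naff] := pselect (affine_on D g).
  rewrite (subdiff_affine gE Xx JP).
  have -> : A *m (x - x') = g x - g x'.
    by rewrite (gE _ (XD Xx)) (gE _ (XD Xx')) opprD addrACA subrr addr0 mulmxBr.
  apply: le_trans (cauchy_schwarz _ _) _.
  have := ler_wpM2l (norm2_ge0 y) (g_lip Xx Xx').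
  have : 0 <= K * norm2 y * norm2 (x - x') by rewrite !mulr_ge0 ?norm2_ge0.
  by lra.
by apply: subdiff_lower => // j; exact: conj_dom_ge0 (f_monotone naff) yY.
Qed.

Lemma dual_dotv_convex y t x x' : conj_dom f y -> 0 <= t <= 1 -> X x -> X x' ->
  dotv y (g (t *: x + (1 - t) *: x')) <= t * dotv y (g x) + (1 - t) * dotv y (g x').
Proof.
move=> yY t01 Xx Xx'; have [[A [b gE]]|naff] := pselect (affine_on D g).
  have Xt := convex_set_comb X_convex t01 Xx Xx'.
  rewrite (gE _ (XD Xt)) (gE _ (XD Xx)) (gE _ (XD Xx')).
  by rewrite mulmxDr -!scalemxAr !dotvDr !dotvZr; lra.
rewrite !mulr_sumr -big_split/=; apply: ler_sum => j _.
have := ler_wpM2l (conj_dom_ge0 j (f_monotone naff) yY)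
  (convex_function_comb (g_convex j) t01 (XD Xx) (XD Xx')).
by lra.
Qed.

End subdifferential.

(** * Independence *)

Section integration_aux.
Local Open Scope ereal_scope.
Context {R : realType} d (T : measurableType d) (mu : {measure set T -> \bar R}).

Import HBNNSimple.

(* No measurability: the integral of a nonnegative function is a supremum over
   the simple functions below it. *)
Lemma ge0_le_integralW (f g : T -> \bar R) : (forall x, 0 <= f x) ->
  (forall x, f x <= g x) -> \int[mu]_x f x <= \int[mu]_x g x.
Proof.
move=> f0 fg; have g0 x : 0 <= g x by apply: le_trans (f0 x) (fg x).
rewrite !ge0_integralTE//; apply: le_ereal_sup => _ [h /= hf <-].
by exists h => // x; exact: le_trans (hf x) (fg x).
Qed.

Lemma measurable_integral2 d2 (T2 : measurableType d2) (nu : {sigma_finite_measure set T2 -> \bar R})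
    (f : (T * T2)%type -> \bar R) : measurable_fun [set: (T * T2)%type] f ->
  measurable_fun setT (fun x => \int[nu]_y f (x, y)).
Proof.
move=> mf.
have -> : (fun x => \int[nu]_y f (x, y)) =
    (fun x => \int[nu]_y f^\+ (x, y)) \- (fun x => \int[nu]_y f^\- (x, y)).
  apply/funext=> x; rewrite [LHS]integralE.
  under eq_integral do rewrite funepos_comp/=.
  by under [X in _ - X = _]eq_integral do rewrite funeneg_comp/=.
apply: emeasurable_funB.
  by apply: (measurable_fun_fubini_tonelli_F (f^\+)) => //; exact: measurable_funepos.
by apply: (measurable_fun_fubini_tonelli_F (f^\-)) => //; exact: measurable_funeneg.
Qed.

End integration_aux.

Section product_rule.
Local Open Scope ereal_scope.
Context {R : realType} {dO d1 d2} {O : measurableType dO} {T1 : measurableType d1}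
  {T2 : measurableType d2}.
Variables (P : probability O R) (nu : probability T2 R) (X : O -> T1) (Y : O -> T2).
Hypothesis mX : measurable_fun setT X.
Hypothesis mY : measurable_fun setT Y.
Hypothesis XY : forall A B, measurable A -> measurable B ->
  P (X @^-1` A `&` Y @^-1` B) = P (X @^-1` A) * nu B.

Let X' : {mfun O >-> T1} := HB.pack X (isMeasurableFun.Build _ _ _ _ X mX).
Let mXY : measurable_fun setT (fun w => (X w, Y w)) := measurable_fun_pair mX mY.
Let XY' : {mfun O >-> (T1 * T2)%type} :=
  HB.pack (fun w => (X w, Y w)) (isMeasurableFun.Build _ _ _ _ _ mXY).

Let jointE A : measurable A -> (distribution P X' \x nu) A = distribution P XY' A.
Proof. by apply: product_measure_unique => A1 A2 mA1 mA2; exact: XY. Qed.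

(** By uniqueness of the product measure on rectangles, the law of [(X, Y)] is the product of the
    law of [X] and [nu]; the rest is Tonelli. *)
Lemma integral_indep_ge0 (h : T1 * T2 -> \bar R) : measurable_fun setT h ->
  (forall p, 0 <= h p) ->
  \int[P]_w h (X w, Y w) = \int[P]_w \int[nu]_z h (X w, z).
Proof.
move=> mh h0; transitivity (\int[distribution P XY']_p h p).
  by rewrite ge0_integral_pushforward.
transitivity (\int[distribution P X' \x nu]_p h p).
  apply: eq_measure_integral => A mA _; first [exact: jointE|exact: esym (jointE mA)].
rewrite fubini_tonelli1// /distribution ge0_integral_pushforward//.
- exact: measurable_fun_fubini_tonelli_F.
- by move=> x _; exact: integral_ge0.
Qed.

Lemma integral_indep_eq0 (h : T1 * T2 -> R) : measurable_fun setT h ->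
  P.-integrable setT (fun w => (h (X w, Y w))%:E) ->
  (forall x, \int[nu]_z (h (x, z))%:E = 0) ->
  \int[P]_w (h (X w, Y w))%:E = 0.
Proof.
move=> mh ih h0; have mEh : measurable_fun setT (EFin \o h) by exact/measurable_EFinP.
have ih' : (pushforward P XY').-integrable setT (EFin \o h).
  by apply: integrable_pushforward.
transitivity (\int[pushforward P XY']_p (h p)%:E).
  by rewrite (integral_pushforward mXY mEh).
have iprod : (distribution P X' \x nu).-integrable setT (EFin \o h).
  apply/integrableP; split => //; move/integrableP : ih' => [_]; apply: le_lt_trans.
  rewrite (eq_measure_integral (distribution P XY'))// => A mA _; first [exact: jointE|exact: esym (jointE mA)].
transitivity (\int[distribution P X' \x nu]_p (h p)%:E).
  apply: eq_measure_integral => A mA _; first [exact: jointE|exact: esym (jointE mA)].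
rewrite -(integral12_prod_meas1 iprod); apply: integral0_eq => x _; exact: h0.
Qed.

End product_rule.

Section independent_past.
Local Open Scope ereal_scope.
Context {R : realType} {dO} {O : measurableType dO} (P : probability O R) {I : eqType}.
Variable F : I -> set (set O).
Hypothesis F_measurable : forall k A, F k A -> measurable A.
Hypothesis F_setI : forall k, setI_closed (F k).
Hypothesis F_indep : mutual_indep P F.

(** Finite intersections of input events: a family closed under intersection, from which Dynkin's
    argument starts. *)
Definition cylinders (Q : set I) : set (set O) :=
  [set A | exists s (E : I -> set O), [/\ uniq s, (forall i, i \in s -> Q i /\ F i (E i)) &
    A = \big[setI/setT]_(i <- s) E i]].

(** A copy of [O] with the smaller sigma-algebra, so that depending only on the inputs in [Q]
    becomes ordinary measurability of a function on this type. *)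
Definition past (Q : set I) := g_sigma_algebraType (cylinders Q).

Lemma cylinders_measurable Q A : cylinders Q A -> measurable A.
Proof.
move=> [s [E [_ sE ->]]]; rewrite big_seq.
by elim/big_rec: _ => // i B /sE[_ /F_measurable mE] mB; exact: measurableI.
Qed.

Lemma past_measurable Q (A : set (past Q)) : measurable A -> measurable (A : set O).
Proof.
by apply: smallest_sub; [exact: sigma_algebra_measurable|exact: cylinders_measurable].
Qed.

Lemma past_mono Q Q' (A : set O) : Q `<=` Q' ->
  measurable (A : set (past Q)) -> measurable (A : set (past Q')).
Proof.
move=> QQ'; apply: smallest_sub; first exact: smallest_sigma_algebra.
move=> _ [s [E [us sE ->]]]; apply: sub_sigma_algebra.
by exists s, E; split => // i /sE[/QQ'].
Qed.

Lemma past_input Q k A : Q k -> F k A -> measurable (A : set (past Q)).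
Proof.
move=> Qk FA; apply: sub_sigma_algebra; exists [:: k], (fun=> A); split => //.
  by move=> i; rewrite inE => /eqP ->.
by rewrite big_seq1.
Qed.

Let big_setIP (s : seq I) (E : I -> set O) w :
  (\big[setI/setT]_(i <- s) E i) w <-> forall i, i \in s -> E i w.
Proof.
elim: s => [|i s IH]; first by rewrite big_nil.
rewrite big_cons; split => [[Ei /IH Es] j|Es].
  by rewrite inE => /orP[/eqP ->|/Es].
split; first by apply: Es; rewrite mem_head.
by apply/IH => j js; apply: Es; rewrite inE js orbT.
Qed.

Let cylinders_setI Q : setI_closed (cylinders Q).
Proof.
move=> _ _ [s [E [us sE ->]]] [s' [E' [us' sE' ->]]].
pose G i := (if i \in s then E i else setT) `&` (if i \in s' then E' i else setT).
exists (undup (s ++ s')), G; split; first exact: undup_uniq.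
  move=> i; rewrite mem_undup mem_cat /G.
  case: ifPn => is_; case: ifPn => is' //= _; rewrite ?setIT ?setTI.
  - by have [? ?] := sE _ is_; split => //; apply: F_setI => //; have [] := sE' _ is'.
  - exact: sE.
  - exact: sE'.
apply/seteqP; split => w.
  move=> [/big_setIP ws /big_setIP ws']; apply/big_setIP => i _; rewrite /G.
  by split; case: ifPn => // is_; [exact: ws|exact: ws'].
move=> /big_setIP wG; split; apply/big_setIP => i is_.
  by have := wG i; rewrite mem_undup mem_cat is_ => /(_ isT); rewrite /G is_ => -[].
by have := wG i; rewrite mem_undup mem_cat is_ orbT => /(_ isT); rewrite /G is_ => -[].
Qed.

Lemma past_indep (Q : set I) l (A : set (past Q)) (B : set O) : ~ Q l -> measurable A -> F l B ->
  P (A `&` B) = P A * P B.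
Proof.
move=> Ql mA FB; have mB := F_measurable FB; move: A mA.
apply: (@dynkin_induction _ (past Q) (cylinders Q)
  (fun A => P ((A : set O) `&` B) = P A * P B)) => //.
- by rewrite setTI probability_setT mul1e.
- move=> _ [s [E [us sE ->]]].
  (* The cylinder and [B] form one family indexed by [l :: s], to which mutual independence applies;
     [l] is not in [s] because it lies outside [Q]. *)
  pose E' i := if i == l then B else E i.
  have ls : l \notin s by apply/negP => /sE[].
  have E'E i : i \in s -> E' i = E i.
    by rewrite /E'; case: eqP => // -> ls'; rewrite ls' in ls.
  have := @F_indep (l :: s) E' _ _; rewrite !big_cons /= ls us => /(_ isT).
  have -> : E' l = B by rewrite /E' eqxx.
  have -> : \big[setI/setT]_(i <- s) E' i = \big[setI/setT]_(i <- s) E i.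
    by apply: eq_big_seq => i; exact: E'E.
  rewrite (eq_big_seq (fun i => P (E i))); last by move=> i /E'E ->.
  rewrite -F_indep//; last by move=> i /sE[].
  rewrite setIC [X in _ = X]muleC; apply => i; rewrite inE => /orP[/eqP->|is_].
    by rewrite /E' eqxx.
  by rewrite E'E//; have [] := sE i is_.
- move=> A mA PA; have mA' := past_measurable mA.
  have fin C : measurable C -> P C \is a fin_num by move=> mC; exact: fin_num_measure.
  have BE : P B = P A * P B + P (~` A `&` B).
    rewrite -PA -measureU//; first by rewrite -setIUl setUv setTI.
    - exact: measurableI.
    - by apply: measurableI => //; exact: measurableC.
    - by rewrite setIACA setICr set0I.
  have := fin _ (measurableI _ _ (measurableC mA') mB); move: BE.
  rewrite probability_setC//; have := fin _ mA'; have := fin _ mB.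
  case: (P B) (P A) (P (~` A `&` B)) => [b| |] [a| |] [c| |] //= _ _.
  by rewrite -EFinB -!EFinM -EFinD => -[bE] _; congr (_%:E); lra.
- move=> G mG tG PG.
  have mG' n : measurable (G n : set O) by exact: past_measurable.
  have tGB : trivIset setT (fun n => (G n : set O) `&` B).
    by apply: trivIset_setIr.
  rewrite setI_bigcupl measure_semi_bigcup//; last 2 first.
  - by move=> n; exact: measurableI.
  - by apply: bigcup_measurable => n _; exact: measurableI.
  rewrite measure_semi_bigcup//; last exact: bigcup_measurable.
  rewrite (eq_eseriesr (g := fun n => P (G n) * P B)); last by move=> n _; exact: PG.
  have PBE : P B = (fine (P B))%:E by rewrite fineK// fin_num_measure.
  rewrite PBE muleC -nneseriesZl//.
  by apply: eq_eseriesr => n _; rewrite muleC.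
Qed.

End independent_past.

(** * Measurability of vector-valued maps *)

Section borel_vectors.
Context {R : realType} {dT} {T : measurableType dT}.

Definition measurable_vec d (f : T -> 'cV[R]_d) :=
  forall i, measurable_fun setT (fun w => f w i 0).

Lemma cV_ball_coord d (u v : 'cV[R]_d) e : 0 < e ->
  (forall i, `|u i 0 - v i 0| < e) -> ball u e v.
Proof. by move=> e0 uv; split => // i j; rewrite ord1; exact: uv. Qed.

(** An open set is the union of the rational boxes it contains, and these are countably many. *)
Lemma measurable_vec_open d (f : T -> 'cV[R]_d) (U : set 'cV[R]_d) :
  measurable_vec f -> open U -> measurable (f @^-1` U).
Proof.
move=> mf oU.
pose box (q : 'cV[rat]_d) (k : nat) : set 'cV[R]_d :=
  [set v | forall i, `|v i 0 - ratr (q i 0)| < k.+1%:R^-1].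
have mbox p : measurable (f @^-1` box p.1 p.2).
  rewrite [X in measurable X](_ : _ =
    \bigcap_(i in [set: 'I_d]) [set w | `|f w i 0 - ratr (p.1 i 0)| < p.2.+1%:R^-1]).
    apply: fin_bigcap_measurable => // i _.
    rewrite -[X in measurable X]setTI.
    have mfi : measurable_fun setT (fun w => `|f w i 0 - ratr (p.1 i 0)|).
      apply: measurableT_comp => //; apply: measurable_funB => //.
    exact: (mfi measurableT _ (measurable_itv `]-oo, p.2.+1%:R^-1[)).
  by apply/seteqP; split => w /= H i; [move=> _; exact: H|exact: (H i I)].
have -> : f @^-1` U = \bigcup_p
    (if `[< box p.1 p.2 `<=` U >] then f @^-1` box p.1 p.2 else set0).
  apply/seteqP; split => [w Uw|w [p _]]; last first.
    by case: asboolP => // sub /sub.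
  have /nbhs_ballP[e /= e0 eU] : nbhs (f w) U by exact: open_nbhs_nbhs.
  pose k := Num.trunc (2 / e).
  have k0 : 0 < k.+1%:R^-1 :> R by rewrite invr_gt0.
  have ke : k.+1%:R^-1 <= e / 2.
    by rewrite -[leRHS]invf_div lef_pV2 ?posrE ?divr_gt0// ltW// truncnS_gt.
  have [q qP] : exists q : 'I_d -> rat, forall i, `|f w i 0 - ratr (q i)| < k.+1%:R^-1.
    suff H i : exists q : rat, `|f w i 0 - ratr q| < k.+1%:R^-1.
      by exists (fun i => projT1 (cid (H i))) => i; exact: (projT2 (cid (H i))).
    have /rat_in_itvoo[q] : f w i 0 - k.+1%:R^-1 < f w i 0 + k.+1%:R^-1.
      by rewrite ltrD2l gtrN.
    by rewrite in_itv/= => qP; exists q; rewrite distrC ltr_distl.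
  exists (\col_i q i, k) => //.
  case: asboolP => [_ i|]; first by rewrite mxE; exact: qP.
  case => v vbox; apply: eU; apply: cV_ball_coord => // i.
  have := vbox i; have := qP i; rewrite /= mxE => H1 H2.
  rewrite [_ - _](_ : _ = (f w i 0 - ratr (q i)) - (v i 0 - ratr (q i))); last by ring.
  apply: le_lt_trans (ler_normB _ _) _. apply: (lt_le_trans (ltrD H1 H2)).
  by move: ke; move: (_^-1 : R) => r; lra.
apply: countable_bigcupT_measurable => // p.
by case: ifP => // _.
Qed.

Lemma measurable_vec_borel d (f : T -> 'cV[R]_d) :
  measurable_vec f -> measurable_fun setT (f : T -> @borel_cV R d).
Proof.
move=> mf; apply: (@measurability _ _ T (@borel_cV R d) setT f (@open 'cV[R]_d)) => // _ [U oU <-].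
by rewrite setTI; exact: measurable_vec_open.
Qed.

Lemma norm2_ball_open d (u : 'cV[R]_d) r : open [set v | norm2 (v - u) < r].
Proof.
move=> v /= vr; apply/nbhs_ballP.
pose e := (r - norm2 (v - u)) / d.+1%:R.
have e0 : 0 < e by rewrite divr_gt0// subr_gt0.
exists e => //= w; rewrite /ball/= => -[_ vw].
have -> : w - u = (v - u) - (v - w) by apply/matrixP => i j; rewrite !mxE; ring.
apply: le_lt_trans (norm2D _ _) _; rewrite norm2N.
suff : norm2 (v - w) < r - norm2 (v - u) by lra.
have -> : r - norm2 (v - u) = d%:R * e + e.
  have <- : d.+1%:R * e = r - norm2 (v - u) by rewrite /e mulrC divfK.
  by rewrite -natr1 mulrDl mul1r.
apply: (@le_lt_trans _ _ (d%:R * e)); last by rewrite ltrDl.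
apply: le_trans (norm2_le_sum _) _.
have -> : d%:R * e = \sum_(i < d) e by rewrite sumr_const card_ord mulr_natl.
by apply: ler_sum => i _; rewrite !mxE; exact/ltW/vw.
Qed.

(** [p] factors through [c] as a nonexpansive map, so the set where its [i]-th coordinate exceeds
    [a] is the preimage under [c] of an open set, a union of balls with radii [p w i 0 - a]. No
    formula for [p] is required. *)
Lemma nonexpansive_measurable d k (c : T -> 'cV[R]_d) (p : T -> 'cV[R]_k) :
  measurable_vec c ->
  (forall w w', norm2 (p w - p w') <= norm2 (c w - c w')) -> measurable_vec p.
Proof.
move=> mc pc i; apply: (measurability (@RGenOInfty.G R)) => [|_ [_ [a ->] <-]].
  exact: RGenOInfty.measurableE.
rewrite setTI.
have -> : (fun w => p w i 0) @^-1` `]a, +oo[%classic =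
    c @^-1` \bigcup_(w in [set w | a < p w i 0]) [set v | norm2 (v - c w) < p w i 0 - a].
  apply/seteqP; split => [w|w [w' /= aw']].
    rewrite /= in_itv/= andbT => aw; exists w => //=.
    by rewrite subrr norm2_0 subr_gt0.
  move=> /(le_lt_trans (pc w w')) H; rewrite in_itv/= andbT.
  have := le_lt_trans (coord_le_norm2 (p w - p w') i) H.
  by rewrite !mxE ltr_norml; lra.
by apply: measurable_vec_open => //; apply: bigcup_open => w _; exact: norm2_ball_open.
Qed.

Lemma measurable_vecD d (f g : T -> 'cV[R]_d) :
  measurable_vec f -> measurable_vec g -> measurable_vec (fun w => f w + g w).
Proof.
move=> mf mg i; under eq_fun do rewrite mxE; exact: measurable_funD.
Qed.

Lemma measurable_vecZ d a (f : T -> 'cV[R]_d) :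
  measurable_vec f -> measurable_vec (fun w => a *: f w).
Proof.
by move=> mf i; under eq_fun do rewrite mxE; exact: measurable_funM.
Qed.

Lemma measurable_vecB d (f g : T -> 'cV[R]_d) :
  measurable_vec f -> measurable_vec g -> measurable_vec (fun w => f w - g w).
Proof.
move=> mf mg; apply: measurable_vecD => // i.
by under eq_fun do rewrite mxE; exact: measurableT_comp.
Qed.

Lemma measurable_vec_cst d (u : 'cV[R]_d) : measurable_vec (fun=> u).
Proof. by move=> i; exact: measurable_cst. Qed.

Lemma measurable_vec_sum d I (s : seq I) (P : pred I) (f : I -> T -> 'cV[R]_d) :
  (forall i, measurable_vec (f i)) ->
  measurable_vec (fun w => \sum_(i <- s | P i) f i w).
Proof.
move=> mf j; under eq_fun do rewrite summxE big_mkcond.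
apply: measurable_sum => i; case: (P i); [exact: mf|exact: measurable_cst].
Qed.

Lemma measurable_dotv d (f g : T -> 'cV[R]_d) :
  measurable_vec f -> measurable_vec g -> measurable_fun setT (fun w => dotv (f w) (g w)).
Proof.
move=> mf mg; rewrite /dotv; apply: measurable_sum => i; exact: measurable_funM.
Qed.

Lemma measurable_mulmx d k (A : T -> 'M[R]_(k, d)) (f : T -> 'cV[R]_d) :
  (forall i j, measurable_fun setT (fun w => A w i j)) -> measurable_vec f ->
  measurable_vec (fun w => A w *m f w).
Proof.
move=> mA mf i; under eq_fun do rewrite mxE.
by apply: measurable_sum => j; exact: measurable_funM.
Qed.

End borel_vectors.

(** * Assumptions in Euclidean form *)

Section regularizer.
Context {R : realType} {d m n : nat} {dZ : measure_display} {Z : measurableType dZ}.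
Variables (pb : problem R d m n Z) (mu : R).
Hypothesis hA1 : A1 pb mu.

Definition reg_dom : set 'cV[R]_d := [set x | Xset pb x /\ (reg pb x < +oo)%E].
Definition regr (x : 'cV[R]_d) : R := fine (reg pb x).

Lemma regE x : reg_dom x -> reg pb x = (regr x)%:E.
Proof.
move=> [Xx rx]; rewrite fineK// fin_numE (lt_eqF rx) andbT.
by have [/(_ x Xx)] := reg_proper hA1.
Qed.

Lemma reg_dom_nonempty : exists x, reg_dom x.
Proof. by have [_ [x Xx rx]] := reg_proper hA1; exists x. Qed.

(** The convexity defect of the square is [t (1 - t)] times the squared distance of [x] and [y], and
    [mu] is nonnegative. Finiteness at the combination follows from finiteness of the right-hand
    side. *)
Lemma regr_convex : convex_on reg_dom regr.
Proof.
move=> t x y t01 rx ry; have [/andP[t0 t1] [Xx _] [Xy _]] := And3 t01 rx ry.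
set z := t *: x + (1 - t) *: y.
have Xz : Xset pb z by exact: convex_set_comb (Xset_convex hA1) t01 Xx Xy.
have := reg_mu_convex hA1 t01 Xx Xy; rewrite -/z (regE rx) (regE ry).
rewrite -!EFinB -!EFinM -EFinD leeBlDr// -EFinD => H.
have rz : reg_dom z by split => //; exact: le_lt_trans H (ltry _).
split => //; move: H; rewrite (regE rz) lee_fin => /le_trans; apply.
have zE : dotv z z = t * dotv x x + (1 - t) * dotv y y - t * (1 - t) * dotv (x - y) (x - y).
  by rewrite /z !dotvE (dotvC y x); ring.
rewrite !norm2_sqr zE.
have : 0 <= mu / 2 * (t * (1 - t) * dotv (x - y) (x - y)).
  by rewrite !mulr_ge0 ?dotv_ge0 ?subr_ge0 ?invr_ge0// (mu_ge0 hA1).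
lra.
Qed.

Lemma prox_step_real (G c z : 'cV[R]_d) (eta : R) :
  is_argmin (Xset pb) (fun u => (dotv G u)%:E + reg pb u
    + (eta / 2 * norm2 (u - c) ^+ 2)%:E)%E z ->
  reg_dom z /\ forall u, reg_dom u ->
    regr z + dotv G z + eta / 2 * dotv (z - c) (z - c) <=
    regr u + dotv G u + eta / 2 * dotv (u - c) (u - c).
Proof.
move=> [Xz zmin]; have rz : reg_dom z.
  split=> //; have [u ru] := reg_dom_nonempty.
  have := zmin u ru.1; rewrite (regE ru) -!EFinD.
  have [/(_ z Xz)] := reg_proper hA1.
  by case: (reg pb z) => [r| |] //= _ _ _; exact: ltry.
split=> // u ru; have := zmin u ru.1.
by rewrite (regE ru) (regE rz) -!EFinD lee_fin !norm2_sqr; lra.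
Qed.

Lemma Fobj_argmin xs : is_argmin (Xset pb) (Fobj pb) xs -> reg_dom xs.
Proof.
move=> [Xxs xsmin]; split => //; have [u ru] := reg_dom_nonempty.
have := xsmin u ru.1; rewrite /Fobj (regE ru) -!EFinD.
have [/(_ xs Xxs)] := reg_proper hA1.
by case: (reg pb xs) => [r| |] //= _ _ _; exact: ltry.
Qed.

End regularizer.

(** [f] stands for the squares of [dual_norm] and [op_norm], suprema whose measurability is not
    established. The constant is therefore pulled out of the integral of [g], and the comparison is
    [ge0_le_integralW]. *)
Lemma ge0_integral_leZ {R : realType} d (T : measurableType d) (mu : {measure set T -> \bar R})
    (f g : T -> R) (c v : R) : measurable_fun setT g -> (forall x, 0 <= g x) -> 0 < c ->
  (forall x, g x <= c * f x) -> (\int[mu]_x (f x)%:E <= v%:E)%E ->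
  (\int[mu]_x (g x)%:E <= (c * v)%:E)%E.
Proof.
move=> mg g0 c0 gf fv; have -> : (\int[mu]_x (g x)%:E = c%:E * \int[mu]_x (c^-1 * g x)%:E)%E.
  rewrite -ge0_integralZl//; last 3 first.
  - by apply/measurable_EFinP; exact: measurable_funM.
  - by move=> x _; rewrite lee_fin mulr_ge0// invr_ge0 ltW.
  - by rewrite lee_fin ltW.
  by apply: eq_integral => x _; rewrite -EFinM mulrA mulfV ?mul1r// gt_eqF.
rewrite EFinM lee_pmul2l//; apply: le_trans fv; apply: ge0_le_integralW => x.
  by rewrite lee_fin mulr_ge0// invr_ge0 ltW.
by rewrite lee_fin ler_pdivrMl.
Qed.

Section euclidean_reduction.
Context {R : realType} {d m n : nat} {dZ : measure_display} {Z : measurableType dZ}.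
Variables (pb : problem R d m n Z) (nrm : 'cV[R]_m -> R).
Variables (k1 k2 Cf Cg sigma0 sigma1 delta mu : R).
Hypothesis k1_gt0 : 0 < k1.
Hypothesis nrmP : is_norm nrm.
Hypothesis nrm_bounds : forall u : 'cV[R]_m, k1 * norm2 u <= nrm u <= k2 * norm2 u.
Hypothesis hO : oracle_model pb.
Hypothesis hA1 : A1 pb mu.
Hypothesis hA2 : A2 pb nrm Cg.
Hypothesis hA3 : A3 pb nrm Cf.
Hypothesis hA4 : A4 pb nrm sigma0 sigma1 delta.

Let k := Num.max k2 1.
(** Euclidean Lipschitz constant of the outer functions, hence a bound on all dual points; the
    absolute value since [Cf] comes without a sign. *)
Let Cy := `|Cf| / k1.

Let k_gt0 : 0 < k.
Proof. by rewrite lt_max ltr01 orbT. Qed.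

Let Cy_ge0 : 0 <= Cy.
Proof. by rewrite divr_ge0// ltW. Qed.

Lemma fout_lipschitz i u u' : `|fout pb i u - fout pb i u'| <= Cy * norm2 (u - u').
Proof.
apply: le_trans (f_lipschitz hA3 i u u') _.
have d0 : 0 <= dual_norm nrm (u - u').
  by rewrite -(pmulr_rge0 _ k_gt0); apply: le_trans (norm2_ge0 _) (norm2_le_dual nrmP k1_gt0 nrm_bounds _).
apply: (@le_trans _ _ (`|Cf| * dual_norm nrm (u - u'))); first by rewrite ler_wpM2r// ler_norm.
by rewrite /Cy -mulrA ler_wpM2l// (dual_norm_le nrmP k1_gt0 nrm_bounds).
Qed.

Lemma Yset_norm2 i v : Yset pb i v -> norm2 v <= Cy.
Proof. by apply: conj_dom_norm2 => // u u'; exact: fout_lipschitz. Qed.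

Lemma gin_lipschitz i x x' : Xset pb x -> Xset pb x' ->
  norm2 (gin pb i x - gin pb i x') <= k * Cg * norm2 (x - x').
Proof.
move=> Xx Xx'; apply: le_trans (norm2_le_dual nrmP k1_gt0 nrm_bounds _) _.
by rewrite -mulrA ler_pM2l// (g_lipschitz hA2).
Qed.

Lemma measurable_gsamp i x j : Xset pb x ->
  measurable_fun setT (fun z => gsamp pb i x z j 0).
Proof.
move=> Xx; apply/measurable_EFinP.
by have /measurable_int := gsamp_integrable hO i j (Xset_gdom hA2 Xx).
Qed.

Lemma measurable_dgsamp i x j l : Xset pb x ->
  measurable_fun setT (fun z => dgsamp pb i x z j l).
Proof.
move=> Xx; apply/measurable_EFinP.
by have /measurable_int := dgsamp_integrable hO i j l Xx.
Qed.

Lemma gsamp_variance i x : Xset pb x ->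
  (\int[law pb i]_z (dotv (gin pb i x - gsamp pb i x z) (gin pb i x - gsamp pb i x z))%:E
    <= (k ^+ 2 * sigma0 ^+ 2)%:E)%E.
Proof.
move=> Xx; have := value_variance hA4 i Xx; rewrite unlock.
have mdiff : measurable_vec (fun z => gin pb i x - gsamp pb i x z).
  apply: measurable_vecB; first exact: measurable_vec_cst.
  by move=> j; exact: measurable_gsamp.
apply: ge0_integral_leZ => [|z||z].
- exact: measurable_dotv.
- exact: dotv_ge0.
- exact: exprn_gt0.
- have H := norm2_le_dual nrmP k1_gt0 nrm_bounds (gin pb i x - gsamp pb i x z).
  rewrite -norm2_sqr -exprMn ler_pXn2r ?nnegrE ?norm2_ge0//.
  exact: le_trans (norm2_ge0 _) H.
Qed.

Lemma measurable_dgsamp_mulmx i x J y : Xset pb x ->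
  measurable_vec (fun z => (J - dgsamp pb i x z)^T *m y).
Proof.
move=> Xx; apply: measurable_mulmx => [j l|]; last exact: measurable_vec_cst.
under eq_fun do rewrite !mxE; apply: measurable_funB => //.
exact: measurable_dgsamp.
Qed.

Lemma dgsamp_variance i x J y : Xset pb x -> subdiff (gdom pb) (gin pb i) x J ->
  (\int[law pb i]_z (dotv ((J - dgsamp pb i x z)^T *m y) ((J - dgsamp pb i x z)^T *m y))%:E
    <= ((k * norm2 y) ^+ 2 * sigma1 ^+ 2)%:E)%E.
Proof.
move=> Xx JP; have := grad_variance hA4 Xx JP; rewrite unlock.
have [y0|y0] := eqVneq (norm2 y) 0.
  move=> _; rewrite (norm2_eq0 y0) norm2_0 mulr0 expr0n mul0r integral0_eq// => z _.
  by rewrite mulmx0 dotv0l.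
have yp : 0 < norm2 y by rewrite lt_neqAle eq_sym y0 norm2_ge0.
apply: ge0_integral_leZ => [|z||z].
- by apply: measurable_dotv; exact: measurable_dgsamp_mulmx.
- exact: dotv_ge0.
- by rewrite exprn_gt0// mulr_gt0.
- have H := norm2_mulmx_op nrmP k1_gt0 nrm_bounds (J - dgsamp pb i x z)^T y.
  rewrite -norm2_sqr -linearB/= -exprMn ler_pXn2r ?nnegrE ?norm2_ge0//.
  exact: le_trans (norm2_ge0 _) H.
Qed.

(** Every subgradient at [x] is close in mean square to the same sample subgradient. The difference
    [J - J'] does not depend on the sample, so it equals its own mean over [law pb i]. *)
Lemma subdiff_gin_diam i x J J' : Xset pb x -> subdiff (gdom pb) (gin pb i) x J ->
  subdiff (gdom pb) (gin pb i) x J' ->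
  forall y, norm2 ((J - J')^T *m y) <= 2 * k * `|sigma1| * norm2 y.
Proof.
move=> Xx JP JP' y; have k0 := ltW k_gt0.
rewrite -(@ler_pXn2r _ 2%N)// ?nnegrE ?norm2_ge0 ?mulr_ge0 ?norm2_ge0//.
rewrite norm2_sqr -lee_fin.
have cstE (c : R) : c%:E = (\int[law pb i]_z c%:E)%E.
  by rewrite integral_cst//= probability_setT mule1.
rewrite [leLHS]cstE.
pose q J0 z := dotv ((J0 - dgsamp pb i x z)^T *m y) ((J0 - dgsamp pb i x z)^T *m y).
have mq J0 : measurable_fun setT (fun z => (2 * q J0 z)%:E).
  apply/measurable_EFinP; apply: measurable_funM => //.
  by apply: measurable_dotv; exact: measurable_dgsamp_mulmx.
have q0 J0 z : (0 <= (2 * q J0 z)%:E)%E by rewrite lee_fin mulr_ge0// dotv_ge0.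
have q_le J0 : subdiff (gdom pb) (gin pb i) x J0 ->
    (\int[law pb i]_z (2 * q J0 z)%:E <= (2 * ((k * norm2 y) ^+ 2 * sigma1 ^+ 2))%:E)%E.
  move=> /(dgsamp_variance y Xx); apply: ge0_integral_leZ => // [|z].
    by move/measurable_EFinP : (mq J0).
  exact: q0.
apply: (@le_trans _ _ (\int[law pb i]_z ((2 * q J z)%:E + (2 * q J' z)%:E)))%E.
  apply: ge0_le_integralW => z; first by rewrite lee_fin dotv_ge0.
  rewrite -EFinD lee_fin.
  have -> : (J - J')^T *m y =
      (J - dgsamp pb i x z)^T *m y + (- ((J' - dgsamp pb i x z)^T *m y)).
    rewrite -mulmxBl -linearB/=; congr (_^T *m _).
    by rewrite opprB addrA subrK.
  by apply: le_trans (sqrD_le _ _) _; rewrite dotvNl dotvNr opprK.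
rewrite ge0_integralD//; apply: le_trans (leeD (q_le _ JP) (q_le _ JP')) _.
rewrite -EFinD lee_fin !exprMn real_normK ?num_real//.
by rewrite le_eqVlt; apply/orP; left; apply/eqP; ring.
Qed.

(** The mean of the oracle, a subgradient at points of [Xset pb]. An explicit formula rather than a
    choice, so that it depends measurably on [x]. *)
Definition gradJ i x : 'M[R]_(m, d) :=
  \matrix_(j, l) fine ('E_(law pb i)[fun z => dgsamp pb i x z j l])%E.

Lemma gradJP i x : Xset pb x -> subdiff (gdom pb) (gin pb i) x (gradJ i x).
Proof.
move=> Xx; have [J JP JE] := dgsamp_mean hO i Xx.
by have -> : gradJ i x = J; [apply/matrixP => j l; rewrite mxE JE|].
Qed.

Lemma gradJ_mean i x j l : Xset pb x ->
  (\int[law pb i]_z (dgsamp pb i x z j l)%:E = (gradJ i x j l)%:E)%E.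
Proof.
by move=> Xx; have [J JP JE] := dgsamp_mean hO i Xx; rewrite mxE JE -JE unlock.
Qed.

Lemma gin_mean i x j : Xset pb x ->
  (\int[law pb i]_z (gsamp pb i x z j 0%R)%:E = (gin pb i x j 0%R)%:E)%E.
Proof. by move=> Xx; rewrite -(gsamp_mean hO i j (Xset_gdom hA2 Xx)) unlock. Qed.

End euclidean_reduction.

(** * Expectations *)

Section expectation.
Context {R : realType} {dO} {O : measurableType dO} (P : probability O R).
Implicit Types f g : O -> R.

Definition intg f := P.-integrable [set: O] (EFin \o f).
Definition mean f : R := \int[P]_w f w.

Lemma intgD f g : intg f -> intg g -> intg (fun w => f w + g w).
Proof. by move=> If Ig; exact: integrableD If Ig. Qed.

Lemma intgZ a f : intg f -> intg (fun w => a * f w).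
Proof. by move=> If; exact: integrableZl If. Qed.

Lemma intgB f g : intg f -> intg g -> intg (fun w => f w - g w).
Proof. by move=> If Ig; exact: integrableB If Ig. Qed.

Lemma intg_cst a : intg (fun=> a).
Proof. by apply: finite_measure_integrable_cst. Qed.

Lemma intg_sum I (s : seq I) (Q : pred I) (f : I -> O -> R) :
  (forall i, intg (f i)) -> intg (fun w => \sum_(i <- s | Q i) f i w).
Proof.
move=> If; elim: s => [|i s IH].
  by under eq_fun do rewrite big_nil; exact: intg_cst.
under eq_fun do rewrite big_cons.
by case: (Q i) => //; exact: intgD.
Qed.

Lemma intg_measurable f : intg f -> measurable_fun setT f.
Proof. by move=> /measurable_int/measurable_EFinP. Qed.

Lemma intg_dom f g : measurable_fun setT f -> intg g -> (forall w, `|f w| <= g w) -> intg f.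
Proof.
move=> mf Ig fg; apply: (le_integrable _ _ _ Ig) => //; first exact/measurable_EFinP.
by move=> w _ /=; rewrite lee_fin; apply: le_trans (fg w) (ler_norm _).
Qed.

Lemma meanD f g : intg f -> intg g -> mean (fun w => f w + g w) = mean f + mean g.
Proof. by move=> If Ig; rewrite /mean RintegralD. Qed.

Lemma meanB f g : intg f -> intg g -> mean (fun w => f w - g w) = mean f - mean g.
Proof. by move=> If Ig; rewrite /mean RintegralB. Qed.

Lemma meanZ a f : intg f -> mean (fun w => a * f w) = a * mean f.
Proof. by move=> If; rewrite /mean RintegralZl. Qed.

Lemma mean_cst a : mean (fun=> a) = a.
Proof. by rewrite /mean Rintegral_cst//= probability_setT/= mulr1. Qed.

Lemma mean_sum I (s : seq I) (Q : pred I) (f : I -> O -> R) : (forall i, intg (f i)) ->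
  mean (fun w => \sum_(i <- s | Q i) f i w) = \sum_(i <- s | Q i) mean (f i).
Proof.
move=> If; elim: s => [|i s IH].
  by under eq_fun do rewrite big_nil; rewrite mean_cst big_nil.
under eq_fun do rewrite big_cons; rewrite big_cons.
by case: (Q i) => //; rewrite meanD ?IH//; exact: intg_sum.
Qed.

Lemma le_mean f g : intg f -> intg g -> (forall w, f w <= g w) -> mean f <= mean g.
Proof. by move=> If Ig fg; apply: le_Rintegral. Qed.

Lemma mean_ge0 f : (forall w, 0 <= f w) -> 0 <= mean f.
Proof. by move=> f0; apply: Rintegral_ge0. Qed.

Lemma intg_fin f c : measurable_fun setT f -> (forall w, 0 <= f w) ->
  (\int[P]_w (f w)%:E <= c%:E)%E -> intg f /\ mean f <= c.
Proof.
move=> mf f0 fc; have If : intg f.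
  apply/integrableP; split; first exact/measurable_EFinP.
  apply: le_lt_trans (ltry c); apply: le_trans fc.
  by apply: ge0_le_integralW => w; rewrite ?lee_fin//= ger0_norm.
by split=> //; rewrite -lee_fin /mean /Rintegral fineK//; exact: integrable_fin_num.
Qed.

Lemma EFin_mean f : intg f -> (\int[P]_w (f w)%:E = (mean f)%:E)%E.
Proof. by move=> If; rewrite /mean /Rintegral fineK//; exact: integrable_fin_num. Qed.

Definition L2v d (f : O -> 'cV[R]_d) :=
  measurable_vec f /\ intg (fun w => dotv (f w) (f w)).

Lemma L2v_dom d (f : O -> 'cV[R]_d) g : measurable_vec f -> intg g ->
  (forall w, dotv (f w) (f w) <= g w) -> L2v f.
Proof.
move=> mf Ig fg; split => //; apply: intg_dom Ig _; first exact: measurable_dotv.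
by move=> w; rewrite ger0_norm ?dotv_ge0.
Qed.

Lemma L2v_bounded d (f : O -> 'cV[R]_d) C : measurable_vec f ->
  (forall w, norm2 (f w) <= C) -> L2v f.
Proof.
move=> mf fC; apply: (L2v_dom mf (intg_cst (C ^+ 2))) => w.
by rewrite -norm2_sqr ler_pXn2r ?nnegrE ?norm2_ge0//; apply: le_trans (norm2_ge0 _) (fC w).
Qed.

Lemma L2v_cst d (u : 'cV[R]_d) : L2v (fun=> u).
Proof. by apply: (L2v_bounded (C := norm2 u)) => //; exact: measurable_vec_cst. Qed.

Lemma L2vD d (f g : O -> 'cV[R]_d) : L2v f -> L2v g -> L2v (fun w => f w + g w).
Proof.
move=> [mf If] [mg Ig]; apply: L2v_dom (intgD (intgZ 2 If) (intgZ 2 Ig)) _.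
  exact: measurable_vecD.
by move=> w; exact: sqrD_le.
Qed.

Lemma L2vZ d a (f : O -> 'cV[R]_d) : L2v f -> L2v (fun w => a *: f w).
Proof.
move=> [mf If]; split; first exact: measurable_vecZ.
by under eq_fun do rewrite dotvZl dotvZr mulrA; exact: intgZ.
Qed.

Lemma L2vB d (f g : O -> 'cV[R]_d) : L2v f -> L2v g -> L2v (fun w => f w - g w).
Proof.
move=> If Ig; have := L2vD If (L2vZ (-1) Ig).
by under eq_fun do rewrite scaleN1r.
Qed.

Lemma L2v_sum d I (s : seq I) (f : I -> O -> 'cV[R]_d) : (forall i, L2v (f i)) ->
  L2v (fun w => \sum_(i <- s) f i w).
Proof.
move=> If; elim: s => [|i s IH].
  by under eq_fun do rewrite big_nil; exact: L2v_cst.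
by under eq_fun do rewrite big_cons; exact: L2vD.
Qed.

Lemma intg_dotv d (f g : O -> 'cV[R]_d) : L2v f -> L2v g ->
  intg (fun w => dotv (f w) (g w)).
Proof.
move=> [mf If] [mg Ig].
apply: intg_dom (intgD (intgZ 2^-1 If) (intgZ 2^-1 Ig)) _; first exact: measurable_dotv.
move=> w; have := dotv_ge0 (f w - g w); have := dotv_ge0 (f w + g w).
by rewrite !dotvE (dotvC (g w)) ler_norml; lra.
Qed.

Lemma L2v_scale d (c : O -> R) C (f : O -> 'cV[R]_d) : measurable_fun setT c ->
  (forall w, `|c w| <= C) -> L2v f -> L2v (fun w => c w *: f w).
Proof.
move=> mc cC [mf If]; apply: (L2v_dom _ (intgZ (C ^+ 2) If)).
  by move=> i; under eq_fun do rewrite mxE; exact: measurable_funM.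
move=> w; rewrite dotvZl dotvZr mulrA ler_wpM2r ?dotv_ge0// -expr2 -real_normK ?num_real//.
by rewrite ler_pXn2r ?nnegrE//; apply: le_trans (cC w).
Qed.

End expectation.

(** * Expectations over a fresh input with the past frozen *)

Section conditional_mean.
Context {R : realType} {dO} {O : measurableType dO} (P : probability O R) {I : eqType}.
Variable F : I -> set (set O).
Hypothesis F_measurable : forall k A, F k A -> measurable A.
Hypothesis F_setI : forall k, setI_closed (F k).
Hypothesis F_indep : mutual_indep P F.

Definition adapted (Q : set I) (f : O -> R) :=
  measurable_fun [set: past F Q] (f : past F Q -> R).
Definition adapted_vec (Q : set I) d (f : O -> 'cV[R]_d) :=
  @measurable_vec R _ (past F Q) d f.

Lemma adapted_measurable Q f : adapted Q f -> measurable_fun [set: O] f.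
Proof.
move=> mf _ A mA; rewrite setTI; apply: (past_measurable F_measurable).
by rewrite -[X in measurable X]setTI; exact: mf.
Qed.

Lemma adapted_vec_measurable Q d (f : O -> 'cV[R]_d) : adapted_vec Q f -> measurable_vec f.
Proof. by move=> mf i; exact: adapted_measurable (mf i). Qed.

Lemma adapted_mono Q Q' f : Q `<=` Q' -> adapted Q f -> adapted Q' f.
Proof.
move=> QQ' mf _ A mA; rewrite setTI; apply: (past_mono QQ').
by rewrite -[X in measurable X]setTI; exact: mf.
Qed.

Lemma adapted_vec_mono Q Q' d (f : O -> 'cV[R]_d) : Q `<=` Q' ->
  adapted_vec Q f -> adapted_vec Q' f.
Proof. by move=> QQ' mf i; exact: adapted_mono QQ' (mf i). Qed.

Context {d2} {T2 : measurableType d2}.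
Variables (Q : set I) (l : I) (Y : O -> T2) (nu : probability T2 R).
Hypothesis Ql : ~ Q l.
Hypothesis mY : measurable_fun setT Y.
Hypothesis FY : forall A, measurable A -> F l (Y @^-1` A).
Hypothesis nuY : forall A, measurable A -> P (Y @^-1` A) = nu A.

Let mid : measurable_fun [set: O] (id : O -> past F Q).
Proof.
move=> _ A mA; rewrite setTI preimage_id.
exact: (@past_measurable _ _ _ F F_measurable Q A mA).
Qed.

Let XY (A : set (past F Q)) B : measurable A -> measurable B ->
  (P ((id : O -> past F Q) @^-1` A `&` Y @^-1` B) = P ((id : O -> past F Q) @^-1` A) * nu B)%E.
Proof. by move=> mA mB; rewrite -nuY//; exact: (past_indep F_measurable F_setI F_indep Ql mA (FY mB)). Qed.

(** Plays the role of conditioning on the inputs in [Q]: the first argument of [h] carries the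
    revealed information, and only [Y] is integrated. *)
Lemma mean_indep_eq0 (h : past F Q * T2 -> R) : measurable_fun setT h ->
  intg P (fun w => h (w, Y w)) -> (forall w, (\int[nu]_z (h (w, z))%:E = 0)%E) ->
  mean P (fun w => h (w, Y w)) = 0.
Proof.
by move=> mh Ih h0; rewrite /mean /Rintegral (integral_indep_eq0 mid mY XY mh Ih h0).
Qed.

Lemma mean_indep_le (h : past F Q * T2 -> R) (c : O -> R) : measurable_fun setT h ->
  (forall p, 0 <= h p) -> intg P c ->
  (forall w, (\int[nu]_z (h (w, z))%:E <= (c w)%:E)%E) ->
  intg P (fun w => h (w, Y w)) /\ mean P (fun w => h (w, Y w)) <= mean P c.
Proof.
move=> mh h0 Ic hc.
have mEh : measurable_fun setT (EFin \o h) by exact/measurable_EFinP.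
apply: intg_fin => //.
  by have := measurableT_comp mh (measurable_fun_pair mid mY).
rewrite -EFin_mean// (integral_indep_ge0 mid mY XY mEh)//.
  apply: ge0_le_integralW => w; last exact: hc.
  by apply: integral_ge0 => z _; rewrite lee_fin.
Qed.

End conditional_mean.

Section random_inputs.
Context {R : realType} {d m n : nat} {dZ : measure_display} {Z : measurableType dZ}.
Context {dO : measure_display} {O : measurableType dO}.
Variables (pb : problem R d m n Z) (P : probability O R) (S B : nat).
Variables (St : nat -> O -> {set 'I_n}) (zeta zeta' : nat -> 'I_n -> 'I_B -> {RV P >-> Z}).
Hypothesis hin : alexr_inputs pb S St zeta zeta'.
Hypothesis S_range : (0 < S <= n)%N.

Notation idx := (@input_index n B).
Notation F := (input_events St zeta zeta').

Definition in_St t (i : 'I_n) : idx := inl t.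
Definition in_zeta t (i : 'I_n) (b : 'I_B) : idx := inr (inl (t, i, b)).
Definition in_zeta' t (i : 'I_n) (b : 'I_B) : idx := inr (inr (t, i, b)).

(* Order in which the inputs are revealed: at step [t], first the batches [zeta t],
   then the index set [St t], then the batches [zeta' t]. *)
Definition stage (k : idx) : nat :=
  match k with
  | inl t => (3 * t).+1
  | inr (inl (t, _, _)) => 3 * t
  | inr (inr (t, _, _)) => (3 * t).+2
  end.

Definition revealed (s : nat) : set idx := [set k | (stage k < s)%N].

Lemma revealed_mono s s' : (s <= s')%N -> revealed s `<=` revealed s'.
Proof. by move=> ss' k /= ks; exact: leq_trans ks ss'. Qed.

Let St_preimage t (A : set {set 'I_n}) : measurable (St t @^-1` A).
Proof.
rewrite [X in measurable X](_ : _ = \bigcup_(a in A) St t @^-1` [set a]).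
  apply: fin_bigcup_measurable; first exact: finite_finset.
  by move=> a _; exact: St_measurable hin t a.
by apply/seteqP; split => w /= => [Aw|[a Aa ->]//]; exists (St t w).
Qed.

Lemma input_measurable k A : F k A -> measurable A.
Proof.
case: k => [t|[[[t i] b]|[[t i] b]]] [A' ? <-]; first exact: St_preimage.
- exact: measurable_funPTI.
- exact: measurable_funPTI.
Qed.

Lemma input_setI k : setI_closed (F k).
Proof.
case: k => [t|[[[t i] b]|[[t i] b]]] _ _ [A' mA' <-] [B' mB' <-]; exists (A' `&` B') => //.
- exact: measurableI.
- exact: measurableI.
Qed.

Definition sel t i w : bool := i \in St t w.

Lemma measurable_sel t i : measurable_fun [set: O] (sel t i).
Proof. by move=> _ A mA; rewrite setTI; exact: (St_preimage t [set s : {set 'I_n} | A (i \in s)]). Qed.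

Lemma adapted_sel Q t i : Q (in_St t i) -> adapted F Q (fun w => (sel t i w)%:R : R).
Proof.
move=> Qt _ A mA; rewrite setTI; apply: past_input Qt _.
by exists [set s : {set 'I_n} | A ((i \in s)%:R)].
Qed.

(** The draws containing [i] are all draws minus those avoiding [i]; Pascal's rule turns the
    difference into ['C(n.-1, S.-1)]. *)
Lemma card_draws_mem (i : 'I_n) :
  (#|[set A : {set 'I_n} | (i \in A) && (#|A| == S)]%SET| * n = S * 'C(n, S))%N.
Proof.
have [S0 Sn] := andP S_range.
pose D := [set A : {set 'I_n} | #|A| == S]%SET.
pose E := [set A : {set 'I_n} | A \subset [set~ i]]%SET.
have -> : [set A : {set 'I_n} | (i \in A) && (#|A| == S)]%SET = D :\: E.
  apply/setP => A; rewrite !inE; congr (_ && _).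
  by rewrite -[X in ~~ X]/(A \subset (~: [set i])%SET) finset.subsetC finset.sub1set finset.in_setC negbK.
have := cardsID E D; have -> : #|D| = 'C(n, S) by rewrite /D card_draws card_ord.
have -> : #|D :&: E| = 'C(n.-1, S).
  have -> : D :&: E = [set A : {set 'I_n} | (A \subset [set~ i]) & (#|A| == S)]%SET.
    by apply/setP => A; rewrite !inE andbC.
  by rewrite cards_draws cardsC1 card_ord.
move: (#|D :\: E|) S0 (leq_trans S0 Sn) => c {D E Sn}.
case: n S => [|n'] [|S'] //= _ _.
by rewrite binS => /addnI ->; rewrite mulnC mul_bin_diag.
Qed.

Lemma prob_sel t i : P [set w | sel t i w] = (S%:R / n%:R)%:E.
Proof.
have [S0 Sn] := andP S_range.
have n0 : (0 < n)%N := leq_trans S0 Sn.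
pose D := [set A : {set 'I_n} | (i \in A) && (#|A| == S)]%SET.
have -> : [set w | sel t i w] = \bigcup_(A in [set` enum D]) (St t @^-1` [set A]).
  apply/seteqP; split => w /= => [iw|[A /=]].
    by exists (St t w) => //=; rewrite mem_enum inE (St_card hin) eqxx andbT.
  by rewrite mem_enum inE => /andP[iA _] wA; rewrite /sel wA.
have tD : trivIset [set` enum D] (fun A => St t @^-1` [set A]).
  by move=> A A' _ _ [w [/= <- <-]].
rewrite (measure_fin_bigcup P (finite_seq (enum D)) tD); last by move=> A _; exact: St_preimage.
rewrite -fsbig_seq ?enum_uniq// big_enum/=.
rewrite (eq_bigr (fun=> ('C(n, S)%:R^-1)%:E)); last first.
  by move=> A; rewrite inE => /andP[_ /eqP cA]; exact: St_uniform hin t A cA.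
rewrite sumEFin sumr_const -[in LHS]mulr_natr; congr (_%:E).
have C0 : 'C(n, S)%:R != 0 :> R by rewrite pnatr_eq0 -lt0n bin_gt0.
have n0' : n%:R != 0 :> R by rewrite pnatr_eq0 -lt0n.
apply: (mulfI n0'); apply: (mulfI C0).
have := congr1 (fun k : nat => k%:R : R) (card_draws_mem i); rewrite /= !natrM => H.
by field: H; rewrite C0 n0'.
Qed.

Let p : R := n%:R / S%:R.

(** [p] is the inverse of the probability that block [i] is drawn, so the factor is centred, and the
    draw is independent of [f]. *)
Lemma sel_mean_eq0 Q t i f : ~ Q (in_St t i) -> adapted F Q f -> intg P f ->
  mean P (fun w => (1 - p * (sel t i w)%:R) * f w) = 0.
Proof.
have [S0 Sn] := andP S_range.
have n0 : (0 < n)%N := leq_trans S0 Sn.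
move=> Qt af If.
pose Y : {mfun O >-> bool} := HB.pack (sel t i) (isMeasurableFun.Build _ _ _ _ _ (measurable_sel t i)).
have mp : measurable_fun [set: bool] (fun b : bool => 1 - p * b%:R) by [].
pose h (q : past F Q * bool) := (1 - p * q.2%:R) * f q.1.
have mh : measurable_fun setT h.
  apply: measurable_funM; first by apply: measurableT_comp mp _; exact: measurable_snd.
  by apply: (measurableT_comp (af : measurable_fun _ _)); exact: measurable_fst.
have FY (A : set bool) : measurable A -> F (in_St t i) (Y @^-1` A).
  by move=> mA; exists [set s : {set 'I_n} | A (i \in s)].
have Ip (g : O -> R) : intg P g -> intg P (fun w => (1 - p * (sel t i w)%:R) * g w).
  move=> Ig; apply: (intg_dom (g := fun w => (1 + p) * `|g w|)).
  - apply: measurable_funM; last exact: intg_measurable Ig.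
    exact: measurableT_comp mp (measurable_sel t i).
  - by apply: intgZ; exact: integrable_norm Ig.
  - move=> w; rewrite normrM ler_wpM2r// ler_norml.
    have p0 : 0 <= p by rewrite divr_ge0.
    by case: (sel t i w); rewrite ?mulr1 ?mulr0; lra.
apply: (mean_indep_eq0 (nu := distribution P Y) input_measurable input_setI (inputs_indep hin)
  Qt (measurable_sel t i) FY _ mh) => //; first exact: Ip.
move=> w; rewrite /h/=.
have I1 : intg P (fun w => (sel t i w)%:R).
  apply: intg_dom (intg_cst P 1) _ => [|w'].
    have mb : measurable_fun [set: bool] (fun b : bool => b%:R : R) by [].
    exact: measurableT_comp mb (measurable_sel t i).
  by case: (sel t i w'); rewrite ?normr1 ?normr0.
have I1p : intg P (fun w => 1 - p * (sel t i w)%:R).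
  by apply: intgB; [exact: intg_cst|exact: intgZ].
have sel0 : (\int[P]_w (1 - p * (sel t i w)%:R)%:E = 0)%E.
  rewrite EFin_mean//.
  rewrite meanB ?mean_cst ?meanZ//; last 2 first.
  - exact: intg_cst.
  - exact: intgZ.
  suff -> : mean P (fun w => (sel t i w)%:R) = S%:R / n%:R.
    by congr (_%:E); rewrite /p; field; rewrite !pnatr_eq0 -!lt0n n0 S0.
  apply: EFin_inj; rewrite -EFin_mean// -(prob_sel t i) -[X in _ = P X]setIT.
  rewrite -integral_indic//; last exact: (St_preimage t [set s : {set 'I_n} | i \in s]).
  apply: eq_integral => w' _; rewrite indicE; congr ((nat_of_bool _)%:R%:E).
  by apply/idP/idP => [H|/set_mem//]; rewrite inE.
transitivity (\int[distribution P Y]_z ((f w)%:E * (1 - p * z%:R)%:E))%E.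
  by apply: eq_integral => z _; rewrite -EFinM mulrC.
have mpE : measurable_fun [set: bool] (EFin \o (fun b : bool => 1 - p * b%:R)).
  exact/measurable_EFinP.
rewrite integralZl//; last first.
  apply: integrable_pushforward => //; exact: measurable_sel.
rewrite (integral_pushforward (measurable_sel t i) mpE)//.
by rewrite sel0 mule0.
Qed.

Let zeta_preimage t i b A : measurable A -> F (in_zeta t i b) (zeta t i b @^-1` A).
Proof. by exists A. Qed.

Let zeta'_preimage t i b A : measurable A -> F (in_zeta' t i b) (zeta' t i b @^-1` A).
Proof. by exists A. Qed.

Lemma adapted_zeta (Q : set idx) t i b : Q (in_zeta t i b) ->
  measurable_fun [set: past F Q] (zeta t i b : past F Q -> Z).
Proof.
by move=> Qk _ A mA; rewrite setTI; apply: past_input Qk _; exact: zeta_preimage.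
Qed.

Lemma adapted_zeta' (Q : set idx) t i b : Q (in_zeta' t i b) ->
  measurable_fun [set: past F Q] (zeta' t i b : past F Q -> Z).
Proof.
by move=> Qk _ A mA; rewrite setTI; apply: past_input Qk _; exact: zeta'_preimage.
Qed.

Lemma zeta_mean_eq0 Q t i b (h : past F Q * Z -> R) : ~ Q (in_zeta t i b) ->
  measurable_fun setT h -> intg P (fun w => h (w, zeta t i b w)) ->
  (forall w, (\int[law pb i]_z (h (w, z))%:E = 0)%E) ->
  mean P (fun w => h (w, zeta t i b w)) = 0.
Proof.
move=> Qk mh Ih h0.
apply: (mean_indep_eq0 (nu := law pb i) input_measurable input_setI (inputs_indep hin)
  Qk _ (zeta_preimage t i b) _ mh Ih h0) => // A mA.
exact: zeta_law hin t i b A mA.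
Qed.

Lemma zeta_mean_le Q t i b (h : past F Q * Z -> R) (c : O -> R) : ~ Q (in_zeta t i b) ->
  measurable_fun setT h -> (forall q, 0 <= h q) -> intg P c ->
  (forall w, (\int[law pb i]_z (h (w, z))%:E <= (c w)%:E)%E) ->
  intg P (fun w => h (w, zeta t i b w)) /\ mean P (fun w => h (w, zeta t i b w)) <= mean P c.
Proof.
move=> Qk mh h0 Ic hc.
apply: (mean_indep_le (nu := law pb i) input_measurable input_setI (inputs_indep hin)
  Qk _ (zeta_preimage t i b) _ mh h0 Ic hc) => // A mA.
exact: zeta_law hin t i b A mA.
Qed.

Lemma zeta'_mean_eq0 Q t i b (h : past F Q * Z -> R) : ~ Q (in_zeta' t i b) ->
  measurable_fun setT h -> intg P (fun w => h (w, zeta' t i b w)) ->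
  (forall w, (\int[law pb i]_z (h (w, z))%:E = 0)%E) ->
  mean P (fun w => h (w, zeta' t i b w)) = 0.
Proof.
move=> Qk mh Ih h0.
apply: (mean_indep_eq0 (nu := law pb i) input_measurable input_setI (inputs_indep hin)
  Qk _ (zeta'_preimage t i b) _ mh Ih h0) => // A mA.
exact: zeta'_law hin t i b A mA.
Qed.

Lemma zeta'_mean_le Q t i b (h : past F Q * Z -> R) (c : O -> R) : ~ Q (in_zeta' t i b) ->
  measurable_fun setT h -> (forall q, 0 <= h q) -> intg P c ->
  (forall w, (\int[law pb i]_z (h (w, z))%:E <= (c w)%:E)%E) ->
  intg P (fun w => h (w, zeta' t i b w)) /\ mean P (fun w => h (w, zeta' t i b w)) <= mean P c.
Proof.
move=> Qk mh h0 Ic hc.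
apply: (mean_indep_le (nu := law pb i) input_measurable input_setI (inputs_indep hin)
  Qk _ (zeta'_preimage t i b) _ mh h0 Ic hc) => // A mA.
exact: zeta'_law hin t i b A mA.
Qed.

End random_inputs.

(** * Measurability of the oracle at a random point *)

Section oracle_measurability.
Context {R : realType} {d m n : nat} {dZ : measure_display} {Z : measurableType dZ}.
Variables (pb : problem R d m n Z) (nrm : 'cV[R]_m -> R) (Cg mu : R).
Hypothesis hO : oracle_model pb.
Hypothesis hA1 : A1 pb mu.
Hypothesis hA2 : A2 pb nrm Cg.
Context {dT} {T : measurableType dT} (f : T -> 'cV[R]_d).
Hypothesis mf : measurable_vec f.
Hypothesis fX : forall w, Xset pb (f w).

Let mXset : measurable (Xset pb `*` [set: Z] : set (@borel_cV R d * Z)%type).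
Proof.
apply: measurableX => //; rewrite -[Xset pb]setCK; apply: measurableC.
by apply: sub_sigma_algebra; exact/closed_openC/(Xset_closed hA1).
Qed.

Let mpair : measurable_fun [set: T * Z] (fun q => (f q.1, q.2) : (@borel_cV R d * Z)%type).
Proof.
apply: measurable_fun_pair; last exact: measurable_snd.
exact: measurableT_comp (measurable_vec_borel mf) measurable_fst.
Qed.

Lemma measurable_gsamp_joint i j :
  measurable_fun [set: T * Z] (fun q => gsamp pb i (f q.1) q.2 j 0).
Proof.
apply: (measurable_comp mXset _ (gsamp_measurable hO i j) mpair).
by move=> _ [q _ <-]; split => //=.
Qed.

Lemma measurable_dgsamp_joint i j l :
  measurable_fun [set: T * Z] (fun q => dgsamp pb i (f q.1) q.2 j l).
Proof.
apply: (measurable_comp mXset _ (dgsamp_measurable hO i j l) mpair).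
by move=> _ [q _ <-]; split => //=.
Qed.

Lemma measurable_gsamp_comp i j (Y : T -> Z) : measurable_fun setT Y ->
  measurable_fun setT (fun w => gsamp pb i (f w) (Y w) j 0).
Proof.
by move=> mY; exact: measurableT_comp (measurable_gsamp_joint i j) (measurable_fun_pair (@measurable_id _ T setT) mY).
Qed.

Lemma measurable_dgsamp_comp i j l (Y : T -> Z) : measurable_fun setT Y ->
  measurable_fun setT (fun w => dgsamp pb i (f w) (Y w) j l).
Proof.
by move=> mY; exact: measurableT_comp (measurable_dgsamp_joint i j l) (measurable_fun_pair (@measurable_id _ T setT) mY).
Qed.

(** On [Xset pb] the inner function is the mean of its samples, so measurability is that of a
    parametric integral; likewise for [gradJ]. *)
Lemma measurable_gin_comp i : measurable_vec (fun w => gin pb i (f w)).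
Proof.
move=> j; apply/measurable_EFinP.
rewrite [X in measurable_fun _ X](_ : _ = fun w => \int[law pb i]_z (gsamp pb i (f w) z j 0)%:E)%E.
  apply: (@measurable_integral2 _ _ _ _ _ (law pb i) (fun q : T * Z => (gsamp pb i (f q.1) q.2 j 0)%:E)).
  by apply/measurable_EFinP; exact: measurable_gsamp_joint.
by apply/funext => w; rewrite (gin_mean hO hA2).
Qed.

Lemma measurable_gradJ_comp i j l : measurable_fun setT (fun w => gradJ pb i (f w) j l).
Proof.
apply/measurable_EFinP.
rewrite [X in measurable_fun _ X](_ : _ = fun w => \int[law pb i]_z (dgsamp pb i (f w) z j l)%:E)%E.
  apply: (@measurable_integral2 _ _ _ _ _ (law pb i) (fun q : T * Z => (dgsamp pb i (f q.1) q.2 j l)%:E)).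
  by apply/measurable_EFinP; exact: measurable_dgsamp_joint.
by apply/funext => w; rewrite (gradJ_mean hO).
Qed.

End oracle_measurability.

(** * Analysis of a run *)

Section run.
Context {R : realType} {d m n : nat} {dZ : measure_display} {Z : measurableType dZ}.
Context {dO : measure_display} {O : measurableType dO}.
Variables (pb : problem R d m n Z) (nrm : 'cV[R]_m -> R).
Variables (k1 k2 Cf Cg sigma0 sigma1 delta mu : R).
Hypothesis k1_gt0 : 0 < k1.
Hypothesis nrmP : is_norm nrm.
Hypothesis nrm_bounds : forall u : 'cV[R]_m, k1 * norm2 u <= nrm u <= k2 * norm2 u.
Hypothesis hO : oracle_model pb.
Hypothesis hA1 : A1 pb mu.
Hypothesis hA2 : A2 pb nrm Cg.
Hypothesis hA3 : A3 pb nrm Cf.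
Hypothesis hA4 : A4 pb nrm sigma0 sigma1 delta.
Variables (P : probability O R) (S B : nat).
Variables (St : nat -> O -> {set 'I_n}) (zeta zeta' : nat -> 'I_n -> 'I_B -> {RV P >-> Z}).
Hypothesis hin : alexr_inputs pb S St zeta zeta'.
Hypothesis S_range : (0 < S <= n)%N.
Hypothesis B_gt0 : (0 < B)%N.
Variables (eta tau : R) (x0 : 'cV[R]_d) (y0 : 'I_n -> 'cV[R]_m).
Variables (x : nat -> O -> 'cV[R]_d) (y : nat -> O -> 'I_n -> 'cV[R]_m).
Hypothesis eta_gt0 : 0 < eta.
Hypothesis tau_gt0 : 0 < tau.
Hypothesis hit : alexr_iterates pb S (fun _ : 'I_n => @half_sqnorm R m) 0 eta tau x0 y0 St
    (fun t i b => zeta t i b) (fun t i b => zeta' t i b) x y.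

Notation F := (input_events St zeta zeta').
Notation rev s := (@revealed n B s).

Let Cy := `|Cf| / k1.

Let Cy_ge0 : 0 <= Cy.
Proof. by rewrite divr_ge0// ltW. Qed.

Let f_lip i u u' : `|fout pb i u - fout pb i u'| <= Cy * norm2 (u - u').
Proof. exact: (fout_lipschitz k1_gt0 nrmP nrm_bounds hA3). Qed.

Definition batch_val t i w : 'cV[R]_m := batch_g pb i (x t w) (fun b => zeta t i b w).

Definition dual_prox t i w (v : 'cV[R]_m) : Prop :=
  Yset pb i v /\ forall v', Yset pb i v' ->
    conjr (fout pb i) v + dotv (- batch_val t i w) v + tau / 2 * dotv (v - y t w i) (v - y t w i) <=
    conjr (fout pb i) v' + dotv (- batch_val t i w) v' +
      tau / 2 * dotv (v' - y t w i) (v' - y t w i).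

(* The dual update that every block [i] would make at step [t]; it agrees with the
   iterate on the sampled blocks. *)
Definition yfull t i w : 'cV[R]_m :=
  if i \in St t w then y t.+1 w i else xget 0 [set v | dual_prox t i w v].

Lemma yfull_prox t i w : dual_prox t i w (yfull t i w).
Proof.
rewrite /yfull; case: ifPn => [iS|_].
  have [yY ymax] := y_step hit iS; split=> // v' v'Y; have := ymax v' v'Y.
  rewrite !bregman_half_sqnorm /half_sqnorm !norm2_sqr scale0r addr0.
  rewrite !conjugateE// -!EFinB lee_fin !dotvNl -/(batch_val t i w) (dotvC (batch_val _ _ _)) (dotvC (batch_val _ _ _)).
  lra.
apply: (xgetPex 0 (P := [set v | dual_prox t i w v])).
have [v vY vmin] := exists_conj_prox (f_convex hA3 i) Cy_ge0 (f_lip i)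
  (batch_val t i w) (y t w i) tau_gt0.
by exists v.
Qed.

Lemma yfull_in t i w : Yset pb i (yfull t i w).
Proof. by have [] := yfull_prox t i w. Qed.

Lemma y_in t w i : Yset pb i (y t w i).
Proof.
elim: t => [|t IH]; first by rewrite (y_init hit); exact: (y0_in hit).
have [iS|iS] := boolP (i \in St t w); first by have := yfull_in t i w; rewrite /yfull iS.
by rewrite (y_stay hit iS).
Qed.

Lemma y_next t w i : y t.+1 w i = y t w i + (sel St t i w)%:R *: (yfull t i w - y t w i).
Proof.
rewrite /yfull /sel; have [iS|iS] := boolP (i \in St t w).
  by rewrite scale1r addrC subrK.
by rewrite scale0r addr0 (y_stay hit iS).
Qed.

Lemma x_in t w : Xset pb (x t w).
Proof.
case: t => [|t]; first by rewrite (x_init hit); exact: (x0_in hit).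
by have [] := x_step hit t w.
Qed.

(** The direction [G] of [x_step] as a sum over all blocks: [yfull] agrees with the iterate on drawn
    blocks, and the draw enters only through the indicators. *)
Definition dir t w : 'cV[R]_d := S%:R^-1 *: \sum_(i < n) (sel St t i w)%:R *:
  ((batch_dg pb i (x t w) (fun b => zeta' t i b w))^T *m yfull t i w).

Lemma x_prox t w : reg_dom pb (x t.+1 w) /\ forall u, reg_dom pb u ->
  regr pb (x t.+1 w) + dotv (dir t w) (x t.+1 w) +
    eta / 2 * dotv (x t.+1 w - x t w) (x t.+1 w - x t w) <=
  regr pb u + dotv (dir t w) u + eta / 2 * dotv (u - x t w) (u - x t w).
Proof.
have := x_step hit t w => /(prox_step_real hA1).
have -> : \sum_(i in St t w) ((batch_dg pb i (x t w) (fun b => zeta' t i b w))^T *m y t.+1 w i) =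
  \sum_(i < n) (sel St t i w)%:R *:
    ((batch_dg pb i (x t w) (fun b => zeta' t i b w))^T *m yfull t i w).
  rewrite big_mkcond/=; apply: eq_bigr => i _; rewrite /sel /yfull.
  by case: ifP => _; rewrite ?scale1r ?scale0r.
by [].
Qed.

(** * Adaptedness of the iterates *)

Let adapted_batch_val t i : adapted_vec F (rev (3 * t)) (x t) ->
  adapted_vec F (rev (3 * t).+1) (batch_val t i).
Proof.
move=> ax; apply: measurable_vecZ; apply: measurable_vec_sum => b j.
have ax' := adapted_vec_mono (revealed_mono (leqnSn _)) ax.
apply: (measurable_gsamp_comp hO hA1 ax' (x_in t)).
by apply: adapted_zeta; exact: ltnSn.
Qed.

(** The definition of [yfull] distinguishes cases on the draw of step [t], yet only the stage before
    the draw is used here. Both cases satisfy [dual_prox], and nonexpansiveness makes the solution a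
    function of [y t] and the batch value alone. *)
Let adapted_yfull_step t i : adapted_vec F (rev (3 * t)) (x t) ->
  adapted_vec F (rev (3 * t)) (fun w => y t w i) -> adapted_vec F (rev (3 * t).+1) (yfull t i).
Proof.
move=> ax ay; apply: (@nonexpansive_measurable R _ (past F (rev (3 * t).+1)) _ _
    (fun w => y t w i - tau^-1 *: (- batch_val t i w)) (yfull t i)).
  apply: measurable_vecB.
    exact: adapted_vec_mono (revealed_mono (leqnSn _)) ay.
  apply: measurable_vecZ; have := measurable_vecZ (-1) (@adapted_batch_val t i ax).
  by under eq_fun do rewrite scaleN1r.
move=> w w'; have [Yw w_min] := yfull_prox t i w; have [Yw' w'_min] := yfull_prox t i w'.
exact: (@prox_nonexpansive _ _ (Yset pb i) (conjr (fout pb i)) tau (y t w i) (y t w' i)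
  (- batch_val t i w) (- batch_val t i w') (yfull t i w) (yfull t i w') tau_gt0 (@conjr_convex _ _ (fout pb i))
  Yw Yw' w_min w'_min).
Qed.

Let measurable_bool_scale (dT : measure_display) (T : measurableType dT) k (c : T -> R)
  (f : T -> 'cV[R]_k) : measurable_fun setT c -> measurable_vec f ->
  measurable_vec (fun w => c w *: f w).
Proof. by move=> mc mf i; under eq_fun do rewrite mxE; exact: measurable_funM. Qed.

Lemma sel_adapted t i s : ((3 * t).+1 < s)%N -> adapted F (rev s) (fun w => (sel St t i w)%:R : R).
Proof. exact: (@adapted_sel R n dZ Z dO O P B St zeta zeta' (rev s) t i). Qed.

Lemma adapted_xy t : adapted_vec F (rev (3 * t)) (x t) /\
  forall i, adapted_vec F (rev (3 * t)) (fun w => y t w i).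
Proof.
elim: t => [|t [ax ay]].
  split=> [|i].
    have -> : x 0%N = fun=> x0 by apply/funext => w; exact: x_init hit w.
    exact: measurable_vec_cst.
  have -> : (fun w => y 0%N w i) = fun=> y0 i by apply/funext => w; exact: y_init hit w i.
  exact: measurable_vec_cst.
(* [3 * t.+1] becomes [(3 * t).+3], the stage at which all three kinds of inputs of step [t] are
   revealed. *)
rewrite mulnS addnC addn3.
have ayb i := adapted_vec_mono (revealed_mono (leq_trans (leqnSn _) (leqnSn _)))
  (adapted_yfull_step (ax) (ay i)).
have ax' := adapted_vec_mono (revealed_mono (leq_trans (leqnSn _) (leq_trans (leqnSn _) (leqnSn _)))) ax.
have ay' i := adapted_vec_mono (revealed_mono (leq_trans (leqnSn _) (leq_trans (leqnSn _) (leqnSn _)))) (ay i).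
have asel i : adapted F (rev (3 * t).+3) (fun w => (sel St t i w)%:R : R).
  exact: sel_adapted (leqnSn _).
split=> [|i]; last first.
  under eq_fun do rewrite y_next; apply: measurable_vecD; first exact: ay'.
  by apply: measurable_bool_scale; [exact: asel|apply: measurable_vecB; [exact: ayb|exact: ay']].
apply: (@nonexpansive_measurable R _ (past F (rev (3 * t).+3)) _ _
    (fun w => x t w - eta^-1 *: dir t w) (x t.+1)).
  apply: measurable_vecB; first exact: ax'.
  apply: measurable_vecZ; apply: measurable_vecZ; apply: measurable_vec_sum => i.
  apply: measurable_bool_scale; first exact: asel.
  apply: measurable_mulmx; last exact: ayb.
  move=> l j; under eq_fun do rewrite !mxE summxE; apply: measurable_funM => //.
  apply: measurable_sum => b.
  apply: (measurable_dgsamp_comp hO hA1 ax' (x_in t)).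
  by apply: adapted_zeta'; exact: ltnSn.
move=> w w'; have [Rw w_min] := x_prox t w; have [Rw' w'_min] := x_prox t w'.
exact: (prox_nonexpansive eta_gt0 (regr_convex hA1) Rw Rw' w_min w'_min).
Qed.

Lemma adapted_yfull t i : adapted_vec F (rev (3 * t).+1) (yfull t i).
Proof. by case: (adapted_xy t) => ax ay; exact: (@adapted_yfull_step t i ax (ay i)). Qed.

Let kn := Num.max k2 1.
Let V0 := kn ^+ 2 * sigma0 ^+ 2.
Let V1 := (kn * Cy) ^+ 2 * sigma1 ^+ 2.
Let L := kn * `|Cg|.
Let K := 2 * kn * `|sigma1|.

Let kn_gt0 : 0 < kn.
Proof. by rewrite lt_max ltr01 orbT. Qed.

Let L_ge0 : 0 <= L.
Proof. by rewrite mulr_ge0// ltW. Qed.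

Let K_ge0 : 0 <= K.
Proof. by rewrite !mulr_ge0// ltW. Qed.

Let adaptedx t : adapted_vec F (rev (3 * t)) (x t).
Proof. by case: (adapted_xy t). Qed.

Let adaptedy t i : adapted_vec F (rev (3 * t)) (fun w => y t w i).
Proof. by case: (adapted_xy t). Qed.

Let mI : forall k A, F k A -> measurable A := input_measurable hin.

Let mvec Q k (f : O -> 'cV[R]_k) : adapted_vec F Q f -> measurable_vec f.
Proof. exact: adapted_vec_measurable. Qed.

(** * Errors of the sampled inner values *)

Definition val_dev t i b w : 'cV[R]_m := gin pb i (x t w) - gsamp pb i (x t w) (zeta t i b w).

(** Stated for a general [Q] because orthogonality within one batch requires sets of inputs that are
    not of the form [rev s]. *)
Lemma adapted_val_dev (Q : set (input_index B)) t i b : rev (3 * t) `<=` Q ->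
  Q (in_zeta t i b) -> adapted_vec F Q (val_dev t i b).
Proof.
move=> tQ Qb; have ax := adapted_vec_mono tQ (@adaptedx t).
apply: measurable_vecB; first exact: (measurable_gin_comp hO hA1 hA2 ax (x_in t)).
move=> j; apply: (measurable_gsamp_comp hO hA1 ax (x_in t)).
exact: (@adapted_zeta R n dZ Z dO O P B St zeta zeta' Q t i b Qb).
Qed.

Let gap_joint Q t i : adapted_vec F Q (x t) ->
  measurable_vec (fun r : past F Q * Z => gin pb i (x t r.1) - gsamp pb i (x t r.1) r.2).
Proof.
move=> ax; apply: measurable_vecB => j; last exact: (measurable_gsamp_joint hO hA1 ax (x_in t)).
have mg : measurable_fun [set: past F Q] (fun w : past F Q => gin pb i (x t w) j 0).
  exact: (measurable_gin_comp hO hA1 hA2 ax (x_in t)).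
exact: measurableT_comp mg measurable_fst.
Qed.

Lemma val_dev_L2 t i b : L2v P (val_dev t i b) /\ mean P (fun w => dotv (val_dev t i b w) (val_dev t i b w)) <= V0.
Proof.
have nQ : ~ rev (3 * t) (in_zeta t i b) by rewrite /revealed/= ltnn.
have [Iq qV] := zeta_mean_le (h := fun r => dotv (gin pb i (x t r.1) - gsamp pb i (x t r.1) r.2)
    (gin pb i (x t r.1) - gsamp pb i (x t r.1) r.2)) hin nQ
  (measurable_dotv (gap_joint i (@adaptedx t)) (gap_joint i (@adaptedx t)))
  (fun r => dotv_ge0 _) (intg_cst P V0)
  (fun w => gsamp_variance k1_gt0 nrmP nrm_bounds hO hA2 hA4 i (x_in t w)).
rewrite mean_cst in qV; split=> //; split => //.
have := @adapted_val_dev (rev (3 * t).+1) t i b (revealed_mono (leqnSn _)) (ltnSn _).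
exact: mvec.
Qed.

Let gin_law_mean0 i u v : Xset pb u ->
  (\int[law pb i]_z (dotv v (gin pb i u - gsamp pb i u z))%:E = 0)%E.
Proof.
move=> Xu; have Ig j : intg (law pb i) (fun z => gsamp pb i u z j 0).
  by have := gsamp_integrable hO i j (Xset_gdom hA2 Xu).
have Ij j : intg (law pb i) (fun z => v j 0 * (gin pb i u j 0 - gsamp pb i u z j 0)).
  by apply: intgZ; apply: intgB => //; exact: intg_cst.
have -> : (fun z => (dotv v (gin pb i u - gsamp pb i u z))%:E) =
    (fun z => (\sum_(j < m) v j 0 * (gin pb i u j 0 - gsamp pb i u z j 0))%:E).
  by apply/funext => z; congr (_%:E); apply: eq_bigr => j _; rewrite !mxE.
rewrite EFin_mean; last exact: intg_sum.
rewrite mean_sum// big1// => j _; rewrite meanZ; last by apply: intgB => //; exact: intg_cst.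
rewrite meanB//; last exact: intg_cst.
by rewrite mean_cst /mean /Rintegral (gin_mean hO hA2)//= subrr mulr0.
Qed.

Lemma val_dev_mean_eq0 Q t i b v : ~ Q (in_zeta t i b) -> rev (3 * t) `<=` Q ->
  adapted_vec F Q v -> L2v P v -> mean P (fun w => dotv (v w) (val_dev t i b w)) = 0.
Proof.
move=> nQ tQ av Lv; have ax := adapted_vec_mono tQ (@adaptedx t).
apply: (zeta_mean_eq0
  (h := fun r => dotv (v r.1) (gin pb i (x t r.1) - gsamp pb i (x t r.1) r.2)) hin nQ).
- apply: measurable_dotv; last exact: gap_joint.
  by move=> j; have mv := av j; exact: measurableT_comp mv measurable_fst.
- by apply: intg_dotv => //; have [] := val_dev_L2 t i b.
- by move=> w; exact: (@gin_law_mean0 i (x t w) (v w) (x_in t w)).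
Qed.

Definition val_noise t i w : 'cV[R]_m := gin pb i (x t w) - batch_val t i w.

Let B0 : B%:R != 0 :> R.
Proof. by rewrite pnatr_eq0 -lt0n. Qed.

Lemma val_noiseE t i w : val_noise t i w = B%:R^-1 *: \sum_(b < B) val_dev t i b w.
Proof.
rewrite /val_noise /batch_val /batch_g sumrB scalerBr sumr_const card_ord -(scaler_nat B (gin pb i (x t w))) scalerA mulVf//.
by rewrite scale1r.
Qed.

Lemma val_noise_L2 t i : L2v P (val_noise t i).
Proof.
have -> : val_noise t i = fun w => B%:R^-1 *: \sum_(b < B) val_dev t i b w by apply/funext => w; exact: val_noiseE.
by apply: L2vZ; apply: L2v_sum => b; have [] := val_dev_L2 t i b.
Qed.

Lemma adapted_val_noise t i : adapted_vec F (rev (3 * t).+1) (val_noise t i).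
Proof.
apply: measurable_vecB; last exact: (@adapted_batch_val t i (@adaptedx t)).
have ax := adapted_vec_mono (revealed_mono (leqnSn _)) (@adaptedx t).
exact: (measurable_gin_comp hO hA1 hA2 ax (x_in t)).
Qed.

Lemma val_noise_mean_eq0 t i v : adapted_vec F (rev (3 * t)) v -> L2v P v ->
  mean P (fun w => dotv (v w) (val_noise t i w)) = 0.
Proof.
move=> av Lv; under [X in mean P X]eq_fun do rewrite val_noiseE dotvZr dotv_sumr.
have Iq b : intg P (fun w => dotv (v w) (val_dev t i b w)).
  by apply: intg_dotv => //; have [] := val_dev_L2 t i b.
rewrite meanZ; last exact: intg_sum.
rewrite mean_sum// big1 ?mulr0// => b _; apply: val_dev_mean_eq0 av Lv => //.
by rewrite /revealed/= ltnn.
Qed.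

Lemma val_noise_variance t i : mean P (fun w => dotv (val_noise t i w) (val_noise t i w)) <= V0 / B%:R.
Proof.
have Iq b b' : intg P (fun w => dotv (val_dev t i b w) (val_dev t i b' w)).
  by apply: intg_dotv; [have [] := val_dev_L2 t i b|have [] := val_dev_L2 t i b'].
have -> : (fun w => dotv (val_noise t i w) (val_noise t i w)) = (fun w => B%:R^-1 ^+ 2 *
    \sum_(b < B) \sum_(b' < B) dotv (val_dev t i b w) (val_dev t i b' w)).
  apply/funext => w; rewrite val_noiseE dotvZl dotvZr mulrA -expr2 dotv_suml; congr (_ * _).
  by apply: eq_bigr => b _; rewrite dotv_sumr.
rewrite meanZ; last by apply: intg_sum => b; exact: intg_sum.
rewrite mean_sum; last by move=> b; exact: intg_sum.
apply: (@le_trans _ _ (B%:R^-1 ^+ 2 * \sum_(b < B) V0)); last first.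
  by rewrite sumr_const card_ord -[V0 *+ B]mulr_natr le_eqVlt; apply/orP; left; apply/eqP; field.
rewrite ler_wpM2l ?sqr_ge0//; apply: ler_sum => b _; rewrite mean_sum//.
rewrite (bigD1 b)//= big1 ?addr0; first by have [] := val_dev_L2 t i b.
move=> b' b'b.
(* Everything up to this stage except the sample [b']: the deviation of [b] is adapted to it, while
   [b'] is still fresh. *)
pose Q : set (input_index B) := [set k | rev (3 * t).+1 k /\ k <> in_zeta t i b'].
apply: (val_dev_mean_eq0 (Q := Q)).
- by move=> [_]; apply.
- move=> k /= kt; split; first exact: ltnW.
  by move=> kE; move: kt; rewrite /revealed kE /= ltnn.
- apply: adapted_val_dev => [k /= kt|].
    split; first exact: ltnW.
    by move=> kE; move: kt; rewrite /revealed kE /= ltnn.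
  by split => /=; [exact: ltnSn|move=> [] bE; rewrite bE eqxx in b'b].
- by have [] := val_dev_L2 t i b.
Qed.

Let p : R := n%:R / S%:R.

Let S0 : S%:R != 0 :> R.
Proof. by have [+ _] := andP S_range; rewrite pnatr_eq0 -lt0n. Qed.

Let n_gt0 : (0 < n)%N.
Proof. by have [+] := andP S_range; exact: leq_trans. Qed.

Let p_ge1 : 1 <= p.
Proof.
have [S_gt0 Sn] := andP S_range.
by rewrite /p ler_pdivlMr ?mul1r ?ler_nat// ltr0n.
Qed.

Let yfull_norm t i w : norm2 (yfull t i w) <= Cy.
Proof. exact: (Yset_norm2 k1_gt0 nrmP nrm_bounds hA3 (yfull_in t i w)). Qed.

Let y_norm t i w : norm2 (y t w i) <= Cy.
Proof. exact: (Yset_norm2 k1_gt0 nrmP nrm_bounds hA3 (y_in t w i)). Qed.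

Let yfull_L2 t i : L2v P (yfull t i).
Proof. by apply: (L2v_bounded _ _ (yfull_norm t i)); exact: mvec (@adapted_yfull t i). Qed.

Let y_L2 t i : L2v P (fun w => y t w i).
Proof.
apply: (L2v_bounded _ _ (fun w => y_norm t i w)); exact: mvec (@adaptedy t i).
Qed.

(** * Dual part: deviations caused by the draw and the batch *)

Definition dual_move t i w : 'cV[R]_m := yfull t i w - y t w i.

Let adapted_dual_move t i : adapted_vec F (rev (3 * t).+1) (dual_move t i).
Proof.
apply: measurable_vecB; first exact: adapted_yfull.
exact: adapted_vec_mono (revealed_mono (leqnSn _)) (@adaptedy t i).
Qed.

Let dual_move_L2 t i : L2v P (dual_move t i).
Proof. by apply: L2vB; [exact: yfull_L2|exact: y_L2]. Qed.

Definition sel_dev t i w : R := 1 - p * (sel St t i w)%:R.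

Let sel_dev_le t i w : `|sel_dev t i w| <= 1 + p.
Proof.
rewrite /sel_dev ler_norml; have := p_ge1.
by case: (sel St t i w); rewrite ?mulr1 ?mulr0; lra.
Qed.

Let sel_dev_measurable t i : measurable_fun setT (sel_dev t i).
Proof.
have mb : measurable_fun [set: bool] (fun b : bool => 1 - p * b%:R) by [].
exact: measurableT_comp mb (measurable_sel hin t i).
Qed.

Let sel_dev_mean_eq0 t i f : adapted F (rev (3 * t).+1) f -> intg P f ->
  mean P (fun w => sel_dev t i w * f w) = 0.
Proof.
move=> af If; apply: (sel_mean_eq0 hin S_range (Q := rev (3 * t).+1)) => //.
by rewrite /revealed/= ltnn.
Qed.

Let sel_dev_intg t i f : intg P f -> intg P (fun w => sel_dev t i w * f w).
Proof.
move=> If; apply: (intg_dom (g := fun w => (1 + p) * `|f w|)).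
- by apply: measurable_funM; [exact: sel_dev_measurable|exact: intg_measurable If].
- by apply: intgZ; exact: integrable_norm If.
- by move=> w; rewrite normrM ler_wpM2r// sel_dev_le.
Qed.

Let sel_dev_L2 t i k (f : O -> 'cV[R]_k) : L2v P f -> L2v P (fun w => sel_dev t i w *: f w).
Proof. exact: L2v_scale (sel_dev_measurable t i) (sel_dev_le t i). Qed.

(** The indicator is idempotent, so the square is affine in [sel_dev]; its mean is [p - 1]. *)
Let sel_dev_sqr t i w : sel_dev t i w ^+ 2 = (p - 1) + (2 - p) * sel_dev t i w.
Proof. by rewrite /sel_dev; case: (sel St t i w); rewrite ?mulr1 ?mulr0; ring. Qed.

(** The coefficient of the comparator [v] in [dual_step]. *)
Definition dual_dev t i w : 'cV[R]_m := tau *: (sel_dev t i w *: dual_move t i w) + val_noise t i w.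

Let dual_dev_L2 t i : L2v P (dual_dev t i).
Proof.
by apply: L2vD; [apply: L2vZ; apply: sel_dev_L2; exact: dual_move_L2|exact: val_noise_L2].
Qed.

Let adapted_sel_dev t i s : ((3 * t).+1 < s)%N -> adapted F (rev s) (sel_dev t i).
Proof.
move=> ts; apply: measurable_funB; first exact: measurable_cst.
by apply: measurable_funM; [exact: measurable_cst|exact: sel_adapted ts].
Qed.

Let adapted_dual_dev t i : adapted_vec F (rev (3 * t.+1)) (dual_dev t i).
Proof.
rewrite mulnS addnC addn3.
have t1 : ((3 * t).+1 <= (3 * t).+3)%N by exact: leq_trans (leqnSn _) (leqnSn _).
apply: measurable_vecD; last exact: adapted_vec_mono (revealed_mono t1) (@adapted_val_noise t i).
apply: measurable_vecZ => j; under eq_fun do rewrite mxE.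
apply: measurable_funM; first by apply: adapted_sel_dev; exact: leqnSn.
exact: (adapted_vec_mono (revealed_mono t1) (@adapted_dual_move t i) j).
Qed.

Let dual_dev_mean_eq0 t i v : adapted_vec F (rev (3 * t)) v -> L2v P v ->
  mean P (fun w => dotv (v w) (dual_dev t i w)) = 0.
Proof.
move=> av Lv.
have -> : (fun w => dotv (v w) (dual_dev t i w)) =
    (fun w => tau * (sel_dev t i w * dotv (v w) (dual_move t i w)) + dotv (v w) (val_noise t i w)).
  by apply/funext => w; rewrite /dual_dev dotvDr !dotvZr.
have Ie : intg P (fun w => dotv (v w) (dual_move t i w)) by apply: intg_dotv => //; exact: dual_move_L2.
rewrite meanD ?meanZ; [|exact: sel_dev_intg|by apply: intgZ; exact: sel_dev_intg|
  by apply: intg_dotv => //; exact: val_noise_L2].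
rewrite val_noise_mean_eq0// sel_dev_mean_eq0 ?mulr0 ?addr0//.
apply: measurable_dotv; last exact: adapted_dual_move.
exact: adapted_vec_mono (revealed_mono (leqnSn _)) av.
Qed.

Let ee t i := mean P (fun w => dotv (dual_move t i w) (dual_move t i w)).
Let zz t i := mean P (fun w => dotv (val_noise t i w) (val_noise t i w)).

Let dual_dev_sqr_mean t i :
  mean P (fun w => dotv (dual_dev t i w) (dual_dev t i w)) = tau ^+ 2 * (p - 1) * ee t i + zz t i.
Proof.
have Ie : intg P (fun w => dotv (dual_move t i w) (dual_move t i w)) by case: (dual_move_L2 t i).
have Iz : intg P (fun w => dotv (val_noise t i w) (val_noise t i w)) by case: (val_noise_L2 t i).
have Iez : intg P (fun w => dotv (dual_move t i w) (val_noise t i w)).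
  by apply: intg_dotv; [exact: dual_move_L2|exact: val_noise_L2].
have aez : adapted F (rev (3 * t).+1) (fun w => dotv (dual_move t i w) (val_noise t i w)).
  by apply: measurable_dotv; [exact: adapted_dual_move|exact: adapted_val_noise].
have aee : adapted F (rev (3 * t).+1) (fun w => dotv (dual_move t i w) (dual_move t i w)).
  by apply: measurable_dotv; exact: adapted_dual_move.
have -> : (fun w => dotv (dual_dev t i w) (dual_dev t i w)) = (fun w =>
    tau ^+ 2 * (p - 1) * dotv (dual_move t i w) (dual_move t i w) +
    (sel_dev t i w * (tau ^+ 2 * (2 - p) * dotv (dual_move t i w) (dual_move t i w)
                 + 2 * tau * dotv (dual_move t i w) (val_noise t i w)) +
    dotv (val_noise t i w) (val_noise t i w))).
  apply/funext => w; rewrite /dual_dev.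
  have := sel_dev_sqr t i w; move: (sel_dev t i w) (dual_move t i w) (val_noise t i w) => u e z uE.
  rewrite !dotvE (dotvC z e) [LHS](_ : _ = tau ^+ 2 * (u ^+ 2) * dotv e e +
    2 * tau * u * dotv e z + dotv z z); last by ring.
  by rewrite uE; ring.
have I2 : intg P (fun w => tau ^+ 2 * (2 - p) * dotv (dual_move t i w) (dual_move t i w)
                 + 2 * tau * dotv (dual_move t i w) (val_noise t i w)).
  by apply: intgD; exact: intgZ.
rewrite meanD ?meanZ ?meanD//; last 3 first.
- exact: sel_dev_intg.
- exact: intgZ.
- by apply: intgD => //; exact: sel_dev_intg.
rewrite sel_dev_mean_eq0 ?add0r//.
by apply: measurable_funD; apply: measurable_funM => //.
Qed.

Definition dual_dev_sum T i w : 'cV[R]_m := \sum_(0 <= t < T) dual_dev t i w.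

Let dual_dev_sum_L2 T i : L2v P (dual_dev_sum T i).
Proof. by apply: L2v_sum => t; exact: dual_dev_L2. Qed.

Let adapted_dual_dev_sum T i : adapted_vec F (rev (3 * T)) (dual_dev_sum T i).
Proof.
elim: T => [|T IH].
  have -> : dual_dev_sum 0 i = fun=> 0 by apply/funext => w; rewrite /dual_dev_sum big_nil.
  exact: measurable_vec_cst.
have -> : dual_dev_sum T.+1 i = fun w => dual_dev_sum T i w + dual_dev T i w.
  by apply/funext => w; rewrite /dual_dev_sum big_nat_recr.
apply: measurable_vecD; last exact: adapted_dual_dev.
by apply: adapted_vec_mono IH; apply: revealed_mono; rewrite leq_mul2l/=.
Qed.

Let dual_dev_sum_mean_eq0 T i (v : 'cV[R]_m) : mean P (fun w => dotv v (dual_dev_sum T i w)) = 0.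
Proof.
have -> : (fun w => dotv v (dual_dev_sum T i w)) = (fun w => \sum_(0 <= t < T) dotv v (dual_dev t i w)).
  by apply/funext => w; rewrite dotv_sumr.
rewrite mean_sum; last by move=> t; apply: intg_dotv; [exact: L2v_cst|exact: dual_dev_L2].
rewrite big1// => t _; apply: (@dual_dev_mean_eq0 t i (fun=> v)); last exact: L2v_cst.
exact: measurable_vec_cst.
Qed.

Let dual_dev_sum_sqr_mean T i : mean P (fun w => dotv (dual_dev_sum T i w) (dual_dev_sum T i w)) =
  \sum_(0 <= t < T) (tau ^+ 2 * (p - 1) * ee t i + zz t i).
Proof.
elim: T => [|T IH].
  rewrite big_nil; have -> : (fun w => dotv (dual_dev_sum 0 i w) (dual_dev_sum 0 i w)) = fun=> 0.
    by apply/funext => w; rewrite /dual_dev_sum big_nil dotv0l.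
  exact: mean_cst.
rewrite big_nat_recr//= -IH.
have -> : (fun w => dotv (dual_dev_sum T.+1 i w) (dual_dev_sum T.+1 i w)) = (fun w => dotv (dual_dev_sum T i w) (dual_dev_sum T i w) +
    (2 * dotv (dual_dev_sum T i w) (dual_dev T i w) + dotv (dual_dev T i w) (dual_dev T i w))).
  apply/funext => w; rewrite /dual_dev_sum big_nat_recr//= -/(dual_dev_sum T i w).
  by move: (dual_dev_sum T i w) (dual_dev T i w) => a b; rewrite !dotvE (dotvC b a); ring.
have Ic : intg P (fun w => dotv (dual_dev_sum T i w) (dual_dev T i w)).
  by apply: intg_dotv; [exact: dual_dev_sum_L2|exact: dual_dev_L2].
have [_ IA] := dual_dev_sum_L2 T i; have [_ Ia] := dual_dev_L2 T i.
rewrite !meanD//; [|exact: intgZ|by apply: intgD => //; exact: intgZ].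
by rewrite meanZ// dual_dev_mean_eq0 ?mulr0 ?add0r ?dual_dev_sqr_mean//; exact: dual_dev_sum_L2.
Qed.

(** The part of [dual_step] free of [v]. Of the [- tau / 2] squared moves given by the proximal
    step, [tau / 4] is spent by Young's inequality against [val_noise], and the remaining [tau / 4]
    is kept for [dual_rest_mean]. *)
Definition dual_noise t i w : R :=
  tau / 2 * (sel_dev t i w * (dotv (y t w i) (y t w i) - dotv (yfull t i w) (yfull t i w)))
  - dotv (y t w i) (val_noise t i w) - tau / 4 * dotv (dual_move t i w) (dual_move t i w)
  + tau^-1 * dotv (val_noise t i w) (val_noise t i w).

Let dual_noise_intg t i : intg P (dual_noise t i).
Proof.
have [_ Iy] := y_L2 t i; have [_ Iyb] := yfull_L2 t i; have [_ Ie] := dual_move_L2 t i.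
have [_ Iz] := val_noise_L2 t i.
apply: intgD; last exact: intgZ.
apply: intgB; last exact: intgZ.
apply: intgB; last by apply: intg_dotv; [exact: y_L2|exact: val_noise_L2].
by apply: intgZ; apply: sel_dev_intg; exact: intgB.
Qed.

Let dual_noise_mean t i : mean P (dual_noise t i) = - (tau / 4) * ee t i + tau^-1 * zz t i.
Proof.
have [_ Iy] := y_L2 t i; have [_ Iyb] := yfull_L2 t i; have [_ Ie] := dual_move_L2 t i.
have [_ Iz] := val_noise_L2 t i.
have Iyy : intg P (fun w => sel_dev t i w *
    (dotv (y t w i) (y t w i) - dotv (yfull t i w) (yfull t i w))).
  by apply: sel_dev_intg; exact: intgB.
have Iyz : intg P (fun w => dotv (y t w i) (val_noise t i w)).
  by apply: intg_dotv; [exact: y_L2|exact: val_noise_L2].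
have H1 := intgZ (tau / 2) Iyy; have H2 := intgZ (tau / 4) Ie; have H3 := intgZ tau^-1 Iz.
rewrite /dual_noise meanD//; last by apply: intgB => //; exact: intgB.
rewrite meanB//; last exact: intgB.
have E1 : mean P (fun w => sel_dev t i w *
    (dotv (y t w i) (y t w i) - dotv (yfull t i w) (yfull t i w))) = 0.
  apply: sel_dev_mean_eq0; last exact: intgB.
  have ay := adapted_vec_mono (revealed_mono (leqnSn _)) (@adaptedy t i).
  have ayb := @adapted_yfull t i.
  by apply: measurable_funB; apply: measurable_dotv.
have E2 : mean P (fun w => dotv (y t w i) (val_noise t i w)) = 0.
  exact: (@val_noise_mean_eq0 t i (fun w => y t w i) (@adaptedy t i) (y_L2 t i)).
by rewrite meanB// !meanZ// E1 E2 mulr0 subr0 sub0r mulNr.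
Qed.

(** The three-point inequality bounds the left-hand side through the virtual step [yfull], whereas
    the iterate moves only when [i] is drawn. Its potential changes by [sel] times the virtual
    change, and replacing [1] by [p * sel] costs [tau / 2 * sel_dev] times
    [|v - y|^2 - |v - yfull|^2]. Expanding the squares leaves one part linear in [v] and one free of
    it. *)
Lemma dual_step t i w v : Yset pb i v ->
  (dotv v (gin pb i (x t w)) - conjr (fout pb i) v)
  - (dotv (yfull t i w) (gin pb i (x t w)) - conjr (fout pb i) (yfull t i w)) <=
  tau * p / 2 * (dotv (v - y t w i) (v - y t w i) - dotv (v - y t.+1 w i) (v - y t.+1 w i))
  + dotv v (dual_dev t i w) + dual_noise t i w.
Proof.
move=> vY; have [ybY ybmin] := yfull_prox t i w.
have := prox_ineq (@conjr_convex _ _ (fout pb i)) ybY ybmin vY.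
rewrite y_next.
have -> : gin pb i (x t w) = batch_val t i w + val_noise t i w by rewrite /val_noise addrC subrK.
have -> : yfull t i w - y t w i = dual_move t i w by [].
have -> : yfull t i w = y t w i + dual_move t i w by rewrite /dual_move addrC subrK.
rewrite /dual_noise /dual_dev.
have -> : yfull t i w = y t w i + dual_move t i w by rewrite /dual_move addrC subrK.
have young : 0 <= tau / 4 * dotv (dual_move t i w) (dual_move t i w) + dotv (dual_move t i w) (val_noise t i w)
    + tau^-1 * dotv (val_noise t i w) (val_noise t i w).
  have := dotv_young (dual_move t i w) (- val_noise t i w) (divr_gt0 tau_gt0 (ltr0n R 2)).
  rewrite !dotvNr dotvNl opprK.
  have -> : dotv (val_noise t i w) (val_noise t i w) / (2 * (tau / 2)) =
    tau^-1 * dotv (val_noise t i w) (val_noise t i w) by field; rewrite gt_eqF.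
  by lra.
move: young; rewrite /sel_dev.
(* In each case of the draw the claim is now linear in the dot products. *)
move: (y t w i) (dual_move t i w) (val_noise t i w) (batch_val t i w) (conjr _ v) (conjr _ _) => Y e z g cv cy.
case: (sel St t i w); rewrite ?mulr1n ?mulr0n ?mulr1 ?mulr0 ?scale1r ?scale0r ?subr0 ?addr0 !dotvE
  ?(dotvC e Y) ?(dotvC v Y) ?(dotvC e v) ?(dotvC z e) ?(dotvC z Y) ?(dotvC z v)
  ?(dotvC g Y) ?(dotvC g v) ?(dotvC g e) => H1 H2; lra.
Qed.

(* [v] may depend on the whole run, so [dotv v (dual_dev_sum T i w)] need not have mean zero;
   Young's inequality leaves the second moment of [dual_dev_sum T i], a sum of orthogonal terms. *)
Lemma dual_sum T i w v : Yset pb i v ->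
  \sum_(0 <= t < T) ((dotv v (gin pb i (x t w)) - conjr (fout pb i) v)
    - (dotv (yfull t i w) (gin pb i (x t w)) - conjr (fout pb i) (yfull t i w))) <=
  3 * tau * p / 2 * dotv (v - y0 i) (v - y0 i)
  + ((4 * tau * p)^-1 * dotv (dual_dev_sum T i w) (dual_dev_sum T i w) + dotv (y0 i) (dual_dev_sum T i w)
     + \sum_(0 <= t < T) dual_noise t i w).
Proof.
move=> vY; pose U t := dotv (v - y t w i) (v - y t w i).
apply: (@le_trans _ _ (\sum_(0 <= t < T)
    (tau * p / 2 * (U t - U t.+1) + dotv v (dual_dev t i w) + dual_noise t i w))).
  by apply: ler_sum => t _; exact: dual_step.
rewrite !big_split/= -dotv_sumr -/(dual_dev_sum T i w) -mulr_sumr.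
have -> : \sum_(0 <= t < T) (U t - U t.+1) = U 0 - U T.
  have := telescope_sumr U (leq0n T) => H.
  by rewrite -[RHS]opprB -H -sumrN; apply: eq_bigr => t _; rewrite opprB.
have U0 : U 0 = dotv (v - y0 i) (v - y0 i) by rewrite /U (y_init hit).
have UT : 0 <= U T by exact: dotv_ge0.
have p0 : 0 < p := lt_le_trans ltr01 p_ge1.
(* The Young weight [2 tau p] turns the variance [tau^2 (p - 1)] of the draw into
   [tau / 4 * (1 - 1 / p)], below the [tau / 4] kept in [dual_noise]. It costs [tau p], which with
   [tau p / 2] from the telescoped potential makes [3 tau p / 2]. *)
have lam0 : 0 < 2 * tau * p := mulr_gt0 (mulr_gt0 (ltr0Sn R 1) tau_gt0) p0.
have H := dotv_young (v - y0 i) (dual_dev_sum T i w) lam0; rewrite dotvBl in H.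
have tp : 0 <= tau * p / 2 * U T.
  exact: mulr_ge0 (divr_ge0 (mulr_ge0 (ltW tau_gt0) (ltW p0)) (ler0n R 2)) UT.
have E : dotv (dual_dev_sum T i w) (dual_dev_sum T i w) / (2 * (2 * tau * p)) =
    (4 * tau * p)^-1 * dotv (dual_dev_sum T i w) (dual_dev_sum T i w).
  rewrite mulrC; congr (_^-1 * _); ring.
rewrite E in H; rewrite U0; lra.
Qed.

Let zz_le t i : zz t i <= V0 / B%:R.
Proof. exact: val_noise_variance. Qed.

Let ee_ge0 t i : 0 <= ee t i.
Proof. by apply: mean_ge0 => w; exact: dotv_ge0. Qed.

Let zz_ge0 t i : 0 <= zz t i.
Proof. by apply: mean_ge0 => w; exact: dotv_ge0. Qed.

Definition dual_rest T i w : R := (4 * tau * p)^-1 * dotv (dual_dev_sum T i w) (dual_dev_sum T i w)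
  + dotv (y0 i) (dual_dev_sum T i w) + \sum_(0 <= t < T) dual_noise t i w.

Let yA_intg T i : intg P (fun w => dotv (y0 i) (dual_dev_sum T i w)).
Proof. by apply: intg_dotv; [exact: L2v_cst|exact: dual_dev_sum_L2]. Qed.

Lemma dual_rest_intg T i : intg P (dual_rest T i).
Proof.
have [_ IA] := dual_dev_sum_L2 T i.
apply: intgD; first by apply: intgD; [exact: intgZ|exact: yA_intg].
by apply: intg_sum => t; exact: dual_noise_intg.
Qed.

Lemma dual_rest_mean T i : mean P (dual_rest T i) <= T%:R * (5 / 4 * (V0 / (tau * B%:R))).
Proof.
have [_ IA] := dual_dev_sum_L2 T i.
have Is : intg P (fun w => \sum_(0 <= t < T) dual_noise t i w).
  by apply: intg_sum => t; exact: dual_noise_intg.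
have IyA := @yA_intg T i.
rewrite meanD//; last by apply: intgD => //; exact: intgZ.
rewrite meanD//; last exact: intgZ.
rewrite meanZ// dual_dev_sum_mean_eq0 addr0 mean_sum; last by move=> t; exact: dual_noise_intg.
rewrite dual_dev_sum_sqr_mean mulr_sumr -big_split/=.
have -> : T%:R * (5 / 4 * (V0 / (tau * B%:R))) =
    \sum_(0 <= t < T) (5 / 4 * (V0 / (tau * B%:R))).
  by rewrite sumr_const_nat subn0 mulr_natl.
apply: ler_sum => t _; rewrite dual_noise_mean.
have p0 : 0 < p := lt_le_trans ltr01 p_ge1.
(* The first term cancels the negative squared moves of [dual_noise]; the last is at most a quarter
   of [zz / tau], which with the one in [dual_noise] explains [5 / 4]. *)
have -> : (4 * tau * p)^-1 * (tau ^+ 2 * (p - 1) * ee t i + zz t i) =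
    tau / 4 * ee t i - tau / (4 * p) * ee t i + p^-1 * (tau^-1 * zz t i) / 4.
  by field; rewrite !gt_eqF.
have H1 : 0 <= tau / (4 * p) * ee t i.
  exact: mulr_ge0 (divr_ge0 (ltW tau_gt0) (mulr_ge0 (ler0n R 4) (ltW p0))) (@ee_ge0 t i).
have t0 : 0 <= tau^-1 by rewrite invr_ge0 ltW.
have z0 : 0 <= tau^-1 * zz t i := mulr_ge0 t0 (@zz_ge0 t i).
have H2 : p^-1 * (tau^-1 * zz t i) <= tau^-1 * zz t i.
  by rewrite ler_piMl// invf_le1.
have H3 : tau^-1 * zz t i <= V0 / (tau * B%:R).
  rewrite [V0 / _](_ : _ = tau^-1 * (V0 / B%:R)); last by field; rewrite B0 gt_eqF.
  by rewrite ler_wpM2l.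
lra.
Qed.

(** * Primal part: subgradients, direction errors and square integrability *)

Variable xs : 'cV[R]_d.
Hypothesis hxs : is_argmin (Xset pb) (Fobj pb) xs.

Let rxs : reg_dom pb xs := Fobj_argmin hA1 hxs.
Let Xxs : Xset pb xs := rxs.1.

Let gin_lip i u u' : Xset pb u -> Xset pb u' ->
  norm2 (gin pb i u - gin pb i u') <= L * norm2 (u - u').
Proof.
move=> Xu Xu'; apply: le_trans (gin_lipschitz k1_gt0 nrmP nrm_bounds hA2 i Xu Xu') _.
by rewrite ler_wpM2r ?norm2_ge0// ler_wpM2l ?(ltW kn_gt0)// ler_norm.
Qed.

Let grad_lower i v u u' : Yset pb i v -> Xset pb u -> Xset pb u' ->
  dotv v (gin pb i u - gin pb i u') <= dotv v (gradJ pb i u *m (u - u')).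
Proof.
move=> vY Xu Xu'.
exact: (dual_subgradient_ineq (Xset_gdom hA2)
  (@subdiff_gin_diam _ _ _ _ _ _ _ _ _ _ _ _ _ k1_gt0 nrmP nrm_bounds hO hA4 i)
  (f_monotone hA3 (i := i)) vY Xu (Xset_gdom hA2 Xu') (gradJP hO i Xu)).
Qed.

Let dotv_gin i v u u' : Yset pb i v -> Xset pb u -> Xset pb u' ->
  dotv v (gin pb i u - gin pb i u') <= L * Cy * norm2 (u - u').
Proof.
move=> vY Xu Xu'; apply: le_trans (cauchy_schwarz _ _) _.
have v_le := Yset_norm2 k1_gt0 nrmP nrm_bounds hA3 vY.
apply: le_trans (ler_pM (norm2_ge0 _) (norm2_ge0 _) v_le (gin_lip i Xu Xu')) _.
by rewrite mulrCA mulrA.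
Qed.

Let grad_upper i v u u' : Yset pb i v -> Xset pb u -> Xset pb u' ->
  dotv v (gradJ pb i u *m (u - u')) <= (L + K) * Cy * norm2 (u - u').
Proof.
move=> vY Xu Xu'.
have := dual_subgradient_upper (Xset_convex hA1) (Xset_gdom hA2) K_ge0
  (@subdiff_gin_diam _ _ _ _ _ _ _ _ _ _ _ _ _ k1_gt0 nrmP nrm_bounds hO hA4 i)
  (fun u Xu => ex_intro _ _ (gradJP hO i Xu)) (@gin_lip i)
  (f_monotone hA3 (i := i)) vY Xu Xu' (gradJP hO i Xu) => /le_trans; apply.
rewrite ler_wpM2r ?norm2_ge0// ler_wpM2l ?addr_ge0//.
exact: (Yset_norm2 k1_gt0 nrmP nrm_bounds hA3 vY).
Qed.

Let sum_sel t w : \sum_(i < n) S%:R^-1 * (sel St t i w)%:R = 1 :> R.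
Proof.
rewrite -mulr_sumr -natr_sum -(St_card hin t w) -sum1_card big_mkcond/=.
rewrite (eq_bigr (fun i => (sel St t i w : nat))); last by move=> i _; rewrite /sel; case: ifP.
rewrite mulVf// pnatr_eq0 -lt0n.
have [+ _] := andP S_range; rewrite -(St_card hin t w) -sum1_card big_mkcond/=.
by rewrite (eq_bigr (fun i => (sel St t i w : nat)))// => i _; rewrite /sel; case: ifP.
Qed.

Definition grad_dev t i b w : 'cV[R]_d :=
  (gradJ pb i (x t w) - dgsamp pb i (x t w) (zeta' t i b w))^T *m yfull t i w.

Definition dir_mean t w : 'cV[R]_d := S%:R^-1 *: \sum_(i < n) (sel St t i w)%:R *:
  ((gradJ pb i (x t w))^T *m yfull t i w).

Definition dir_noise t w : 'cV[R]_d := dir_mean t w - dir t w.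

Lemma dir_noiseE t w : dir_noise t w = \sum_(i < n) (S%:R^-1 * (sel St t i w)%:R) *:
  \sum_(b < B) B%:R^-1 *: grad_dev t i b w.
Proof.
rewrite /dir_noise /dir_mean /dir -scalerBr -sumrB scaler_sumr; apply: eq_bigr => i _.
rewrite -scalerBr scalerA; congr (_ *: _).
rewrite -scaler_sumr /grad_dev -mulmx_suml -linear_sum/= sumrB sumr_const card_ord.
rewrite -mulmxBl -linearB/= scalemxAl -linearZ/= scalerBr.
by rewrite -(scaler_nat B (gradJ pb i (x t w))) scalerA mulVf// scale1r.
Qed.

Let grad_dev_joint (Q : set (input_index B)) t i : rev (3 * t).+1 `<=` Q ->
  measurable_vec (fun r : past F Q * Z =>
    (gradJ pb i (x t r.1) - dgsamp pb i (x t r.1) r.2)^T *m yfull t i r.1).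
Proof.
move=> tQ.
have ax := adapted_vec_mono (subset_trans (revealed_mono (leqnSn _)) tQ) (@adaptedx t).
have ay := adapted_vec_mono tQ (@adapted_yfull t i).
apply: measurable_mulmx => [l j|j]; last first.
  have mj : measurable_fun [set: past F Q] (fun w : past F Q => yfull t i w j 0) by exact: ay.
  exact: measurableT_comp mj measurable_fst.
have -> : (fun r : past F Q * Z => (gradJ pb i (x t r.1) - dgsamp pb i (x t r.1) r.2)^T l j) =
    (fun r => gradJ pb i (x t r.1) j l - dgsamp pb i (x t r.1) r.2 j l).
  by apply/funext => r; rewrite [LHS]mxE [LHS]mxE [X in _ + X = _]mxE.
apply: measurable_funB.
  have mJ : measurable_fun [set: past F Q] (fun w : past F Q => gradJ pb i (x t w) j l).
    exact: (measurable_gradJ_comp hO hA1 ax (x_in t)).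
  exact: measurableT_comp mJ measurable_fst.
exact: (measurable_dgsamp_joint hO hA1 ax (x_in t)).
Qed.

Let grad_dev_measurable t i b : measurable_vec (grad_dev t i b).
Proof.
have tQ : rev (3 * t).+1 `<=` rev (3 * t).+3.
  by apply: revealed_mono; exact: leq_trans (leqnSn _) (leqnSn _).
have mz := @adapted_zeta' R n dZ Z dO O P B St zeta zeta' (rev (3 * t).+3) t i b (ltnSn _).
have aj : adapted_vec F (rev (3 * t).+3) (grad_dev t i b).
  move=> l; have mj := @grad_dev_joint (rev (3 * t).+3) t i tQ l.
  by have := measurableT_comp mj (measurable_fun_pair (@measurable_id _ _ setT) mz).
exact: mvec aj.
Qed.

Let V1_ge0 : 0 <= V1.
Proof. by rewrite mulr_ge0 ?sqr_ge0. Qed.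

Let grad_dev_var w t i : (\int[law pb i]_z (dotv
    ((gradJ pb i (x t w) - dgsamp pb i (x t w) z)^T *m yfull t i w)
    ((gradJ pb i (x t w) - dgsamp pb i (x t w) z)^T *m yfull t i w))%:E <= V1%:E)%E.
Proof.
apply: le_trans (dgsamp_variance k1_gt0 nrmP nrm_bounds hO hA4 (yfull t i w) (x_in t w)
  (gradJP hO i (x_in t w))) _.
have kC0 : 0 <= kn * Cy := mulr_ge0 (ltW kn_gt0) Cy_ge0.
have ky0 : 0 <= kn * norm2 (yfull t i w) := mulr_ge0 (ltW kn_gt0) (norm2_ge0 _).
rewrite lee_fin ler_wpM2r ?sqr_ge0// (ler_pXn2r _ ky0 kC0)//.
by rewrite ler_pM2l// yfull_norm.
Qed.

Let nrev' t i b : ~ rev (3 * t).+2 (in_zeta' t i b).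
Proof. by rewrite /revealed/= ltnn. Qed.

(** The indicator stays inside the mean, frozen while the second batch is integrated, so that
    [sum_sel] can later average the bounds to [V1]; dropping it would cost a factor [n / S]. *)
Let grad_dev_sel t i b : intg P (fun w => (sel St t i w)%:R * dotv (grad_dev t i b w) (grad_dev t i b w)) /\
  mean P (fun w => (sel St t i w)%:R * dotv (grad_dev t i b w) (grad_dev t i b w)) <=
  mean P (fun w => (sel St t i w)%:R * V1).
Proof.
have mr := @grad_dev_joint (rev (3 * t).+2) t i (revealed_mono (leqnSn (3 * t).+1)).
have as_ := @sel_adapted t i (3 * t).+2 (ltnSn _).
apply: (zeta'_mean_le (h := fun r => (sel St t i r.1)%:R * dotv
    ((gradJ pb i (x t r.1) - dgsamp pb i (x t r.1) r.2)^T *m yfull t i r.1)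
    ((gradJ pb i (x t r.1) - dgsamp pb i (x t r.1) r.2)^T *m yfull t i r.1)) hin (@nrev' t i b)).
- apply: measurable_funM; last exact: measurable_dotv.
  exact: measurableT_comp as_ measurable_fst.
- by move=> r; rewrite mulr_ge0// dotv_ge0.
- apply: (intg_dom _ (intg_cst P V1)) => [|w].
    by apply: measurable_funM; [exact: (adapted_measurable mI as_)|exact: measurable_cst].
  by case: (sel _ _ _ _); rewrite ?mul1r ?mul0r ?normr0// ger0_norm.
- move=> w; case: (sel _ _ _ _).
    by under eq_integral do rewrite mul1r; rewrite mul1r; exact: grad_dev_var.
  by under eq_integral do rewrite mul0r; rewrite mul0r integral0.
Qed.

Let grad_dev_L2 t i b : L2v P (grad_dev t i b).
Proof.
have mr := @grad_dev_joint (rev (3 * t).+2) t i (revealed_mono (leqnSn (3 * t).+1)).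
have [] := zeta'_mean_le (h := fun r => dotv
    ((gradJ pb i (x t r.1) - dgsamp pb i (x t r.1) r.2)^T *m yfull t i r.1)
    ((gradJ pb i (x t r.1) - dgsamp pb i (x t r.1) r.2)^T *m yfull t i r.1)) hin (@nrev' t i b)
    (measurable_dotv mr mr) (fun r => dotv_ge0 _) (intg_cst P V1) (fun w => @grad_dev_var w t i).
by move=> Ir _; split => //; exact: grad_dev_measurable.
Qed.

(** Jensen twice, over the drawn blocks and over the batch. Nothing is gained from averaging, but a
    bound [V1] free of [B] suffices, since it will be divided by [eta]. *)
Let dir_noise_sqr t w : dotv (dir_noise t w) (dir_noise t w) <= \sum_(i < n) S%:R^-1 * \sum_(b < B) B%:R^-1 *
  ((sel St t i w)%:R * dotv (grad_dev t i b w) (grad_dev t i b w)).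
Proof.
rewrite dir_noiseE; apply: le_trans (jensen_sqnorm _ _ _) _ => [i|//|].
  by rewrite mulr_ge0// invr_ge0.
apply: ler_sum => i _; rewrite -mulrA ler_wpM2l ?invr_ge0//.
under [leRHS]eq_bigr do rewrite mulrCA.
rewrite -mulr_sumr ler_wpM2l//; apply: jensen_sqnorm => [b|]; first by rewrite invr_ge0.
by rewrite sumr_const card_ord -[_ *+ B]mulr_natr mulVf.
Qed.

Let sel_measurable t i : measurable_fun [set: O] (fun w => (sel St t i w)%:R : R).
Proof. exact: (adapted_measurable mI (@sel_adapted t i (3 * t).+2 (ltnSn _))). Qed.

Let dir_noise_measurable t : measurable_vec (dir_noise t).
Proof.
have -> : dir_noise t = fun w => \sum_(i < n) (S%:R^-1 * (sel St t i w)%:R) *: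
    \sum_(b < B) B%:R^-1 *: grad_dev t i b w by apply/funext => w; exact: dir_noiseE.
apply: measurable_vec_sum => i; apply: measurable_bool_scale.
  by apply: measurable_funM => //; exact: sel_measurable.
by apply: measurable_vec_sum => b; apply: measurable_vecZ; exact: grad_dev_measurable.
Qed.

Let dir_noise_dom_intg t : intg P (fun w => \sum_(i < n) S%:R^-1 * \sum_(b < B) B%:R^-1 *
  ((sel St t i w)%:R * dotv (grad_dev t i b w) (grad_dev t i b w))).
Proof.
apply: intg_sum => i; apply: intgZ; apply: intg_sum => b; apply: intgZ.
by have [] := grad_dev_sel t i b.
Qed.

Let dir_noise_L2 t : L2v P (dir_noise t).
Proof. exact: L2v_dom (@dir_noise_measurable t) (@dir_noise_dom_intg t) (@dir_noise_sqr t). Qed.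

Let dir_noise_var t : mean P (fun w => dotv (dir_noise t w) (dir_noise t w)) <= V1.
Proof.
have [_ Ig] := dir_noise_L2 t.
apply: le_trans (le_mean Ig (@dir_noise_dom_intg t) (@dir_noise_sqr t)) _.
have Is i b := (grad_dev_sel t i b).1.
have Iss i : intg P (fun w => \sum_(b < B) B%:R^-1 *
    ((sel St t i w)%:R * dotv (grad_dev t i b w) (grad_dev t i b w))).
  by apply: intg_sum => b; apply: intgZ.
have Isel i : intg P (fun w => (sel St t i w)%:R * V1).
  apply: (intg_dom _ (intg_cst P V1)) => [|w].
    by apply: measurable_funM; [exact: sel_measurable|exact: measurable_cst].
  by case: (sel _ _ _ _); rewrite ?mul1r ?mul0r ?normr0// ger0_norm.
rewrite mean_sum; last by move=> i; exact: intgZ.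
apply: (@le_trans _ _ (mean P (fun w => \sum_(i < n) S%:R^-1 * ((sel St t i w)%:R * V1)))).
  rewrite mean_sum; last by move=> i; exact: intgZ.
  apply: ler_sum => i _; rewrite !meanZ// ler_wpM2l ?invr_ge0//.
  rewrite mean_sum; last by move=> b; exact: intgZ.
  apply: (@le_trans _ _ (\sum_(b < B) B%:R^-1 * mean P (fun w => (sel St t i w)%:R * V1))).
    by apply: ler_sum => b _; rewrite meanZ// ler_wpM2l ?invr_ge0//; exact: (grad_dev_sel t i b).2.
  by rewrite sumr_const card_ord -[_ *+ B]mulr_natl mulrA mulfV// mul1r.
have -> : (fun w => \sum_(i < n) S%:R^-1 * ((sel St t i w)%:R * V1)) = fun=> V1.
  by apply/funext => w; under eq_bigr do rewrite mulrA; rewrite -mulr_suml sum_sel mul1r.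
by rewrite mean_cst.
Qed.

Let HE t w v : dotv (dir_mean t w) v =
  \sum_(i < n) S%:R^-1 * (sel St t i w)%:R * dotv (yfull t i w) (gradJ pb i (x t w) *m v).
Proof.
rewrite /dir_mean dotvZl dotv_suml mulr_sumr; apply: eq_bigr => i _.
by rewrite dotvZl dotv_mulmx mulrA.
Qed.

Let sel_avg_le t w (a : 'I_n -> R) c : (forall i, a i <= c) ->
  \sum_(i < n) S%:R^-1 * (sel St t i w)%:R * a i <= c.
Proof.
move=> ac; have -> : c = \sum_(i < n) S%:R^-1 * (sel St t i w)%:R * c.
  by rewrite -mulr_suml sum_sel mul1r.
by apply: ler_sum => i _; rewrite ler_wpM2l// mulr_ge0// invr_ge0.
Qed.

Let H_upper t w u : Xset pb u -> dotv (dir_mean t w) (x t w - u) <= (L + K) * Cy * norm2 (x t w - u).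
Proof. by move=> Xu; rewrite HE; apply: sel_avg_le => i; apply: grad_upper (yfull_in t i w) (x_in t w) Xu. Qed.

Let grad_lower' t i w u : Xset pb u ->
  - (L * Cy * norm2 (x t w - u)) <= dotv (yfull t i w) (gradJ pb i (x t w) *m (x t w - u)).
Proof.
move=> Xu; apply: le_trans (grad_lower (yfull_in t i w) (x_in t w) Xu).
by rewrite lerNl -dotvNr opprB norm2_distC; apply: dotv_gin (yfull_in t i w) Xu (x_in t w).
Qed.

Let H_lower t w u : Xset pb u -> - (L * Cy * norm2 (x t w - u)) <= dotv (dir_mean t w) (x t w - u).
Proof.
move=> Xu; rewrite HE lerNl -sumrN; under eq_bigr do rewrite -mulrN.
by apply: sel_avg_le => i; rewrite lerNl; exact: grad_lower'.
Qed.

Let x_descent t w :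
  regr pb (x t.+1 w) - regr pb xs + dotv (dir t w) (x t.+1 w - xs) <=
  eta / 2 * (dotv (x t w - xs) (x t w - xs) - dotv (x t.+1 w - xs) (x t.+1 w - xs)
             - dotv (x t.+1 w - x t w) (x t.+1 w - x t w)).
Proof.
have [rx x_min] := x_prox t w.
have := prox_ineq (regr_convex hA1) rx x_min rxs.
have -> : dotv (x t.+1 w - xs) (x t.+1 w - xs) = dotv (x t w - xs) (x t w - xs)
    + 2 * dotv (x t.+1 w - x t w) (x t.+1 w - xs) - dotv (x t.+1 w - x t w) (x t.+1 w - x t w).
  have -> : x t w - xs = (x t.+1 w - xs) - (x t.+1 w - x t w).
    by apply/matrixP => i j; rewrite !mxE; ring.
  by move: (x t.+1 w - xs) (x t.+1 w - x t w) => a b; rewrite !dotvBl !dotvBr (dotvC a b); ring.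
rewrite -(opprB (x t.+1 w) xs) dotvNr; lra.
Qed.

(** The regularizer need not be Lipschitz; the bound follows from optimality of [xs] and the
    Lipschitz constant of the composite part. *)
Let regr_lower t w : - (L * Cy * norm2 (x t.+1 w - xs)) <= regr pb (x t.+1 w) - regr pb xs.
Proof.
have [rx _] := x_prox t w; have := hxs.2 _ rx.1.
rewrite /Fobj (regE hA1 rx) (regE hA1 rxs) -!EFinD lee_fin => H.
have n0 : n%:R != 0 :> R by rewrite pnatr_eq0 -lt0n.
have : n%:R^-1 * \sum_(i < n) fout pb i (gin pb i (x t.+1 w)) <=
    n%:R^-1 * \sum_(i < n) fout pb i (gin pb i xs) + L * Cy * norm2 (x t.+1 w - xs).
  have -> : L * Cy * norm2 (x t.+1 w - xs) =
      n%:R^-1 * \sum_(i < n) L * Cy * norm2 (x t.+1 w - xs).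
    by rewrite sumr_const card_ord -[X in _ = _ * X]mulr_natl mulKf.
  rewrite -mulrDr ler_wpM2l ?invr_ge0// -big_split/=; apply: ler_sum => i _.
  rewrite -lerBlDl; apply: le_trans (ler_norm _) _; apply: le_trans (f_lip i _ _) _.
  apply: le_trans (ler_wpM2l Cy_ge0 (gin_lip i rx.1 Xxs)) _.
  by rewrite mulrCA mulrA.
by lra.
Qed.

Let dirE t w v : dotv (dir t w) v = dotv (dir_mean t w) v - dotv (dir_noise t w) v.
Proof. by rewrite /dir_noise dotvBl; ring. Qed.

Let LKC_ge0 : 0 <= (L + K) * Cy := mulr_ge0 (addr_ge0 L_ge0 K_ge0) Cy_ge0.

Let am_gm (a s e : R) : 0 < e -> a * s <= e * s ^+ 2 + a ^+ 2 / (4 * e).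
Proof.
move=> e0; rewrite -subr_ge0.
have -> : e * s ^+ 2 + a ^+ 2 / (4 * e) - a * s = (2 * e * s - a) ^+ 2 / (4 * e).
  by field; rewrite gt_eqF.
by rewrite divr_ge0 ?sqr_ge0// mulr_ge0// ltW.
Qed.

(* The subgradients need not be bounded in the directions normal to [Xset pb], so
   square integrability of the iterates comes from the optimality of [xs]. *)
Let growth t w : dotv (x t.+1 w - xs) (x t.+1 w - xs) <=
  4 * dotv (x t w - xs) (x t w - xs) + 8 / eta ^+ 2 * dotv (dir_noise t w) (dir_noise t w)
  + (10 * (L * Cy) ^+ 2 + 2 * ((L + K) * Cy) ^+ 2) / eta ^+ 2.
Proof.
have H1 := x_descent t w; have H2 := regr_lower t w; rewrite dirE in H1.
have Xx1 := x_in t.+1 w.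
have H3 := H_lower t w Xxs; have H4 := H_upper t w Xx1.
(* The two terms in [x t.+1 w - xs] take [eta / 8] each, which leaves [eta / 4] of the available
   [eta / 2]; the squared step is absorbed completely. *)
have e8 : 0 < eta / 8 by rewrite divr_gt0.
have e2 : 0 < eta / 2 by rewrite divr_gt0.
have H5 := dotv_young (x t.+1 w - xs) (dir_noise t w) (divr_gt0 eta_gt0 (ltr0Sn R 3)).
have H6 := am_gm (L * Cy) (norm2 (x t.+1 w - xs)) e8.
have H7 := am_gm (L * Cy) (norm2 (x t w - xs)) e2.
have H8 := am_gm ((L + K) * Cy) (norm2 (x t w - x t.+1 w)) e2.
have HE1 : dotv (dir_mean t w) (x t.+1 w - xs) =
    dotv (dir_mean t w) (x t w - xs) - dotv (dir_mean t w) (x t w - x t.+1 w).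
  by rewrite -dotvBr; congr dotv; apply/matrixP => i j; rewrite !mxE; ring.
rewrite HE1 in H1; rewrite !norm2_sqr in H6 H7; rewrite norm2_distC norm2_sqr in H8.
rewrite norm2_distC in H4; rewrite dotvC in H5.
move: H1 H2 H3 H4 H5 H6 H7 H8.
move: (dotv (x t.+1 w - x t w) _) (dotv (x t.+1 w - xs) _) (dotv (x t w - xs) _).
move: (dotv (dir_noise t w) (dir_noise t w)) (dotv (dir_noise t w) _) (dotv (dir_mean t w) _) (dotv (dir_mean t w) _).
move: (norm2 (x t.+1 w - xs)) (norm2 (x t.+1 w - x t w)) (norm2 (x t w - xs)).
move: (regr pb (x t.+1 w) - regr pb xs) (L * Cy) ((L + K) * Cy).
move=> r c c' n1 n2 n3 N gx Ha Hb dd D' D H1 H2 H3 H4 H5 H6 H7 H8.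
have e0 : eta != 0 by rewrite gt_eqF.
rewrite -(ler_pM2l (divr_gt0 eta_gt0 (ltr0Sn R 3))).
have -> : eta / 4 * (4 * D + 8 / eta ^+ 2 * N + (10 * c ^+ 2 + 2 * c' ^+ 2) / eta ^+ 2) =
  eta * D + 2 * (N / eta) + (5 / 2 * (c ^+ 2 / eta) + 1 / 2 * (c' ^+ 2 / eta)) by field.
have E5 : N / (2 * (eta / 4)) = 2 * (N / eta) by field.
have E6 : c ^+ 2 / (4 * (eta / 8)) = 2 * (c ^+ 2 / eta) by field.
have E7 : c ^+ 2 / (4 * (eta / 2)) = 1 / 2 * (c ^+ 2 / eta) by field.
have E8 : c' ^+ 2 / (4 * (eta / 2)) = 1 / 2 * (c' ^+ 2 / eta) by field.
rewrite E5 in H5; rewrite E6 in H6; rewrite E7 in H7; rewrite E8 in H8; lra.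
Qed.

Let dx_L2 t : L2v P (fun w => x t w - xs).
Proof.
have mx t' : measurable_vec (fun w => x t' w - xs).
  by apply: measurable_vecB; [exact: mvec (@adaptedx t')|exact: measurable_vec_cst].
elim: t => [|t [_ ID]].
  by have -> : (fun w => x 0%N w - xs) = fun=> x0 - xs;
    [apply/funext => w; rewrite (x_init hit)|exact: L2v_cst].
have [_ Ig] := dir_noise_L2 t.
apply: (L2v_dom (mx _) _ (growth t)).
by apply: intgD (intg_cst _ _); apply: intgD; exact: intgZ.
Qed.

Definition lin_gap t i w : R := dotv (yfull t i w) (gradJ pb i (x t w) *m (x t w - xs)).

(** Equal to the average of [lin_gap] over all blocks minus [dotv (dir t w) (x t w - xs)], split
    into the error of the draw and that of the second batch, each of mean zero. *)
Definition primal_noise t w : R :=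
  \sum_(i < n) n%:R^-1 * (sel_dev t i w * lin_gap t i w) + dotv (dir_noise t w) (x t w - xs).

Let adapted_lin_gap t i : adapted F (rev (3 * t).+1) (lin_gap t i).
Proof.
have ax := adapted_vec_mono (revealed_mono (leqnSn _)) (@adaptedx t).
apply: measurable_dotv; first exact: (@adapted_yfull t i).
apply: measurable_mulmx => [j l|]; first exact: (measurable_gradJ_comp hO hA1 ax (x_in t)).
by apply: measurable_vecB; [exact: ax|exact: measurable_vec_cst].
Qed.

Let lin_gap_intg t i : intg P (lin_gap t i).
Proof.
have [_ ID] := dx_L2 t.
apply: (intg_dom (adapted_measurable mI (@adapted_lin_gap t i))
  (intgZ ((L + K) * Cy) (intgD (intg_cst P 1) ID))) => w.
have H1 := grad_lower' t i w Xxs; have H2 := grad_upper (yfull_in t i w) (x_in t w) Xxs.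
have s_le : norm2 (x t w - xs) <= 1 + dotv (x t w - xs) (x t w - xs).
  by rewrite -norm2_sqr; have := sqr_ge0 (norm2 (x t w - xs) - 1); have := norm2_ge0 (x t w - xs); nra.
have H3 := ler_wpM2l LKC_ge0 s_le.
have H4 : L * Cy * norm2 (x t w - xs) <= (L + K) * Cy * norm2 (x t w - xs).
  by rewrite ler_wpM2r ?norm2_ge0// ler_wpM2r// lerDl.
rewrite /lin_gap ler_norml; apply/andP; split; last exact: le_trans H3.
by rewrite lerNl; apply: le_trans H3; apply: le_trans H4; rewrite lerNl.
Qed.

Let dgsamp_law_mean0 i u yy v : Xset pb u ->
  (\int[law pb i]_z (dotv ((gradJ pb i u - dgsamp pb i u z)^T *m yy) v)%:E = 0)%E.
Proof.
move=> Xu; have Id j l : intg (law pb i) (fun z => dgsamp pb i u z j l).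
  by have := dgsamp_integrable hO i j l Xu.
have Ijl j l : intg (law pb i) (fun z => gradJ pb i u j l - dgsamp pb i u z j l).
  by apply: intgB => //; exact: intg_cst.
have Ijl' j l : intg (law pb i)
    (fun z => yy j 0 * v l 0 * (gradJ pb i u j l - dgsamp pb i u z j l)) by exact: intgZ.
have -> : (fun z => (dotv ((gradJ pb i u - dgsamp pb i u z)^T *m yy) v)%:E) = (fun z =>
    (\sum_(j < m) \sum_(l < d) yy j 0 * v l 0 * (gradJ pb i u j l - dgsamp pb i u z j l))%:E).
  apply/funext => z; congr (_%:E); rewrite dotv_mulmx; apply: eq_bigr => j _.
  rewrite mxE mulr_sumr; apply: eq_bigr => l _.
  have -> : (gradJ pb i u - dgsamp pb i u z) j l = gradJ pb i u j l - dgsamp pb i u z j l.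
    by rewrite [LHS]mxE [X in _ + X = _]mxE.
  by ring.
rewrite EFin_mean; last by apply: intg_sum => j; exact: intg_sum.
rewrite mean_sum; last by move=> j; exact: intg_sum.
rewrite big1// => j _; rewrite mean_sum// big1// => l _; rewrite meanZ// meanB//; last exact: intg_cst.
by rewrite mean_cst /mean /Rintegral (gradJ_mean hO)//= subrr mulr0.
Qed.

Let grad_dev_mean_eq0 t i b :
  intg P (fun w => (sel St t i w)%:R * dotv (grad_dev t i b w) (x t w - xs)) /\
  mean P (fun w => (sel St t i w)%:R * dotv (grad_dev t i b w) (x t w - xs)) = 0.
Proof.
have Ird := intg_dotv (grad_dev_L2 t i b) (dx_L2 t).
have Is : intg P (fun w => (sel St t i w)%:R * dotv (grad_dev t i b w) (x t w - xs)).
  apply: (intg_dom (g := fun w => `|dotv (grad_dev t i b w) (x t w - xs)|)) => [||w].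
  - by apply: measurable_funM; [exact: sel_measurable|exact: intg_measurable Ird].
  - exact: integrable_norm Ird.
  - by case: (sel _ _ _ _); rewrite ?mul1r ?mul0r ?normr0.
split=> //.
have mr := @grad_dev_joint (rev (3 * t).+2) t i (revealed_mono (leqnSn (3 * t).+1)).
have as_ := @sel_adapted t i (3 * t).+2 (ltnSn _).
have ax := adapted_vec_mono (revealed_mono (leq_trans (leqnSn _) (leqnSn _))) (@adaptedx t).
apply: (zeta'_mean_eq0 (h := fun r => (sel St t i r.1)%:R * dotv
    ((gradJ pb i (x t r.1) - dgsamp pb i (x t r.1) r.2)^T *m yfull t i r.1)
    (x t r.1 - xs)) hin (@nrev' t i b)) => //.
- apply: measurable_funM; first exact: measurableT_comp as_ measurable_fst.
  apply: measurable_dotv => //; apply: measurable_vecB; last exact: measurable_vec_cst.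
  move=> j; have mj : measurable_fun [set: past F (rev (3 * t).+2)]
    (fun w : past F (rev (3 * t).+2) => x t w j 0) by exact: ax.
  exact: measurableT_comp mj measurable_fst.
- move=> w; case: (sel St t i w).
    have E := @dgsamp_law_mean0 i (x t w) (yfull t i w) (x t w - xs) (x_in t w).
    by rewrite -[RHS]E; apply: eq_integral => z _; congr (_%:E); exact: mul1r.
  by rewrite integral0_eq// => z _; congr (_%:E); exact: mul0r.
Qed.

Let dir_noise_dx t w : dotv (dir_noise t w) (x t w - xs) = \sum_(i < n) S%:R^-1 * \sum_(b < B) B%:R^-1 *
  ((sel St t i w)%:R * dotv (grad_dev t i b w) (x t w - xs)).
Proof.
rewrite dir_noiseE dotv_suml; apply: eq_bigr => i _; rewrite dotvZl -mulrA; congr (_ * _).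
rewrite dotv_suml mulr_sumr; apply: eq_bigr => b _.
by rewrite dotvZl mulrCA.
Qed.

Lemma primal_noise_intg t : intg P (primal_noise t).
Proof.
apply: intgD; last exact: intg_dotv (dir_noise_L2 t) (dx_L2 t).
by apply: intg_sum => i; apply: intgZ; apply: sel_dev_intg; exact: lin_gap_intg.
Qed.

Lemma primal_noise_mean t : mean P (primal_noise t) = 0.
Proof.
have Ih i : intg P (fun w => sel_dev t i w * lin_gap t i w) by apply: sel_dev_intg; exact: lin_gap_intg.
rewrite meanD; [|by apply: intg_sum => i; exact: intgZ|exact: intg_dotv (dir_noise_L2 t) (dx_L2 t)].
rewrite mean_sum; last by move=> i; exact: intgZ.
rewrite big1 ?add0r; last first.
  by move=> i _; rewrite meanZ// (@sel_dev_mean_eq0 t i _ (@adapted_lin_gap t i) (@lin_gap_intg t i)) mulr0.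
rewrite [X in mean P X](_ : _ = fun w => \sum_(i < n) S%:R^-1 * \sum_(b < B) B%:R^-1 *
  ((sel St t i w)%:R * dotv (grad_dev t i b w) (x t w - xs))); last by apply/funext => w; exact: dir_noise_dx.
have Ir i b := (grad_dev_mean_eq0 t i b).1.
have Is i : intg P (fun w => \sum_(b < B) B%:R^-1 *
    ((sel St t i w)%:R * dotv (grad_dev t i b w) (x t w - xs))).
  by apply: intg_sum => b; exact: intgZ.
rewrite mean_sum; last by move=> i; exact: intgZ.
rewrite big1// => i _; rewrite meanZ// mean_sum; last by move=> b; exact: intgZ.
by rewrite big1 ?mulr0// => b _; rewrite meanZ// (grad_dev_mean_eq0 t i b).2 mulr0.
Qed.

(** Two multiples of the step length: [L * Cy] for moving the comparator term from [x t] to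
    [x t.+1], and [(L + K) * Cy] for the averaged direction tested on the step. *)
Let Kp := L * Cy + (L + K) * Cy.

Lemma primal_step t w (v : 'I_n -> 'cV[R]_m) : (forall i, Yset pb i (v i)) ->
  n%:R^-1 * \sum_(i < n) dotv (v i) (gin pb i (x t.+1 w) - gin pb i (x t w))
  + n%:R^-1 * \sum_(i < n) dotv (yfull t i w) (gin pb i (x t w) - gin pb i xs)
  + (regr pb (x t.+1 w) - regr pb xs) <=
  eta / 2 * (dotv (x t w - xs) (x t w - xs) - dotv (x t.+1 w - xs) (x t.+1 w - xs))
  + (Kp ^+ 2 / eta + eta^-1 * dotv (dir_noise t w) (dir_noise t w) + primal_noise t w).
Proof.
move=> vY; set del := x t.+1 w - x t w.
have n0 : n%:R != 0 :> R by rewrite pnatr_eq0 -lt0n.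
have avg (a : 'I_n -> R) c : (forall i, a i <= c) -> n%:R^-1 * \sum_(i < n) a i <= c.
  move=> ac; rewrite -[c](mulKf n0) ler_wpM2l ?invr_ge0//.
  have -> : n%:R * c = \sum_(i < n) c by rewrite sumr_const card_ord mulr_natl.
  exact: ler_sum.
have A1_ : n%:R^-1 * \sum_(i < n) dotv (v i) (gin pb i (x t.+1 w) - gin pb i (x t w)) <=
    L * Cy * norm2 del.
  by apply: avg => i; exact: dotv_gin (vY i) (x_in t.+1 w) (x_in t w).
have A2_ : n%:R^-1 * \sum_(i < n) dotv (yfull t i w) (gin pb i (x t w) - gin pb i xs) <=
    n%:R^-1 * \sum_(i < n) lin_gap t i w.
  rewrite ler_wpM2l ?invr_ge0//; apply: ler_sum => i _.
  exact: grad_lower (yfull_in t i w) (x_in t w) Xxs.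
have H1 := x_descent t w; rewrite dirE -/del in H1.
have H4 := H_upper t w (x_in t.+1 w); rewrite norm2_distC -/del in H4.
have primal_noiseE : primal_noise t w = n%:R^-1 * \sum_(i < n) lin_gap t i w - dotv (dir_mean t w) (x t w - xs)
    + dotv (dir_noise t w) (x t w - xs).
  rewrite /primal_noise; congr (_ + _); rewrite HE mulr_sumr -sumrB; apply: eq_bigr => i _.
  rewrite /sel_dev /p -/(lin_gap t i w); field; by rewrite n0 S0.
have HE1 : dotv (dir_mean t w) (x t.+1 w - xs) =
    dotv (dir_mean t w) (x t w - xs) - dotv (dir_mean t w) (x t w - x t.+1 w).
  by rewrite -dotvBr; congr dotv; apply/matrixP => i j; rewrite !mxE; ring.
have gE1 : dotv (dir_noise t w) (x t.+1 w - xs) =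
    dotv (dir_noise t w) (x t w - xs) + dotv (dir_noise t w) del.
  by rewrite -dotvDr; congr dotv; apply/matrixP => i j; rewrite !mxE; ring.
rewrite HE1 gE1 in H1.
have e4 : 0 < eta / 4 by rewrite divr_gt0.
(* The available [eta / 2 * |del|^2] is shared equally between the direction noise and the terms
   collected in [Kp]. *)
have H5 := dotv_young del (dir_noise t w) (divr_gt0 eta_gt0 (ltr0Sn R 1)).
have H6 := am_gm Kp (norm2 del) e4.
rewrite norm2_sqr in H6; rewrite dotvC in H5; rewrite primal_noiseE.
have e0 : eta != 0 by rewrite gt_eqF.
have E5 : dotv (dir_noise t w) (dir_noise t w) / (2 * (eta / 2)) = eta^-1 * dotv (dir_noise t w) (dir_noise t w) by field.
have E6 : Kp ^+ 2 / (4 * (eta / 4)) = Kp ^+ 2 / eta by field.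
rewrite E5 in H5; rewrite E6 in H6.
have KpE : Kp * norm2 del = L * Cy * norm2 del + (L + K) * Cy * norm2 del by rewrite mulrDl.
rewrite KpE in H6; lra.
Qed.

(** * Gap at the averaged iterate *)

Variables (yt : O -> 'I_n -> 'cV[R]_m) (T : nat).
Hypothesis T_gt0 : (0 < T)%N.
Hypothesis hyt : dual_selection pb (xbar x T) yt.

Let yt_in w i : Yset pb i (yt w i).
Proof. by have [] := yt_argmax hyt w i. Qed.

Let n0 : n%:R != 0 :> R.
Proof. by rewrite pnatr_eq0 -lt0n. Qed.

Let Fr u : R := n%:R^-1 * \sum_(i < n) fout pb i (gin pb i u) + regr pb u.

(** Although [yt] depends on the whole run, it is constant once [w] is fixed, so Jensen's inequality
    applies to each outcome separately. *)
Let Lag w u : R := n%:R^-1 * \sum_(i < n) (dotv (yt w i) (gin pb i u) - conjr (fout pb i) (yt w i))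
  + regr pb u.

Let Lag_convex w : convex_on (reg_dom pb) (Lag w).
Proof.
move=> t a b t01 ra rb; have [rc r_le] := regr_convex hA1 t01 ra rb; split => //.
have H : \sum_(i < n) (dotv (yt w i) (gin pb i (t *: a + (1 - t) *: b)) - conjr (fout pb i) (yt w i))
   <= t * \sum_(i < n) (dotv (yt w i) (gin pb i a) - conjr (fout pb i) (yt w i))
   + (1 - t) * \sum_(i < n) (dotv (yt w i) (gin pb i b) - conjr (fout pb i) (yt w i)).
  rewrite !mulr_sumr -big_split/=; apply: ler_sum => i _.
  have := dual_dotv_convex (Xset_convex hA1) (Xset_gdom hA2) (g_convex hA2 i)
    (f_monotone hA3 (i := i)) (yt_in w i) t01 ra.1 rb.1.
  by lra.
have ni : 0 <= n%:R^-1 :> R by rewrite invr_ge0.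
have := ler_wpM2l ni H; rewrite /Lag; lra.
Qed.

Let Lag_xbar w : reg_dom pb (xbar x T w) /\ Fr (xbar x T w) <= Lag w (xbar x T w).
Proof.
have [rb _] := convex_on_mean (x := fun t => x t.+1 w) (@Lag_convex w) T_gt0
  (fun t _ => (x_prox t w).1).
split => //; rewrite lerD2r ler_wpM2l ?invr_ge0//; apply: ler_sum => i _.
have [Yi max_i] := yt_argmax hyt w i.
apply: (conjr_argmax (f_convex hA3 i) Cy_ge0 (f_lip i)) => // v' v'Y.
by have := max_i v' v'Y; rewrite !conjugateE.
Qed.

Definition gap_bound w : R :=
  3 * tau * p / 2 * (n%:R^-1 * \sum_(i < n) dotv (yt w i - y0 i) (yt w i - y0 i))
  + n%:R^-1 * \sum_(i < n) dual_rest T i w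
  + eta / 2 * dotv (x0 - xs) (x0 - xs)
  + \sum_(0 <= t < T) (Kp ^+ 2 / eta + eta^-1 * dotv (dir_noise t w) (dir_noise t w) + primal_noise t w).

Let step_gap t w : Lag w (x t.+1 w) - Fr xs <=
  n%:R^-1 * \sum_(i < n) ((dotv (yt w i) (gin pb i (x t w)) - conjr (fout pb i) (yt w i))
    - (dotv (yfull t i w) (gin pb i (x t w)) - conjr (fout pb i) (yfull t i w)))
  + (n%:R^-1 * \sum_(i < n) dotv (yt w i) (gin pb i (x t.+1 w) - gin pb i (x t w))
  + n%:R^-1 * \sum_(i < n) dotv (yfull t i w) (gin pb i (x t w) - gin pb i xs)
  + (regr pb (x t.+1 w) - regr pb xs)).
Proof.
have H : \sum_(i < n) (dotv (yfull t i w) (gin pb i xs) - conjr (fout pb i) (yfull t i w)) <=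
    \sum_(i < n) fout pb i (gin pb i xs).
  by apply: ler_sum => i _; have := fenchel_young (gin pb i xs) (yfull_in t i w); lra.
have ni : 0 <= n%:R^-1 :> R by rewrite invr_ge0.
have := ler_wpM2l ni H; rewrite /Lag /Fr => H'.
have E : \sum_(i < n) (dotv (yt w i) (gin pb i (x t.+1 w)) - conjr (fout pb i) (yt w i)) =
  \sum_(i < n) ((dotv (yt w i) (gin pb i (x t w)) - conjr (fout pb i) (yt w i))
    - (dotv (yfull t i w) (gin pb i (x t w)) - conjr (fout pb i) (yfull t i w)))
  + \sum_(i < n) dotv (yt w i) (gin pb i (x t.+1 w) - gin pb i (x t w))
  + \sum_(i < n) dotv (yfull t i w) (gin pb i (x t w) - gin pb i xs)
  + \sum_(i < n) (dotv (yfull t i w) (gin pb i xs) - conjr (fout pb i) (yfull t i w)).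
  by rewrite -!big_split/=; apply: eq_bigr => i _; rewrite !dotvBr; ring.
rewrite E; lra.
Qed.

Let gap w : Fr (xbar x T w) - Fr xs <= T%:R^-1 * gap_bound w.
Proof.
have [_ F_le] := Lag_xbar w.
have [_ L_le] := convex_on_mean (x := fun t => x t.+1 w) (@Lag_convex w) T_gt0
  (fun t _ => (x_prox t w).1).
have T0 : 0 < T%:R :> R by rewrite ltr0n.
have Tinv : T%:R^-1 * (T%:R * Fr xs) = Fr xs by rewrite mulKf// gt_eqF.
apply: (@le_trans _ _ (T%:R^-1 * (\sum_(0 <= t < T) Lag w (x t.+1 w) - T%:R * Fr xs))).
  by rewrite mulrBr Tinv lerD2r; exact: le_trans F_le L_le.
rewrite ler_wpM2l ?invr_ge0//.
have -> : T%:R * Fr xs = \sum_(0 <= t < T) Fr xs by rewrite sumr_const_nat subn0 mulr_natl.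
rewrite -sumrB.
pose D t := dotv (x t w - xs) (x t w - xs).
pose dual t i := (dotv (yt w i) (gin pb i (x t w)) - conjr (fout pb i) (yt w i))
    - (dotv (yfull t i w) (gin pb i (x t w)) - conjr (fout pb i) (yfull t i w)).
apply: (@le_trans _ _ (\sum_(0 <= t < T) (n%:R^-1 * \sum_(i < n) dual t i +
    (eta / 2 * (D t - D t.+1) + (Kp ^+ 2 / eta + eta^-1 * dotv (dir_noise t w) (dir_noise t w) + primal_noise t w))))).
  apply: ler_sum => t _; apply: le_trans (step_gap t w) _; rewrite lerD2l.
  exact: primal_step (yt_in w).
rewrite big_split/= -mulr_sumr exchange_big/= big_split/= -mulr_sumr addrA /gap_bound lerD2r.
have -> : \sum_(0 <= t < T) (D t - D t.+1) = D 0%N - D T.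
  have := telescope_sumr D (leq0n T) => H.
  by rewrite -[RHS]opprB -H -sumrN; apply: eq_bigr => t _; rewrite opprB.
have D0 : D 0%N = dotv (x0 - xs) (x0 - xs) by rewrite /D (x_init hit).
have DT : 0 <= eta / 2 * D T := mulr_ge0 (divr_ge0 (ltW eta_gt0) (ler0n R 2)) (dotv_ge0 _).
have H : n%:R^-1 * \sum_(i < n) \sum_(0 <= t < T) dual t i <= n%:R^-1 *
    \sum_(i < n) (3 * tau * p / 2 * dotv (yt w i - y0 i) (yt w i - y0 i) + dual_rest T i w).
  by rewrite ler_wpM2l ?invr_ge0//; apply: ler_sum => i _; exact: dual_sum (yt_in w i).
move: H; rewrite big_split/= -mulr_sumr mulrDr D0; lra.
Qed.

Let yt_L2 i : L2v P (fun w => yt w i - y0 i).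
Proof.
apply: L2vB; last exact: L2v_cst.
apply: (L2v_bounded _ _ (fun w => Yset_norm2 k1_gt0 nrmP nrm_bounds hA3 (yt_in w i))).
by move=> j; exact: yt_measurable hyt i j.
Qed.

Let dist2 := \sum_(i < n) mean P (fun w => dotv (yt w i - y0 i) (yt w i - y0 i)).

Let gap_bound_mean : intg P gap_bound /\ mean P gap_bound <=
  3 * tau * p / 2 * (n%:R^-1 * dist2) + T%:R * (5 / 4 * (V0 / (tau * B%:R)))
  + eta / 2 * dotv (x0 - xs) (x0 - xs) + T%:R * ((Kp ^+ 2 + V1) / eta).
Proof.
have Iy i : intg P (fun w => dotv (yt w i - y0 i) (yt w i - y0 i)) by case: (yt_L2 i).
have Ig t : intg P (fun w => dotv (dir_noise t w) (dir_noise t w)) by case: (dir_noise_L2 t).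
have Ip t : intg P (fun w => Kp ^+ 2 / eta + eta^-1 * dotv (dir_noise t w) (dir_noise t w) + primal_noise t w).
  by apply: intgD (primal_noise_intg t); apply: intgD; [exact: intg_cst|exact: intgZ].
have I1 : intg P (fun w => 3 * tau * p / 2 *
    (n%:R^-1 * \sum_(i < n) dotv (yt w i - y0 i) (yt w i - y0 i))).
  by apply: intgZ; apply: intgZ; exact: intg_sum.
have I2 : intg P (fun w => n%:R^-1 * \sum_(i < n) dual_rest T i w).
  by apply: intgZ; apply: intg_sum => i; exact: dual_rest_intg.
have I3 := intg_cst P (eta / 2 * dotv (x0 - xs) (x0 - xs)).
have I4 : intg P (fun w =>
    \sum_(0 <= t < T) (Kp ^+ 2 / eta + eta^-1 * dotv (dir_noise t w) (dir_noise t w) + primal_noise t w)).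
  by apply: intg_sum => t; exact: Ip.
have I12 := intgD I1 I2; have I123 := intgD I12 I3.
split; first exact: intgD I123 I4.
rewrite (meanD I123 I4) (meanD I12 I3) (meanD I1 I2) mean_cst.
have -> : mean P (fun w => 3 * tau * p / 2 *
    (n%:R^-1 * \sum_(i < n) dotv (yt w i - y0 i) (yt w i - y0 i))) =
    3 * tau * p / 2 * (n%:R^-1 * dist2).
  by rewrite !meanZ ?mean_sum//; [exact: intg_sum|apply: intgZ; exact: intg_sum].
apply: lerD; first (rewrite lerD2r lerD2l).
  rewrite meanZ; last by apply: intg_sum => i; exact: dual_rest_intg.
  rewrite mean_sum; last by move=> i; exact: dual_rest_intg.
  rewrite ler_pdivrMl; last by rewrite ltr0n.
  rewrite [leRHS](_ : _ = \sum_(i < n) T%:R * (5 / 4 * (V0 / (tau * B%:R)))).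
    by apply: ler_sum => i _; exact: dual_rest_mean.
  by rewrite sumr_const card_ord -[RHS]mulr_natl.
rewrite mean_sum//.
have -> : T%:R * ((Kp ^+ 2 + V1) / eta) = \sum_(0 <= t < T) ((Kp ^+ 2 + V1) / eta).
  by rewrite sumr_const_nat subn0 mulr_natl.
apply: ler_sum => t _.
have J1 := intgZ eta^-1 (Ig t); have J2 := intg_cst P (Kp ^+ 2 / eta).
rewrite (meanD (intgD J2 J1) (primal_noise_intg t)) primal_noise_mean addr0 (meanD J2 J1) mean_cst meanZ//.
by rewrite mulrDl lerD2l mulrC ler_wpM2r ?invr_ge0 ?(ltW eta_gt0)// dir_noise_var.
Qed.

(** [OmegaY] is finite because the dual points are bounded; the factor [n] in [p] cancels against
    the average over blocks and leaves [3 tau / S]. *)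
Lemma run_bound : exists Om : R,
  [/\ 0 <= Om, OmegaY P (fun _ : 'I_n => @half_sqnorm R m) y0 yt = Om%:E &
  (\int[P]_w (Fobj pb (xbar x T w) - Fobj pb xs) <=
    (T%:R^-1 * (eta / 2 * norm2 (x0 - xs) ^+ 2 + 3 * tau / S%:R * Om)
     + 5 / 4 * (V0 / (tau * B%:R)) + (Kp ^+ 2 + V1) / eta)%:E)%E].
Proof.
exists (2^-1 * dist2); split.
- by rewrite mulr_ge0// sumr_ge0// => i _; apply: mean_ge0 => w; exact: dotv_ge0.
- rewrite /OmegaY unlock.
  have Iy i : intg P (fun w => dotv (yt w i - y0 i) (yt w i - y0 i)) by case: (yt_L2 i).
  have E w : \sum_(i < n) bregman (@half_sqnorm R m) (yt w i) (y0 i) =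
      2^-1 * \sum_(i < n) dotv (yt w i - y0 i) (yt w i - y0 i).
    by rewrite mulr_sumr; apply: eq_bigr => i _; rewrite bregman_half_sqnorm /half_sqnorm norm2_sqr.
  under eq_integral do rewrite E.
  have Is : intg P (fun w => \sum_(i < n) dotv (yt w i - y0 i) (yt w i - y0 i)) by exact: intg_sum.
  by rewrite EFin_mean; [rewrite meanZ// mean_sum|exact: intgZ].
- have [Ig g_le] := gap_bound_mean; have T0 : T%:R != 0 :> R by rewrite pnatr_eq0 -lt0n.
  have FE w : (Fobj pb (xbar x T w) - Fobj pb xs = (Fr (xbar x T w) - Fr xs)%:E)%E.
    have [rb _] := Lag_xbar w.
    by rewrite /Fobj (regE hA1 rb) (regE hA1 rxs) -!EFinD.
  apply: (@le_trans _ _ (\int[P]_w (T%:R^-1 * gap_bound w)%:E)%E).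
    (* The integrand need not be measurable for this comparison; its nonnegativity, checked next,
       comes from the optimality of [xs]. *)
    apply: ge0_le_integralW => w; last by rewrite FE lee_fin; exact: gap.
    rewrite FE lee_fin subr_ge0 -lee_fin.
    have [rb _] := Lag_xbar w; have := hxs.2 _ rb.1.
    by rewrite /Fobj (regE hA1 rb) (regE hA1 rxs) -!EFinD.
  rewrite EFin_mean; last exact: intgZ.
  rewrite lee_fin meanZ//.
  have Ti : 0 <= T%:R^-1 :> R by rewrite invr_ge0.
  apply: le_trans (ler_wpM2l Ti g_le) _; rewrite norm2_sqr.
  have S_n : 3 * tau * p / 2 * (n%:R^-1 * dist2) = 3 * tau / S%:R * (2^-1 * dist2).
    by rewrite /p; field; rewrite n0 S0.
  rewrite S_n le_eqVlt; apply/orP; left; apply/eqP.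
  by field; rewrite T0 B0 S0 !gt_eqF.
Qed.

End run.

(* The constants are fixed before the dimensions, the problem, n, S, B and eps; they
   depend only on Cf, Cg, sigma0, sigma1, delta, the norm-equivalence constants and a
   bound D0 on the distance of x0 to xs. *)
Theorem theorem2 (R : realType) (Cf Cg sigma0 sigma1 delta k1 k2 D0 : R) :
  0 < k1 ->
  exists C ceta ctau eps0 : R,
    (0 < C /\ 0 < ceta /\ 0 < ctau /\ 0 < eps0) /\
  forall (d m n S B : nat) (nrm : 'cV[R]_m -> R)
    (dZ : measure_display) (Z : measurableType dZ) (pb : problem R d m n Z) (mu : R),
  is_norm nrm ->
  (forall u : 'cV[R]_m, k1 * norm2 u <= nrm u <= k2 * norm2 u) ->
  (0 < S <= n)%N -> (0 < B)%N ->
  oracle_model pb ->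
  A1 pb mu -> A2 pb nrm Cg -> A3 pb nrm Cf -> A4 pb nrm sigma0 sigma1 delta ->
  forall (xs x0 : 'cV[R]_d) (y0 : 'I_n -> 'cV[R]_m),
  is_argmin (Xset pb) (Fobj pb) xs ->
  norm2 (x0 - xs) <= D0 ->
  forall eps : R, 0 < eps <= eps0 ->
  exists eta tau : R,
    (0 < eta <= ceta / eps /\ 0 < tau <= ctau / (B%:R * eps)) /\
  forall (dO : measure_display) (O : measurableType dO) (P : probability O R)
    (St : nat -> O -> {set 'I_n})
    (zeta zeta' : nat -> 'I_n -> 'I_B -> {RV P >-> Z})
    (x : nat -> O -> 'cV[R]_d) (y : nat -> O -> 'I_n -> 'cV[R]_m)
    (T : nat) (yt : O -> 'I_n -> 'cV[R]_m),
  let psi := fun _ : 'I_n => @half_sqnorm R m in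
  alexr_inputs pb S St zeta zeta' ->
  alexr_iterates pb S psi 0 eta tau x0 y0 St
    (fun t i b => zeta t i b) (fun t i b => zeta' t i b) x y ->
  dual_selection pb (xbar x T) yt ->
  (C%:E * maxe 1 (OmegaY P psi y0 yt * ((B * S)%N%:R^-1)%:E) * (eps ^- 2)%:E
     <= T%:R%:E)%E ->
  (\int[P]_w (Fobj pb (xbar x T w) - Fobj pb xs) <= eps%:E)%E.
Proof.
move=> k1_gt0.
pose Cy := `|Cf| / k1; pose kn := Num.max k2 1; pose L := kn * `|Cg|.
pose K := 2 * kn * `|sigma1|; pose V0 := kn ^+ 2 * sigma0 ^+ 2.
pose V1 := (kn * Cy) ^+ 2 * sigma1 ^+ 2; pose Kp := L * Cy + (L + K) * Cy.
pose W := Kp ^+ 2 + V1.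
have V0_ge0 : 0 <= V0 by rewrite mulr_ge0 ?sqr_ge0.
have W_ge0 : 0 <= W by rewrite addr_ge0 ?sqr_ge0// mulr_ge0 ?sqr_ge0.
(* Chosen so that [W / eta] and [5 / 4 * V0 / (tau B)] are each at most [eps / 4]; the added [1]
   keeps both positive when [W] or [V0] vanishes. *)
pose ceta := 4 * W + 1; pose ctau := 5 * V0 + 1.
have ceta_gt0 : 0 < ceta by rewrite /ceta; lra.
have ctau_gt0 : 0 < ctau by rewrite /ctau; lra.
(* Four times the coefficients [ceta / 2] and [3 ctau] of the terms divided by [T], so that these
   contribute at most [eps / 4]; the [1] ensures positivity. *)
pose C := 2 * ceta * D0 ^+ 2 + 12 * ctau + 1.
have cD : 0 <= 2 * ceta * D0 ^+ 2 by rewrite mulr_ge0 ?sqr_ge0// mulr_ge0// ltW.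
have C_gt0 : 0 < C by rewrite /C; lra.
exists C, ceta, ctau, 1; split; first by [].
move=> d m n S B nrm dZ Z pb mu nrmP nrm_bounds S_range B_gt0 hO hA1 hA2 hA3 hA4.
move=> xs x0 y0 hxs xD eps /andP[eps_gt0 _].
have B_gt0' : 0 < B%:R :> R by rewrite ltr0n.
have S_gt0' : 0 < S%:R :> R by have [S0 _] := andP S_range; rewrite ltr0n.
pose eta := ceta / eps; pose tau := ctau / (B%:R * eps).
have eta_gt0 : 0 < eta by rewrite divr_gt0.
have tau_gt0 : 0 < tau by rewrite divr_gt0// mulr_gt0.
exists eta, tau; split; first by rewrite eta_gt0 tau_gt0 !lexx.
move=> dO O P St zeta zeta' x y T yt psi hin hit hyt.
have T_pos (r : R) : (0%:E < r%:E)%E -> (r%:E <= T%:R%:E)%E -> (0 < T)%N.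
  by rewrite lte_fin lee_fin -(ltr0n R); exact: lt_le_trans.
(* The empty average for [T = 0] is excluded: the required number of iterations is positive because
   of the maximum with [1]. *)
have [T0|T_gt0] := posnP T.
  rewrite T0 => H; exfalso; move: H; apply/negP; rewrite -ltNge.
  have m1 : (1%:E <= maxe 1 (OmegaY P psi y0 yt * ((B * S)%N%:R^-1)%:E))%E by rewrite le_max lexx.
  rewrite mule_gt0// ?lte_fin ?invr_gt0 ?exprn_gt0// mule_gt0 ?lte_fin//.
  exact: lt_le_trans m1.
have [Om [Om_ge0 -> bound]] := run_bound k1_gt0 nrmP nrm_bounds hO hA1 hA2 hA3 hA4 hin
  S_range B_gt0 eta_gt0 tau_gt0 hit hxs T_gt0 hyt.
rewrite -EFinM -EFin_max -!EFinM lee_fin => T_ge.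
apply: le_trans bound _; rewrite lee_fin -/Cy -/kn -/L -/K -/V0 -/V1 -/Kp -/W.
have T_gt0' : 0 < T%:R :> R by rewrite ltr0n.
set M := Num.max _ _ in T_ge.
have e2_gt0 : 0 < eps ^- 2 by rewrite invr_gt0 exprn_gt0.
have M1 : 1 <= M by rewrite /M le_max lexx.
have M2 : Om / (B%:R * S%:R) <= M by rewrite /M natrM le_max lexx orbT.
have CM : C * M <= T%:R * eps ^+ 2.
  by rewrite -ler_pdivrMr ?exprn_gt0.
have MC : 2 * ceta * D0 ^+ 2 + 12 * ctau * (Om / (B%:R * S%:R)) <= C * M.
  have := ler_wpM2l cD M1.
  have := ler_wpM2l (ltW ctau_gt0) M2.
  by rewrite /C; lra.
have T1 : 5 / 4 * (V0 / (tau * B%:R)) <= eps / 4.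
  have -> : 5 / 4 * (V0 / (tau * B%:R)) = (5 * V0) * eps / (4 * ctau).
    by rewrite /tau; field; rewrite !gt_eqF.
  rewrite ler_pdivrMr ?mulr_gt0//.
  have : 5 * V0 * eps <= ctau * eps by rewrite ler_pM2r// /ctau; lra.
  by lra.
have T2 : W / eta <= eps / 4.
  have -> : W / eta = W * eps / ceta by rewrite /eta; field; rewrite !gt_eqF.
  rewrite ler_pdivrMr//.
  have : 4 * W * eps <= ceta * eps by rewrite ler_pM2r// /ceta; lra.
  by lra.
have T3 : T%:R^-1 * (eta / 2 * norm2 (x0 - xs) ^+ 2 + 3 * tau / S%:R * Om) <= eps / 4.
  have D_le : norm2 (x0 - xs) ^+ 2 <= D0 ^+ 2.
    by rewrite ler_pXn2r ?nnegrE ?norm2_ge0//; exact: le_trans (norm2_ge0 _) xD.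
  rewrite ler_pdivrMl//.
  have E : 3 * tau / S%:R * Om = 3 * ctau * (Om / (B%:R * S%:R)) / eps.
    by rewrite /tau; field; rewrite !gt_eqF.
  have E' : eta / 2 * norm2 (x0 - xs) ^+ 2 = ceta * norm2 (x0 - xs) ^+ 2 / 2 / eps.
    by rewrite /eta; field; rewrite !gt_eqF.
  rewrite E E' -mulrDl ler_pdivrMr//.
  have : ceta * norm2 (x0 - xs) ^+ 2 <= ceta * D0 ^+ 2 by rewrite ler_pM2l.
  by move: MC CM; rewrite expr2; lra.
lra.
Qed.
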